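(* Under the standing setup below, if $\varepsilon_0>0$ is sufficiently small, there exist $\eta\in(0,1)$ and $C>0$ such that for every $f\in V_1$, $Pf\in V_1$ and $$\|Pf\|_{V_1}\le\eta\|f\|_{V_1}+C\|f\|_{L^1}.$$
   Context: Standing setup. Fix an integer $k\ge2$ and reals $L>0$, $\beta>0$. Let $\Phi_0:(-L-\beta,L+\beta)^k\to\mathbb R$ be $C^2$. For $n\ge1$ let $\gamma_n$ be the Lebesgue volume of the unit ball of $\mathbb R^n$. For $\sigma>1$, $Y>0$ put $\eta_0(\sigma,Y)=\sigma^{-1/2}+\frac{4}{\sqrt\sigma-1}\,Y\,\frac{\gamma_{k-1}}{\gamma_k}$ and let $S_k(Y)>1$ be the value of $\sigma$ with $\eta_0(\sigma,Y)=1$. Fix $\sigma>S_k(k+2)$ and constants $C_1,C_2>1$, and assume: $\gamma^{-2}=C_1\sigma$; for all $x\in(-L-\beta,L+\beta)^k$, $(\partial_1\Phi_0(x))^2\ge C_1^{k-1}C_2\sigma^k$ and $(\partial_j\Phi_0(x))^2\le\frac{(C_1-1)(C_2-1)}{k-1}\sigma$ for $2\le j\le k$. Let $\Gamma(x)=(\gamma^{-(j-1)}x_j)_{j=1}^k$; $\Omega=\prod_{j=1}^k[-\gamma^{j-1}L,\gamma^{j-1}L]$; $\Omega_0=\Gamma^{-1}((-L,L)^k)$; $U_j^\theta=\{x\in\Omega_0:(2j-1)L<\theta+\Phi_0(\Gamma x)<(2j+1)L\}$; $T_\theta:\Omega\to\Omega$ defined a.e. by $T_\theta(u)=(u_2/\gamma,\dots,u_k/\gamma,\gamma^{k-1}(\Phi_0(\Gamma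 u)+\theta-2jL))$ on $U_j^\theta$. $P_\theta$ is the Perron–Frobenius operator of $T_\theta$ on $L^1(\Omega,m)$ ($m$ Lebesgue): $\int_AP_\theta f\,dm=\int_{T_\theta^{-1}(A)}f\,dm$. $H$ is a probability density on $\mathbb R$ and $Pf=\int_{\mathbb R}H(\theta)P_\theta f\,d\theta$. For $f\in L^1(\mathbb R^k)$ and non-null Borel $A$, $\operatorname{osc}(f,A)=\operatorname{ess\,sup}_{x,y\in A}|f(x)-f(y)|$. Given $\varepsilon_0>0$: $|f|_1=\sup_{0<\varepsilon<\varepsilon_0}\varepsilon^{-1}\int_{\mathbb R^k}\operatorname{osc}(f,B(x,\varepsilon))\,dx$, $V_1=\{f\in L^1(\mathbb R^k):\operatorname{supp}f\subset\Omega,\ |f|_1<\infty\}$, $\|f\|_{V_1}=\|f\|_{L^1}+|f|_1$; functions on $\Omega$ are extended by $0$. *)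

(* Defs.v *)
From HB Require Import structures.
From mathcomp Require Import all_boot all_order all_algebra.
From mathcomp Require Import all_classical all_reals all_analysis.
Import Order.TTheory GRing.Theory Num.Theory numFieldNormedType.Exports.

Set Implicit Arguments.
Unset Strict Implicit.
Unset Printing Implicit Defensive.

Local Open Scope classical_set_scope.
Local Open Scope ring_scope.

Section Defs.
Variable R : realType.

(* ---------- R^n as n.-tuple R (with its product = Borel sigma-algebra) ---------- *)

Definition box (n : nat) (a b : n.-tuple R) : set (n.-tuple R) :=
  [set x | forall i : 'I_n, tnth a i <= tnth x i <= tnth b i].

(* mu is the Lebesgue measure (on Borel sets of R^n): it gives every box its volume.
   This property characterizes Lebesgue measure on the Borel sigma-algebra. *)
Definition is_lebesgue (n : nat) (mu : set (n.-tuple R) -> \bar R) : Prop :=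
  forall a b : n.-tuple R, (forall i, tnth a i <= tnth b i) ->
    mu (box a b) = (\prod_(i < n) (tnth b i - tnth a i))%:E.

Definition eball (n : nat) (x : n.-tuple R) (e : R) : set (n.-tuple R) :=
  [set y | \sum_(i < n) (tnth y i - tnth x i) ^+ 2 < e ^+ 2].

Definition origin (n : nat) : n.-tuple R := [tuple 0 | i < n].

Definition unit_ball_vol (leb : forall n : nat, set (n.-tuple R) -> \bar R)
  (n : nat) : R := fine (leb n (eball (origin n) 1)).

Definition eta0 (gm : nat -> R) (k : nat) (s Y : R) : R :=
  (Num.sqrt s)^-1 + 4 / (Num.sqrt s - 1) * Y * (gm (k.-1) / gm k).

Definition S_k (gm : nat -> R) (k : nat) (Y : R) : R :=
  xget 0 [set s | 1 < s /\ eta0 gm k s Y = 1].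

(* partial derivative d_i F (i is 0-based: i = 0 is the paper's d_1) *)
Definition pd (n : nat) (i : 'I_n) (F : 'rV[R]_n -> R) : 'rV[R]_n -> R :=
  fun x => 'D_('e_i) F x.

Definition C2_on (n : nat) (D : set 'rV[R]_n) (F : 'rV[R]_n -> R) : Prop :=
  [/\ {in D, continuous F},
      forall i : 'I_n, {in D, forall x, derivable F x 'e_i},
      forall i : 'I_n, {in D, continuous (pd i F)},
      forall i j : 'I_n, {in D, forall x, derivable (pd i F) x 'e_j} &
      forall i j : 'I_n, {in D, continuous (pd j (pd i F))}].

Definition ocube (n : nat) (a : R) : set 'rV[R]_n :=
  [set x | forall i : 'I_n, - a < x ord0 i < a].

Section Dyn.
Variables (k : nat) (Phi0 : 'rV[R]_k -> R) (gam L : R).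

(* Gamma(x) = (gam^{-(j-1)} x_j)_j   (0-based: gam^{-i} x_i) *)
Definition Gam (x : k.-tuple R) : 'rV[R]_k := \row_(i < k) (gam ^- i * tnth x i).

Definition Omega : set (k.-tuple R) :=
  [set u | forall i : 'I_k, - (gam ^+ i * L) <= tnth u i <= gam ^+ i * L].

Definition Omega0 : set (k.-tuple R) := [set u | ocube L (Gam u)].

Definition U (th : R) (j : int) : set (k.-tuple R) :=
  [set x | Omega0 x /\
     (2 * j%:~R - 1) * L < th + Phi0 (Gam x) < (2 * j%:~R + 1) * L].

(* T_theta: on U_j^theta,
   T(u) = (u_2/gam, ..., u_k/gam, gam^{k-1}(Phi0(Gamma u) + theta - 2jL)).
   The only j for which u can lie in U_j^theta is floor((theta+Phi0(Gamma u)+L)/(2L)).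
   Off the union of the U_j (a null set) T is set to the identity (irrelevant). *)
Definition Tmap (th : R) (u : k.-tuple R) : k.-tuple R :=
  let j := Num.floor ((th + Phi0 (Gam u) + L) / (2 * L)) in
  if `[< U th j u >] then
    [tuple (if ((i : nat).+1 < k)%N then tnth u (insubd i (i : nat).+1) / gam
            else gam ^+ k.-1 * (Phi0 (Gam u) + th - 2 * j%:~R * L)) | i < k]
  else u.

End Dyn.

Section Spaces.
Variables (k : nat) (mu : {measure set (k.-tuple R) -> \bar R}).

Definition osc (f : k.-tuple R -> R) (A : set (k.-tuple R)) : \bar R :=
  ereal_inf [set M : \bar R | (\forall z \ae (mu \x mu)%E,
                 A z.1 -> A z.2 -> ((`|f z.1 - f z.2|)%:E <= M)%E)].

Definition seminorm1 (e0 : R) (f : k.-tuple R -> R) : \bar R :=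
  ereal_sup [set y : \bar R | exists e : R, 0 < e < e0 /\
               y = ((e^-1)%:E * \int[mu]_x osc f (eball x e))%E].

Definition L1norm (f : k.-tuple R -> R) : \bar R := (\int[mu]_x (`|f x|)%:E)%E.

Definition V1norm (e0 : R) (f : k.-tuple R -> R) : \bar R :=
  (L1norm f + seminorm1 e0 f)%E.

(* f in V_1 (f : R^k -> R representing an L^1 class, supp f in Omega a.e.) *)
Definition inV1 (Om : set (k.-tuple R)) (e0 : R) (f : k.-tuple R -> R) : Prop :=
  [/\ measurable_fun setT f, mu.-integrable setT (EFin \o f),
      (\forall x \ae mu, ~ Om x -> f x = 0) & (seminorm1 e0 f < +oo)%E].

(* g represents P f = int H(theta) P_theta f dtheta, where
   int_A P_theta f dm = int_{T_theta^{-1}(A)} f dm; i.e. g is an L^1 function with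
   int_A g dm = int H(theta) (int_{T_theta^{-1} A} f dm) dtheta for all Borel A. *)
Definition isPf (H : R -> R) (T : R -> k.-tuple R -> k.-tuple R)
    (f g : k.-tuple R -> R) : Prop :=
  [/\ measurable_fun setT g, mu.-integrable setT (EFin \o g) &
      forall A : set (k.-tuple R), measurable A ->
        (\int[mu]_(x in A) (g x)%:E =
         \int[lebesgue_measure]_th ((H th)%:E * \int[mu]_(x in T th @^-1` A) (f x)%:E))%E].

End Spaces.

Definition prob_density (H : R -> R) : Prop :=
  [/\ forall t, 0 <= H t, measurable_fun setT H &
      (\int[@lebesgue_measure R]_t (H t)%:E = 1)%E].

End Defs.

(* Main.v *)
Require Import Defs.
From HB Require Import structures.
From mathcomp Require Import all_boot all_order all_algebra.
From mathcomp Require Import all_classical all_reals all_analysis.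
From mathcomp Require Import measurable_realfun.
From mathcomp Require Import zify ring lra.
Import Order.TTheory GRing.Theory Num.Theory numFieldNormedType.Exports.
Set Implicit Arguments.
Unset Strict Implicit.
Unset Printing Implicit Defensive.
Local Open Scope classical_set_scope.
Local Open Scope ring_scope.

(** [sigma > S_k (k + 2)] forces [sigma > 81], because the unit ball of dimension [k]
    has volume at most twice that of dimension [k - 1].  Extending [Phi0 \o Gam]
    linearly in the first coordinate turns every branch of [T_theta] into a bijection
    of the whole space that expands distances by 9, so that its inverse branches
    contract balls by 1/9 and [P_theta f] is the sum over the branches of
    [f * psi] composed with an inverse branch, cut off at the two faces
    [x_k = +- gamma^(k-1) L] of the box.  Away from these faces the oscillation of a
    piece on a ball of radius [e] is controlled by that of [f] on a ball of radius
    [e / 9], which contributes 1/9 of the seminorm.  Near the faces it is controlled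
    by local suprema of [|f|] over neighbourhoods, of width [2 e / 9], of the preimages
    of the faces; the branches expand the first coordinate direction by 9, so
    averaging along segments of half-length [rho = 8/9 e0] in that direction
    (which replaces the supremum by [|f|] plus an oscillation at radius
    [rho + e / 9 < e0]) makes the boundary contribute about half of the seminorm
    plus a multiple of the L1 norm.  The remaining faces of the box cost nothing
    since membership in [V_1] already accounts for the jump of [f] across them.
    The sum is below 9/10, uniformly in [theta], and integrating against [H]
    preserves the estimate.  Since [osc] is an essential supremum over pairs, the
    pointwise bounds are carried out on a full-measure set where the values of [f]
    are approximated on sets of positive measure. *)

(** [mu] is known only through the volumes of boxes, so the change of variables along a branch rests
    on uniqueness: the image of the Jacobian-weighted measure is computed on boxes, by Tonelli and
    the fundamental theorem of calculus along lines in the first direction. The linear extension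
    keeps the expansion but makes the Jacobian jump where the first coordinate is [L] or [- L]. The
    weight is therefore not the inverse Jacobian but the Lipschitz function [psi], with
    [Jac y * psi y <= 1] everywhere and equality on [Omega0], outside which [f] may be taken to
    vanish. As for the constants, the seminorm only controls radii below [e0], and
    [rho + e / 9 < e0] for all [e < e0] allows at most [rho = 8/9 e0]. A segment of length [2 rho]
    spends length at most [2 e / 9] near the preimages of one face; the two faces, together with a
    factor 2 from bounding a difference by two values, give [(4 e / 9) / rho = e / (2 e0)]. This is
    the share 1/2 of the boundary, and the distortion of [psi] only adds multiples of [e], absorbed
    by taking [e0] small. *)

(** * Lebesgue measure on tuples and its uniqueness *)

Section tuple_lebesgue.
Variable R : realType.

Lemma measurable_box n (a b : n.-tuple R) : measurable (box a b).
Proof.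
have -> : box a b = \bigcap_(i in [set: 'I_n])
    ((@tnth n R ^~ i) @^-1` `[tnth a i, tnth b i]%classic).
  apply/seteqP; split=> x h i; first by move=> _ /=; rewrite in_itv/=.
  by have := h i I; rewrite /= in_itv/=.
apply: fin_bigcap_measurable; first exact: finite_finset.
by move=> i _; rewrite -[X in measurable X]setTI; exact: measurable_tnth.
Qed.

Definition boxes n : set (set (n.-tuple R)) :=
  [set A | exists a b, A = box a b].

Definition cbox n (m : nat) : set (n.-tuple R) :=
  box [tuple - m%:R | i < n] [tuple m%:R | i < n].

Lemma bigcup_cbox n : \bigcup_m @cbox n m = setT.
Proof.
apply/seteqP; split=> // x _.
have [m hm] : exists m : nat, forall i : 'I_n, `|tnth x i| <= m%:R.
  exists (\sum_i (Num.trunc (`|tnth x i|)%R).+1)%N => i.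
  rewrite (@le_trans _ _ (Num.trunc `|tnth x i|).+1%:R)//.
    by apply/ltW; exact: truncnS_gt.
  by rewrite ler_nat (bigD1 i)//= leq_addr.
exists m => //= i; rewrite !tnth_mktuple.
by have := hm i; rewrite ler_norml.
Qed.

Lemma setI_closed_boxes n : setI_closed (@boxes n).
Proof.
move=> _ _ [a [b ->]] [c [d ->]].
exists [tuple Num.max (tnth a i) (tnth c i) | i < n].
exists [tuple Num.min (tnth b i) (tnth d i) | i < n].
apply/seteqP; split=> [x [h1 h2] i|x h].
  rewrite !tnth_mktuple ge_max le_min.
  by have /andP[-> ->] := h1 i; have /andP[-> ->] := h2 i.
by split=> i; have := h i; rewrite !tnth_mktuple ge_max le_min;
  case/andP=> /andP[h1 h2] /andP[h3 h4]; apply/andP.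
Qed.

(** The product sigma-algebra is generated by the coordinates, and the preimage of a half-line under
    a coordinate is a countable union of boxes whose free sides are exhausted by [[-m, m]]. *)
Lemma measurable_boxesE n : @measurable _ (n.-tuple R) = <<s @boxes n >>.
Proof.
apply/seteqP; split; last first.
  apply: smallest_sub; first exact: sigma_algebra_measurable.
  by move=> _ [a [b ->]]; exact: measurable_box.
move=> A mA.
have mid : measurable_fun [set: g_sigma_algebraType (@boxes n)]
    (id : g_sigma_algebraType (@boxes n) -> n.-tuple R).
  apply/measurable_fun_tnthP => i.
  apply: (measurability _ (RGenCInfty.measurableE R)) => _ [_ [r ->] <-].
  rewrite setTI.
  pose a m := [tuple (if j == i then r else - m%:R) | j < n].
  pose b (m : nat) := [tuple (m%:R : R) | j < n].
  have -> : (@tnth n R ^~ i \o id) @^-1` `[r, +oo[%classic =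
      \bigcup_m box (a m) (b m).
    apply/seteqP; split=> [x /= rx|x [m _ h]]; last first.
      by have := h i; rewrite /= !tnth_mktuple eqxx in_itv/= andbT => /andP[].
    have : (\bigcup_m @cbox n m) x by rewrite bigcup_cbox.
    move=> [m _ h]; exists m => //= j; have := h j.
    rewrite !tnth_mktuple; case: eqP => // -> /andP[_ ->].
    by move: rx; rewrite in_itv/= andbT => ->.
  apply: bigcupT_measurable => m.
  by apply: sub_sigma_algebra; exists (a m), (b m).
by have := mid measurableT A mA; rewrite setTI.
Qed.

Lemma is_lebesgue_box_lty n (mu : {measure set (n.-tuple R) -> \bar R}) :
  is_lebesgue mu -> forall m, (mu (@cbox n m) < +oo)%E.
Proof.
move=> h m; rewrite /cbox h ?ltry// => i; rewrite !tnth_mktuple.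
by rewrite (@le_trans _ _ 0)// oppr_le0.
Qed.

Lemma is_lebesgue_unique n (mu nu : {measure set (n.-tuple R) -> \bar R}) :
  is_lebesgue mu -> is_lebesgue nu ->
  forall A, measurable A -> mu A = nu A.
Proof.
move=> hmu hnu A mA.
apply: (measure_unique (@boxes n) (@cbox n)) => //.
- exact: measurable_boxesE.
- exact: setI_closed_boxes.
- by move=> m; exists [tuple - m%:R | i < n], [tuple m%:R | i < n].
- exact: bigcup_cbox.
- move=> _ [a [b ->]].
  have [ab|] := pselect (forall i, tnth a i <= tnth b i).
    by rewrite hmu// hnu.
  (* [is_lebesgue] only speaks of boxes with ordered corners; a box with corners in the wrong order
     is empty. *)
  move=> /existsNP[i abi].
  suff -> : box a b = set0 by rewrite !measure0.
  by rewrite -subset0 => x /(_ i)/andP[/le_trans h /h].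
- exact: is_lebesgue_box_lty.
Qed.

Lemma is_lebesgue_sigma_finite n (mu : {measure set (n.-tuple R) -> \bar R}) :
  is_lebesgue mu -> sigma_finite setT mu.
Proof.
move=> hmu; exists (@cbox n); first by rewrite bigcup_cbox.
by move=> m; split; [exact: measurable_box|exact: is_lebesgue_box_lty].
Qed.

End tuple_lebesgue.

(* A Lebesgue measure seen as a sigma-finite measure, as the Fubini theorems require. *)
Definition sf_lebesgue (R : realType) n (mu : {measure set (n.-tuple R) -> \bar R})
  (hmu : is_lebesgue mu) : set (n.-tuple R) -> \bar R := mu.

HB.instance Definition _ (R : realType) n (mu : {measure set (n.-tuple R) -> \bar R})
  (hmu : is_lebesgue mu) := Measure.on (sf_lebesgue hmu).
HB.instance Definition _ (R : realType) n (mu : {measure set (n.-tuple R) -> \bar R})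
  (hmu : is_lebesgue mu) :=
  Measure_isSigmaFinite.Build _ _ _ (sf_lebesgue hmu) (is_lebesgue_sigma_finite hmu).

(** * Images of measures with a density, and change of variables *)

Section density_pushforward.
Context d d' (X : measurableType d) (Y : measurableType d') (R : realType).
Variables (m : {measure set X -> \bar R}) (T : X -> Y) (J : X -> R).
Hypotheses (mT : measurable_fun setT T) (mJ : measurable_fun setT J).
Hypothesis J0 : forall x, 0 <= J x.
Local Open Scope ereal_scope.

(** The image under [T] of the measure with density [J] with respect to [m]. If [T] is bijective
    with Jacobian [J], this should be Lebesgue measure again. *)
Definition dpush (A : set Y) : \bar R := \int[m]_(x in T @^-1` A) (J x)%:E.

Let mTA A : measurable A -> measurable (T @^-1` A).
Proof. by move=> mA; rewrite -[X in measurable X]setTI; exact: mT. Qed.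

Let dpush0 : dpush set0 = 0.
Proof. by rewrite /dpush preimage_set0 integral_set0. Qed.

Let dpush_ge0 A : 0 <= dpush A.
Proof. by apply: integral_ge0 => x _; rewrite lee_fin. Qed.

Let dpush_sigma_additive : semi_sigma_additive dpush.
Proof.
move=> F mF tF mUF; rewrite /dpush preimage_bigcup ge0_integral_bigcup//=.
- apply: is_cvg_nneseries => n _ _; exact: dpush_ge0.
- by move=> k; exact: mTA.
- by apply/measurable_funTS/measurable_EFinP.
- by move=> x _; rewrite lee_fin.
- apply/trivIsetP => /= i j _ _ ij; rewrite -preimage_setI.
  by move/trivIsetP : tF => /(_ _ _ _ _ ij) ->//; rewrite preimage_set0.
Qed.

HB.instance Definition _ := isMeasure.Build _ _ _ dpush
  dpush0 dpush_ge0 dpush_sigma_additive.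

Import HBNNSimple.

Lemma ge0_integral_dpush (Q : Y -> \bar R) :
  measurable_fun setT Q -> (forall y, 0 <= Q y) ->
  \int[dpush]_y Q y = \int[m]_x (Q (T x) * (J x)%:E).
Proof.
move=> mQ Q0; have mE := @measurableT _ Y.
pose h := nnsfun_approx mE mQ.
have mh n : measurable_fun setT (fun x => (h n (T x))%:E).
  by apply/measurable_EFinP; apply: (measurableT_comp _ mT).
have -> : \int[dpush]_x Q x = lim (\int[dpush]_x (EFin \o h n) x @[n --> \oo]).
  have fE x : Q x = lim ((EFin \o h n) x @[n --> \oo]).
    by apply/esym/cvg_lim => //; exact: cvg_nnsfun_approx.
  under eq_integral => x _ do rewrite fE.
  apply: monotone_convergence => //.
  - by move=> n; exact/measurable_EFinP.
  - by move=> n x _ //=; rewrite lee_fin.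
  - by move=> x _ a b ab; rewrite lee_fin; exact/lefP/nd_nnsfun_approx.
have -> : \int[m]_x (Q (T x) * (J x)%:E) =
    lim (\int[m]_x ((h n (T x))%:E * (J x)%:E) @[n --> \oo]).
  have fg x : Q (T x) * (J x)%:E = lim ((h n (T x))%:E * (J x)%:E @[n --> \oo]).
    apply/esym/cvg_lim => //; apply: cvgeZr => //.
    by apply: (cvg_nnsfun_approx mE mQ) => // *; exact: Q0.
  under eq_integral => x _ do rewrite fg.
  apply: monotone_convergence => //.
  - by move=> n; apply: emeasurable_funM => //; exact/measurable_EFinP.
  - by move=> n x _ /=; rewrite mule_ge0 ?lee_fin.
  - move=> x _ a b ab/=; rewrite lee_wpmul2r ?lee_fin//.
    exact/lefP/nd_nnsfun_approx.
suff suf n : \int[dpush]_x (h n x)%:E = \int[m]_x ((h n (T x))%:E * (J x)%:E).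
  by under eq_fun do rewrite /= suf.
transitivity (\int[dpush]_x
   (\sum_(y \in range (h n)) (y * \1_(h n @^-1` [set y]) x)%:E)).
  by apply: eq_integral => t tE; rewrite /= fimfunE -fsumEFin.
rewrite ge0_integral_fsum//; last 2 first.
  - by move=> r; apply/measurable_EFinP; exact: measurable_funM.
  - by move=> r x _; exact: nnfun_muleindic_ge0.
have mind r : measurable_fun setT (fun x => (r * \1_(h n @^-1` [set r]) (T x))%:E).
  apply/measurable_EFinP; apply: measurable_funM => //.
  exact: (measurableT_comp _ mT).
transitivity (\int[m]_x (\sum_(y \in range (h n))
    (y * \1_(h n @^-1` [set y]) (T x))%:E * (J x)%:E)); last first.
  apply: eq_integral => x xE.
  rewrite -ge0_mule_fsuml => [|y]; last exact: nnfun_muleindic_ge0.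
  by rewrite fsumEFin // -(fimfunE _ (T x)).
rewrite ge0_integral_fsum//; last 2 first.
  - by move=> y; apply: emeasurable_funM => //; exact/measurable_EFinP.
  - by move=> r y Ey; rewrite mule_ge0 ?lee_fin//; exact: nnfun_muleindic_ge0.
apply: eq_fsbigr => r rhn.
rewrite integralZl_indic_nnsfun => //.
under [RHS]eq_integral do rewrite EFinM -muleA.
have r0 : (0 <= r)%R by move: rhn; rewrite inE => -[y _ <-].
rewrite ge0_integralZl//; last 2 first.
- apply: emeasurable_funM; last exact/measurable_EFinP.
  by apply/measurable_EFinP; exact: (measurableT_comp _ mT).
- by move=> x _; rewrite mule_ge0 ?lee_fin.
congr (_ * _); rewrite integral_indic// setIT /dpush [LHS]integral_mkcond.
by apply: eq_integral => x _; rewrite epatch_indic muleC.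
Qed.

End density_pushforward.

(** By uniqueness, a change of variables only has to be checked on boxes, with no regularity theory
    for [T]. *)
Lemma lebesgue_change_of_variables (R : realType) n
  (mu : {measure set (n.-tuple R) -> \bar R}) d (X : measurableType d)
  (m : {measure set X -> \bar R}) (T : X -> n.-tuple R) (J : X -> R) :
  is_lebesgue mu -> measurable_fun setT T -> measurable_fun setT J ->
  (forall x, 0 <= J x) -> is_lebesgue (dpush m T J) ->
  forall Q : n.-tuple R -> \bar R,
    measurable_fun setT Q -> (forall y, 0 <= Q y)%E ->
    (\int[mu]_y Q y = \int[m]_x (Q (T x) * (J x)%:E))%E.
Proof.
move=> hmu mT mJ J0 hd Q mQ Q0.
rewrite -ge0_integral_dpush//.
apply: eq_measure_integral => A mA _.
exact: is_lebesgue_unique.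
Qed.

(** * Splitting off and translating the first coordinate *)

Section cons_lebesgue.
Variables (R : realType) (n : nat).
Local Open Scope ereal_scope.

Definition tcons (p : R * n.-tuple R) : n.+1.-tuple R := [tuple of p.1 :: p.2].

Definition ttail (y : n.+1.-tuple R) : n.-tuple R :=
  [tuple tnth y (lift ord0 i) | i < n].

Lemma tcons0 p : tnth (tcons p) ord0 = p.1.
Proof. by []. Qed.

Lemma tconsS p i : tnth (tcons p) (lift ord0 i) = tnth p.2 i.
Proof. by rewrite /tcons tnthS. Qed.

Lemma measurable_tcons : measurable_fun setT tcons.
Proof. exact: measurable_cons. Qed.

Lemma is_lebesgue_tcons (nu : {measure set (n.-tuple R) -> \bar R})
    (hnu : is_lebesgue nu) :
  is_lebesgue (dpush (@lebesgue_measure R \x sf_lebesgue hnu) tcons (cst 1%R)).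
Proof.
move=> a b ab; rewrite /dpush.
have -> : tcons @^-1` box a b = `[tnth a ord0, tnth b ord0]%classic `*`
    box (ttail a) (ttail b).
  apply/seteqP; split=> [[t v] h|[t v] [h1 h2] i].
    split=> [|i]; first by have := h ord0; rewrite tcons0/= in_itv/=.
    by have := h (lift ord0 i); rewrite tconsS !tnth_mktuple.
  have [j ->|->] := unliftP ord0 i; last by rewrite tcons0; move: h1; rewrite /= in_itv.
  by have := h2 j; rewrite tconsS !tnth_mktuple.
rewrite (@integral_cst _ _ _ _ _ _ 1%:E)/=; last first.
  by apply: measurableX => //; exact: measurable_box.
rewrite product_measure1E//; last exact: measurable_box.
rewrite mul1e/= lebesgue_measure_itv/= lte_fin.
rewrite /sf_lebesgue hnu; last by move=> i; rewrite !tnth_mktuple.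
rewrite big_ord_recl/= EFinM.
under eq_bigr do rewrite !tnth_mktuple.
have := ab ord0; rewrite le_eqVlt => /orP[/eqP ->|->//].
by rewrite ltxx subrr !mul0e.
Qed.

Lemma ge0_integral_tcons (mu : {measure set (n.+1.-tuple R) -> \bar R})
    (nu : {measure set (n.-tuple R) -> \bar R})
    (hmu : is_lebesgue mu) (hnu : is_lebesgue nu) (Q : n.+1.-tuple R -> \bar R) :
  measurable_fun setT Q -> (forall y, 0 <= Q y) ->
  \int[mu]_y Q y = \int[@lebesgue_measure R \x sf_lebesgue hnu]_p Q (tcons p).
Proof.
move=> mQ Q0.
rewrite (@lebesgue_change_of_variables _ _ mu _ _
  (@lebesgue_measure R \x sf_lebesgue hnu)%E tcons (cst 1%R))//.
- by apply: eq_integral => x _; rewrite mule1.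
- exact: measurable_tcons.
- exact: is_lebesgue_tcons.
Qed.

Definition e1shift (t : R) (y : n.+1.-tuple R) : n.+1.-tuple R :=
  [tuple (tnth y i + (i == ord0)%:R * t)%R | i < n.+1].

Lemma measurable_e1shift :
  measurable_fun setT (fun p : R * n.+1.-tuple R => e1shift p.1 p.2).
Proof.
apply/measurable_fun_tnthP => i.
rewrite (_ : _ \o _ = fun p => (tnth p.2 i + (i == ord0)%:R * p.1)%R); last first.
  by apply/funext => p /=; rewrite tnth_mktuple.
apply: measurable_funD.
  exact: (measurableT_comp (measurable_tnth i) measurable_snd).
by apply: measurable_funM => //; exact: measurable_fst.
Qed.

Lemma ge0_integral_e1shift (mu : {measure set (n.+1.-tuple R) -> \bar R})
    (hmu : is_lebesgue mu) (t : R) (Q : n.+1.-tuple R -> \bar R) :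
  measurable_fun setT Q -> (forall y, 0 <= Q y) ->
  \int[mu]_y Q (e1shift t y) = \int[mu]_y Q y.
Proof.
move=> mQ Q0.
have ms : measurable_fun setT (e1shift t).
  exact: (measurableT_comp measurable_e1shift (pair1_measurable t)).
rewrite [RHS](@lebesgue_change_of_variables _ _ mu _ _ mu (e1shift t) (cst 1%R))//.
  by apply: eq_integral => x _; rewrite mule1.
move=> a b ab; rewrite /dpush (@integral_cst _ _ _ _ _ _ 1%:E)/=; last first.
  by rewrite -[X in measurable X]setTI; apply: ms => //; exact: measurable_box.
have -> : e1shift t @^-1` box a b = box (e1shift (- t) a) (e1shift (- t) b).
  apply/seteqP; split=> [y h i|y h i]; have := h i; rewrite !tnth_mktuple mulrN.
    by rewrite lerBlDr lerBrDr.
  by rewrite lerBlDr lerBrDr.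
rewrite hmu ?mul1e; last by move=> i; rewrite !tnth_mktuple lerD2r.
by congr EFin; apply: eq_bigr => i _; rewrite !tnth_mktuple; ring.
Qed.

End cons_lebesgue.

(** * Euclidean balls and the volume of the unit ball *)

Section eball.
Variable (R : realType).

Definition sqdist n (x y : n.-tuple R) : R := \sum_(i < n) (tnth y i - tnth x i) ^+ 2.

Lemma measurable_eball n (x : n.-tuple R) e : measurable (eball x e).
Proof.
rewrite -[X in measurable X]setTI.
have mf : measurable_fun setT (fun y => sqdist x y).
  apply: measurable_sum => i; apply: measurable_funX.
  by apply: measurable_funB => //; exact: measurable_tnth.
have -> : eball x e = (fun y => sqdist x y) @^-1` `]-oo, e ^+ 2[%classic.
  by apply/seteqP; split=> y; rewrite /eball /= in_itv.
exact: mf.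
Qed.

Lemma eball_sym n (x y : n.-tuple R) e : eball x e y -> eball y e x.
Proof.
rewrite /eball /=; congr (is_true (_ < _)); apply: eq_bigr => i _.
by rewrite -sqrrN opprB.
Qed.

Lemma eball_center n (x : n.-tuple R) e : 0 < e -> eball x e x.
Proof.
by move=> e0; rewrite /eball /= big1 ?exprn_gt0// => i _; rewrite subrr expr0n.
Qed.

Lemma eballS n (x : n.-tuple R) e e' : 0 <= e -> e <= e' -> eball x e `<=` eball x e'.
Proof.
move=> e0 ee' y; rewrite /eball /= => /lt_le_trans; apply.
by rewrite ler_sqr ?nnegrE// (le_trans e0).
Qed.

(** In each coordinate [(p + q)^2 <= (a + b) / a * p^2 + (a + b) / b * q^2], which takes the place
    of Cauchy-Schwarz; the weights are those for which the bounds [a^2] and [b^2] add up to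
    [(a + b)^2]. *)
Lemma eball_triangle n (x y z : n.-tuple R) a b : 0 < a -> 0 < b ->
  eball x a y -> eball y b z -> eball x (a + b) z.
Proof.
move=> a0 b0; rewrite /eball /= => xy yz.
have ab0 := addr_gt0 a0 b0.
set P := \sum_(i < n) _ in xy; set Q := \sum_(i < n) _ in yz.
apply: (@le_lt_trans _ _ ((a + b) / a * P + (a + b) / b * Q)).
  rewrite !mulr_sumr -big_split/=; apply: ler_sum => i _.
  set p := tnth y i - tnth x i; set q := tnth z i - tnth y i.
  have -> : tnth z i - tnth x i = p + q by rewrite /p /q; ring.
  rewrite -subr_ge0.
  have -> : (a + b) / a * p ^+ 2 + (a + b) / b * q ^+ 2 - (p + q) ^+ 2 =
     (b * p - a * q) ^+ 2 / (a * b) by field; lra.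
  by rewrite divr_ge0 ?sqr_ge0// ltW// mulr_gt0.
have -> : (a + b) ^+ 2 = (a + b) / a * a ^+ 2 + (a + b) / b * b ^+ 2 by field; lra.
by apply: ltrD; rewrite ltr_pM2l// divr_gt0.
Qed.

Lemma eball_e1shift n (y : n.+1.-tuple R) t r : `|t| < r -> eball y r (e1shift t y).
Proof.
move=> tr; rewrite /eball /= (eq_bigr (fun i => ((i == ord0)%:R * t) ^+ 2)); last first.
  by move=> i _; rewrite tnth_mktuple addrAC subrr add0r.
rewrite (bigD1 ord0)//= mul1r big1 ?addr0; last first.
  by move=> i /negbTE ->; rewrite mul0r expr0n.
by rewrite -real_normK ?num_real// ltr_sqr ?nnegrE// (le_trans _ (ltW tr)).
Qed.

Lemma eball_coord n (x y : n.-tuple R) (e : R) i : 0 < e -> eball x e y ->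
  `|tnth y i - tnth x i| < e.
Proof.
move=> e0; rewrite /eball /= (bigD1 i)//= => h.
rewrite ltNge; apply/negP => le_e.
have : e ^+ 2 <= `|tnth y i - tnth x i| ^+ 2 by rewrite ler_sqr ?nnegrE ?(ltW e0).
rewrite real_normK ?num_real// => /(lt_le_trans h); apply/negP; rewrite -leNgt.
by rewrite lerDl sumr_ge0// => j _; rewrite sqr_ge0.
Qed.

(** The generous factor [n.+1] keeps the inequality strict, even for [n = 0]. *)
Lemma sub_eball_box n (x y : n.-tuple R) (d : R) :
  0 < d -> (forall i, `|tnth y i - tnth x i| <= d) -> eball x (n.+1%:R * d) y.
Proof.
move=> d0 h; rewrite /eball /= (@le_lt_trans _ _ (\sum_(i < n) d ^+ 2))//.
  apply: ler_sum => i _; rewrite -real_normK ?num_real// ler_sqr ?nnegrE//.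
  exact: ltW.
rewrite sumr_const card_ord exprMn -[ltLHS]mulr_natl ltr_pM2r ?exprn_gt0//.
by rewrite -natrX ltr_nat expnS expn1 mulSn ltnS leq_addr.
Qed.

Lemma unit_ball_vol_lty n (mu : {measure set (n.-tuple R) -> \bar R}) :
  is_lebesgue mu -> (mu (eball (origin R n) 1) < +oo)%E.
Proof.
move=> hmu; apply: le_lt_trans (is_lebesgue_box_lty hmu 1).
apply: le_measure; rewrite ?inE; [exact: measurable_eball|exact: measurable_box|].
move=> y /(fun h => eball_coord h)/= h i; rewrite !tnth_mktuple -ler_norml ltW//.
by have := h i ltr01; rewrite tnth_mktuple subr0.
Qed.

Lemma unit_ball_vol_gt0 n (mu : {measure set (n.-tuple R) -> \bar R}) :
  is_lebesgue mu -> (0 < mu (eball (origin R n) 1))%E.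
Proof.
move=> hmu; pose d : R := n.+1%:R ^-1.
have d0 : 0 < d by rewrite invr_gt0.
apply: (@lt_le_trans _ _ (mu (box [tuple - d | i < n] [tuple d | i < n]))).
  rewrite hmu => [|i]; last by rewrite !tnth_mktuple; lra.
  rewrite lte_fin; apply: prodr_gt0 => i _; rewrite !tnth_mktuple; lra.
apply: le_measure; rewrite ?inE; [exact: measurable_box|exact: measurable_eball|].
move=> y h; have -> : 1 = n.+1%:R * d by rewrite mulfV.
apply: sub_eball_box => // i; have := h i.
by rewrite !tnth_mktuple subr0 ler_norml.
Qed.

(** The unit ball lies in the cylinder over the unit ball of one dimension less with axis
    [[-1, 1]]. *)
Lemma unit_ball_vol_leS (leb : forall n : nat, {measure set (n.-tuple R) -> \bar R})
    (Hleb : forall n : nat, is_lebesgue (leb n)) n :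
  unit_ball_vol leb n.+1 <= 2 * unit_ball_vol leb n.
Proof.
have fin m : leb m (eball (origin R m) 1) \is a fin_num.
  by rewrite ge0_fin_numE// unit_ball_vol_lty.
rewrite -lee_fin EFinM /unit_ball_vol !fineK//.
have mB m := @measurable_eball m (origin R m) 1.
rewrite -[eball _ _ in leLHS]setIT -integral_indic//; last exact: mB.
rewrite (ge0_integral_tcons (Hleb _) (Hleb n)); last 2 first.
- by apply/measurable_EFinP; apply: measurable_indic; exact: mB.
- by move=> y; rewrite lee_fin.
pose B := `[(-1 : R), 1]%classic `*` eball (origin R n) 1.
have mBB : measurable B by apply: measurableX => //; exact: mB.
apply: (@le_trans _ _ (\int[@lebesgue_measure R \x sf_lebesgue (Hleb n)]_p
   (\1_B p)%:E)%E).
  apply: ge0_le_integral => //.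
  - apply/measurable_EFinP; apply: measurableT_comp; last exact: measurable_tcons.
    by apply: measurable_indic; exact: mB.
  - exact/measurable_EFinP.
  - move=> p _; rewrite lee_fin !indicE; case: (boolP (tcons p \in _)) => //.
    rewrite inE => h; rewrite mem_set//; split.
      have := eball_coord ord0 ltr01 h; rewrite tcons0 tnth_mktuple subr0 /=.
      by rewrite in_itv/= -ler_norml => /ltW.
    move: h; rewrite /eball /=; apply: le_lt_trans.
    rewrite [leRHS]big_ord_recl/= -[leLHS]add0r lerD// ?sqr_ge0//.
    by apply: ler_sum => i _; rewrite tconsS !tnth_mktuple.
rewrite integral_indic// setIT [leLHS]product_measure1E//; last exact: mB.
rewrite /= lebesgue_measure_itv/= lte_fin ifT; last by lra.
by rewrite /sf_lebesgue lee_wpmul2r// -EFinB lee_fin; lra.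
Qed.

End eball.

(** * Measurability from openness, semicontinuity and Lipschitz bounds *)

Section euclid_open.
Variables (R : realType) (n : nat).
Implicit Types (x y z : n.-tuple R) (q : n.-tuple rat * rat).

(** Rational cubes form a countable family, so that the union of any subfamily is measurable. *)
Definition ratcube q : set (n.-tuple R) :=
  [set y | forall i, `|tnth y i - ratr (tnth q.1 i)| <= ratr q.2].

Lemma measurable_ratcube q : measurable (ratcube q).
Proof.
have -> : ratcube q = box [tuple (ratr (tnth q.1 i) - ratr q.2 : R) | i < n]
    [tuple (ratr (tnth q.1 i) + ratr q.2 : R) | i < n].
  by apply/seteqP; split=> y h i; have := h i; rewrite !tnth_mktuple ler_distl.
exact: measurable_box.
Qed.

Lemma ratcube_eball x (d : R) : 0 < d ->
  exists q, ratcube q x /\ ratcube q `<=` eball x d.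
Proof.
move=> d0; have [c [c0 dE]] : exists c : R, 0 < c /\ d = n.+1%:R * (2 * c).
  exists (d / n.+1%:R / 2); split; first by rewrite !divr_gt0.
  by rewrite [2 * _]mulrC divfK ?pnatr_eq0// mulrC divfK ?pnatr_eq0.
have [r] := rat_in_itvoo c0; rewrite in_itv/= => /andP[r0 rc].
have hq i : {q : rat | `|tnth x i - ratr q| <= ratr r}.
  apply: cid; have : tnth x i - ratr r < tnth x i + ratr r by lra.
  move=> /rat_in_itvoo[q]; rewrite in_itv/= => /andP[h1 h2].
  by exists q; rewrite ler_distlC; apply/andP; split; lra.
exists ([tuple sval (hq i) | i < n], r); split.
  by move=> i /=; rewrite tnth_mktuple; exact: (svalP (hq i)).
move=> y h; rewrite dE.
apply: sub_eball_box => [|i]; first by lra.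
have := h i; rewrite /= tnth_mktuple; have := svalP (hq i).
move: (sval (hq i)) => q h1 h2.
have -> : tnth y i - tnth x i = (tnth y i - ratr q) - (tnth x i - ratr q) by ring.
by apply: le_trans (ler_normB _ _) _; lra.
Qed.

Lemma measurable_euclid_open (O : set (n.-tuple R)) :
  (forall x, O x -> exists d : R, 0 < d /\ eball x d `<=` O) -> measurable O.
Proof.
move=> hO; have -> : O = \bigcup_(q in [set q | ratcube q `<=` O]) ratcube q.
  apply/seteqP; split=> [x Ox|x [q + qx]]; last exact.
  have [d [d0 dO]] := hO _ Ox; have [q [qx qd]] := ratcube_eball x d0.
  by exists q => //; apply: subset_trans qd dO.
rewrite bigcup_mkcond; apply: countable_bigcupT_measurable => [|q].
  exact: countableP.
by case: ifP => _ //; exact: measurable_ratcube.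
Qed.

Lemma eball_shrink x (r : R) z : 0 < r -> eball x r z ->
  exists r', [/\ 0 < r', r' < r & eball x r' z].
Proof.
move=> r0; rewrite /eball /=; set S := \sum_(i < n) _ => Sr.
have S0 : 0 <= S by apply: sumr_ge0 => i _; exact: sqr_ge0.
have sr : Num.sqrt S < r.
  by rewrite -[ltRHS](gtr0_norm r0) -sqrtr_sqr ltr_sqrt ?exprn_gt0.
have s0 := sqrtr_ge0 S.
exists ((Num.sqrt S + r) / 2); split; [lra|lra|].
by rewrite -[ltLHS]sqr_sqrtr// ltr_sqr ?nnegrE; lra.
Qed.

(** The strict superlevel sets are open. Oscillations and local suprema over open balls are of this
    kind however irregular [f] is. *)
Lemma lsc_measurable (h : n.-tuple R -> \bar R) :
  (forall x M, (M < h x)%E -> exists d : R, 0 < d /\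
    forall x', eball x d x' -> (M < h x')%E) ->
  measurable_fun setT h.
Proof.
move=> hh; apply: (measurability _ (ErealGenOInfty.measurableE R)) => _ [_ [r ->] <-].
rewrite setTI; apply: measurable_euclid_open => x /=; rewrite in_itv/= andbT.
move=> /hh[d [d0 hd]]; exists d; split=> // x' /hd /=.
by rewrite in_itv/= andbT.
Qed.

Lemma lip_measurable (h : n.-tuple R -> R) (C : R) :
  (forall x z (e : R), 0 < e -> eball x e z -> `|h z - h x| <= C * e) ->
  measurable_fun setT h.
Proof.
move=> hh; apply/measurable_EFinP; apply: lsc_measurable => x [M| |]; last first.
- by exists 1; split => // z _; rewrite ltNyr.
- by rewrite ltNge leey.
rewrite /= lte_fin => Mh.
have C0 : 0 <= C.
  have := hh x x 1 ltr01 (eball_center x ltr01).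
  by rewrite subrr normr0 mulr1.
exists ((h x - M) / (2 * (C + 1))); split; first by rewrite divr_gt0//; lra.
move=> z xz; rewrite lte_fin.
have : `|h z - h x| <= C * ((h x - M) / (2 * (C + 1))).
  by apply: hh xz; rewrite divr_gt0//; lra.
have : C * ((h x - M) / (2 * (C + 1))) <= (h x - M) / 2.
  rewrite mulrA ler_pdivrMr; last by lra.
  rewrite mulrA mulrAC [leRHS]mulrC; nra.
rewrite ler_norml => h1 /andP[h2 h3]; lra.
Qed.

End euclid_open.

(** * Essential oscillation as a supremum over a set of full measure *)

Section goodset.
Variables (R : realType) (n : nat).

(* Points near which [f] takes values close to [f z] on sets of positive measure:
   on such points essential oscillations over balls are genuine suprema. *)
Definition goodset (mu : set (n.-tuple R) -> \bar R) (f : n.-tuple R -> R)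
    (G : set (n.-tuple R)) :=
  [/\ measurable G, mu (~` G) = 0%E &
    forall z (d e : R), G z -> 0 < d -> 0 < e ->
      (0 < mu (eball z d `&` [set y | (`|f y - f z| < e)%R]))%E].

(** A point is bad if some rational cube containing it and some rational interval containing its
    value cut out a null set. Countably many such null sets cover the bad points; no differentiation
    theorem is involved. *)
Lemma ex_goodset (mu : {measure set (n.-tuple R) -> \bar R}) f :
  measurable_fun setT f -> exists G, goodset mu f G.
Proof.
move=> mf.
pose idx : Type := ((n.-tuple rat * rat) * (rat * rat))%type.
pose A (i : idx) : set (n.-tuple R) :=
  @ratcube R n i.1 `&` f @^-1` `]ratr i.2.1, ratr i.2.2[%classic.
have mA i : measurable (A i).
  apply: measurableI; first exact: measurable_ratcube.
  by rewrite -[X in measurable X]setTI; exact: mf.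
pose Bad := \bigcup_(i in [set i | mu (A i) = 0%E]) A i.
have mBad : measurable Bad.
  rewrite /Bad bigcup_mkcond; apply: countable_bigcupT_measurable => [|q].
    exact: countableP.
  by case: ifP.
exists (~` Bad); split; first exact: measurableC.
- rewrite setCK; apply: measure_negligible => //.
  rewrite /Bad bigcup_mkcond.
  pose B i : set (n.-tuple R) := if i \in [set i | mu (A i) = 0%E] then A i else set0.
  have B0 i : mu.-negligible (B i).
    rewrite /B; case: ifPn => [|_]; last exact: negligible_set0.
    by rewrite inE /= => h; exact/negligibleP.
  apply: (@negligibleS _ _ _ _ (\bigcup_m (if unpickle m is Some i then B i else set0))).
    by move=> x [i _ Bi]; exists (pickle i) => //; rewrite pickleK.
  by apply: negligible_bigcup => m; case: unpickle => // ; exact: negligible_set0.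
- move=> z d e Gz d0 e0.
  have [q [qz qd]] := ratcube_eball z d0.
  have [a] : exists a, ratr a \in `]f z - e, f z[ by apply: rat_in_itvoo; lra.
  rewrite in_itv/= => /andP[a1 a2].
  have [b] : exists b, ratr b \in `]f z, f z + e[ by apply: rat_in_itvoo; lra.
  rewrite in_itv/= => /andP[b1 b2].
  pose i : idx := (q, (a, b)).
  have Aiz : A i z by split => //=; rewrite in_itv/= a2.
  have Ai0 : (0 < mu (A i))%E.
    rewrite lt0e measure_ge0 andbT; apply/eqP => h; apply: Gz.
    by exists i.
  apply: lt_le_trans Ai0 _; apply: le_measure; rewrite ?inE//.
    apply: measurableI; first exact: measurable_eball.
    have -> : [set y | `|f y - f z| < e] = f @^-1` `](f z - e), (f z + e)[%classic.
      by apply/seteqP; split => y; rewrite /= in_itv/= ltr_distl.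
    by rewrite -[X in measurable X]setTI; exact: mf.
  apply: setISS => // y; rewrite /= in_itv/= => /andP[h1 h2].
  by rewrite ltr_distl; apply/andP; split; lra.
Qed.

Variable mu : {sigma_finite_measure set (n.-tuple R) -> \bar R}.
Hypothesis hmu : is_lebesgue mu.
Local Open Scope ereal_scope.

(** The complement of [G * G] is null for the product measure, so a bound on [G] is an essential
    bound on pairs. *)
Lemma osc_le (f : n.-tuple R -> R) (A G : set (n.-tuple R)) (M : \bar R) :
  measurable G -> mu (~` G) = 0 ->
  (forall z w, G z -> G w -> A z -> A w -> (`|f z - f w|%R)%:E <= M) ->
  osc mu f A <= M.
Proof.
move=> mG G0 h; apply: ereal_inf_lbound => /=.
have mGC := measurableC mG.
apply: (@negligibleS _ _ _ _ ((~` G `*` setT) `|` (setT `*` ~` G))).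
  move=> [z w] /= hzw; have [Gz|] := pselect (G z); last by left.
  have [Gw|] := pselect (G w); last by right.
  by exfalso; apply: hzw => Az Aw; exact: h.
apply: negligibleU; apply/negligibleP; try exact: measurableX.
  by rewrite [LHS]product_measure1E//= G0 mul0e.
by rewrite [LHS]product_measure1E//= G0 mule0.
Qed.

(** If the essential bound were smaller than [|f z - f w|], it would fail on a product of two sets
    of positive measure, one of points near [z] with values near [f z], the other likewise for
    [w]. *)
Lemma osc_ge (f : n.-tuple R -> R) G x (r : R) z w : measurable_fun setT f ->
  goodset mu f G -> (0 < r)%R ->
  G z -> G w -> eball x r z -> eball x r w ->
  (`|f z - f w|%R)%:E <= osc mu f (eball x r).
Proof.
move=> mf [mG G0 hG] r0 Gz Gw xz xw.
apply: le_ereal_inf_tmp => M /= [N [mN N0 hN]].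
rewrite leNgt; apply/negP => Mlt.
(* The gap [2 * d] leaves room for moving each of [f z] and [f w] by less than [d]. *)
have [d [d0 hd]] : exists d : R, (0 < d)%R /\ M <= (`|f z - f w| - 2 * d)%R%:E.
  move: Mlt; case: M {hN} => [M| |].
  - rewrite lte_fin => Mlt; exists ((`|f z - f w| - M) / 2)%R; split; first by lra.
    by rewrite lee_fin; lra.
  - by rewrite ltNge leey.
  - by move=> _; exists 1%R; rewrite leNye.
have sub u : eball x r u -> exists e : R, (0 < e)%R /\ eball u e `<=` eball x r.
  move=> xu; have [r' [r'0 r'r xu']] := eball_shrink r0 xu.
  exists (r - r')%R; split; first by lra.
  move=> v uv; have -> : r = (r' + (r - r'))%R by ring.
  by apply: eball_triangle xu' uv => //; lra.
have [ez [ez0 subz]] := sub _ xz.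
have [ew [ew0 subw]] := sub _ xw.
pose B u e : set (n.-tuple R) := eball u e `&` [set y | (`|f y - f u| < d)%R].
have mB u e : measurable (B u e).
  apply: measurableI; first exact: measurable_eball.
  have -> : [set y | (`|f y - f u| < d)%R] = f @^-1` `](f u - d)%R, (f u + d)%R[%classic.
    by apply/seteqP; split => y; rewrite /= in_itv/= ltr_distl.
  by rewrite -[X in measurable X]setTI; exact: mf.
have : 0 < (mu \x mu) (B z ez `*` B w ew).
  by rewrite product_measure1E// mule_gt0//; apply: hG.
apply/negP; rewrite -leNgt -N0; apply: le_measure; rewrite ?inE//.
  exact: measurableX.
move=> [u v] /= [[zu fu] [wv fv]]; apply: hN => /=.
apply/not_implyP; split; first exact: subz.
apply/not_implyP; split; first exact: subw.
apply/negP; rewrite -ltNge; apply: (le_lt_trans hd); rewrite lte_fin.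
have : (`|f z - f w| <= `|f u - f z| + `|f u - f v| + `|f v - f w|)%R.
  have -> : (f z - f w = - (f u - f z) + (f u - f v) + (f v - f w))%R by ring.
  apply: (le_trans (ler_normD _ _)); rewrite lerD2r.
  by apply: (le_trans (ler_normD _ _)); rewrite normrN.
by move: fu fv => /= fu fv ?; lra.
Qed.

Lemma goodset_eball G f x (r : R) : goodset mu f G -> (0 < r)%R ->
  exists z, G z /\ eball x r z.
Proof.
move=> [mG G0 _] r0; apply/not_existsP => h.
have sub : eball x r `<=` ~` G by move=> z xz Gz; apply: (h z).
have [d [d0 rE]] : exists d : R, (0 < d)%R /\ r = (n.+1%:R * d)%R.
  exists (r / n.+1%:R)%R; split; first by rewrite divr_gt0.
  by rewrite mulrC divfK ?pnatr_eq0.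
pose bx := box [tuple (tnth x i - d)%R | i < n] [tuple (tnth x i + d)%R | i < n].
have : 0 < mu bx.
  rewrite hmu => [|i]; last by rewrite !tnth_mktuple; lra.
  rewrite lte_fin; apply: prodr_gt0 => i _; rewrite !tnth_mktuple; lra.
apply/negP; rewrite -leNgt -G0; apply: le_measure; rewrite ?inE.
- exact: measurable_box.
- exact: measurableC.
- apply: subset_trans sub => y hy.
  rewrite rE; apply: sub_eball_box => // i; have := hy i; rewrite !tnth_mktuple ler_distl.
  by [].
Qed.

Lemma osc_ge0 (f : n.-tuple R -> R) x (r : R) : measurable_fun setT f -> (0 < r)%R ->
  0 <= osc mu f (eball x r).
Proof.
move=> mf r0; have [G gG] := ex_goodset mu mf.
have [z [Gz xz]] := goodset_eball x gG r0.
by have := osc_ge mf gG r0 Gz Gz xz xz; rewrite subrr normr0.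
Qed.

(** The oscillation is a supremum over pairs of points of [G] in the open ball, and such a pair
    stays in the ball when its centre moves slightly: the function is lower semicontinuous. *)
Lemma measurable_osc (f : n.-tuple R -> R) (r : R) : measurable_fun setT f -> (0 < r)%R ->
  measurable_fun setT (fun x => osc mu f (eball x r)).
Proof.
move=> mf r0; have [G gG] := ex_goodset mu mf.
apply: lsc_measurable => x M Mlt.
have [[z [w [Gz Gw xz xw zw]]]|h] := pselect (exists z w, [/\ G z, G w, eball x r z, eball x r w &
    M < (`|f z - f w|%R)%:E]); last first.
  exfalso; move: Mlt; apply/negP; rewrite -leNgt.
  have [mG G0 _] := gG.
  apply: (osc_le mG G0) => z w Gz Gw xz xw; rewrite leNgt; apply/negP => zw.
  by apply: h; exists z, w.
have [r1 [r10 r1r xz1]] := eball_shrink r0 xz.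
have [r2 [r20 r2r xw2]] := eball_shrink r0 xw.
pose d := (r - Num.max r1 r2)%R.
have [m1 m2] : (r1 <= Num.max r1 r2)%R /\ (r2 <= Num.max r1 r2)%R.
  by rewrite !le_max !lexx orbT.
have d0 : (0 < d)%R by rewrite /d subr_gt0 gt_max r1r.
exists d; split => // x' /eball_sym xx'.
apply: (lt_le_trans zw); apply: (osc_ge mf gG) => //.
- apply: (@eballS _ _ _ (d + r1)%R); [lra|rewrite /d; lra|].
  exact: eball_triangle xx' xz1.
- apply: (@eballS _ _ _ (d + r2)%R); [lra|rewrite /d; lra|].
  exact: eball_triangle xx' xw2.
Qed.

(** The value 0 is included so that the supremum is nonnegative without first finding a point of [G]
    in the ball. *)
Definition supball (G : set (n.-tuple R)) (f : n.-tuple R -> R) (r : R) x : \bar R :=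
  ereal_sup [set y | y = 0 \/ exists z, [/\ G z, eball x r z & y = (`|f z|%R)%:E]].

Lemma supball_ge0 G f r x : 0 <= supball G f r x.
Proof. by apply: ereal_sup_ubound; left. Qed.

Lemma supball_ge G f r x z : G z -> eball x r z -> (`|f z|%R)%:E <= supball G f r x.
Proof. by move=> Gz xz; apply: ereal_sup_ubound; right; exists z. Qed.

Lemma supball_le G f r x M : 0 <= M ->
  (forall z, G z -> eball x r z -> (`|f z|%R)%:E <= M) -> supball G f r x <= M.
Proof. by move=> M0 h; apply: ge_ereal_sup => y [->//|[z [Gz xz ->]]]; exact: h. Qed.

Lemma measurable_supball G f r : (0 < r)%R -> measurable_fun setT (supball G f r).
Proof.
move=> r0; apply: lsc_measurable => x M.
have [M0|M0] := ltP M 0.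
  by move=> _; exists 1%R; split => // x' _; apply: (lt_le_trans M0); exact: supball_ge0.
move=> /ereal_sup_gt[y /= [->|[z [Gz xz ->]]] My].
  by move: My; rewrite ltNge M0.
have [r1 [r10 r1r xz1]] := eball_shrink r0 xz.
exists (r - r1)%R; split; first by lra.
move=> x' /eball_sym xx'; apply: (lt_le_trans My); apply: supball_ge => //.
have -> : r = (r - r1 + r1)%R by ring.
by apply: eball_triangle xx' xz1 => //; lra.
Qed.

End goodset.

(** * Mean value estimates on the closed cube *)

Section cube_calculus.
Variables (R : realType) (n : nat) (L beta : R).
Hypotheses (L0 : 0 < L) (beta0 : 0 < beta).
Implicit Types (u v x : 'rV[R]_n) (F : 'rV[R]_n -> R).

Definition ccube : set 'rV[R]_n := [set x | forall i, - L <= x ord0 i <= L].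

Lemma sub_ccube : ccube `<=` ocube (L + beta).
Proof.
move=> x h i; have /andP[h1 h2] := h i; apply/andP; split.
  by apply: lt_le_trans h1; rewrite ltrN2 ltrDl.
by apply: le_lt_trans h2 _; rewrite ltrDl.
Qed.

Lemma ccube_in x : ccube x -> x \in ocube (L + beta).
Proof. by move=> h; rewrite inE; exact: sub_ccube. Qed.

Lemma compact_ccube : compact ccube.
Proof.
have := @rV_compact R n (fun=> `[- L, L]%classic) (fun=> @segment_compact _ _ _).
by congr compact; apply/seteqP; split=> x h i; have := h i; rewrite /= in_itv.
Qed.

Lemma ccube_bounded F : {in ocube (L + beta), continuous F} ->
  exists M, 0 < M /\ forall x, ccube x -> `|F x| <= M.
Proof.
move=> cF.
have cc : {within ccube, continuous F}.
  by apply: continuous_in_subspaceT => x /[!inE]/ccube_in; exact: cF.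
have /compact_bounded[M [_ hM]] := continuous_compact cc compact_ccube.
exists (`|M| + 1); split; first by rewrite ltr_wpDl.
move=> x Qx; apply: (hM (`|M| + 1)); last by exists x.
by rewrite (le_lt_trans (ler_norm _))// ltrDl.
Qed.

Lemma is_derive_line F x (i : 'I_n) t : derivable F (x + t *: 'e_i) 'e_i ->
  is_derive t 1 (fun t => F (x + t *: 'e_i)) (pd i F (x + t *: 'e_i)).
Proof.
move=> dF.
have E : (fun h : R => h^-1 *: (((fun t => F (x + t *: 'e_i)) \o shift t) (h *: (1 : R)) -
    F (x + t *: 'e_i))) =
  (fun h : R => h^-1 *: ((F \o shift (x + t *: 'e_i)) (h *: 'e_i) - F (x + t *: 'e_i))).
  apply/funext => h /=; congr (_ *: (F _ - _)).
  by rewrite [h *: 1]mulr1 scalerDl addrCA.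
by split; rewrite /pd /derivable /derive /= E.
Qed.

Lemma continuous_line x (i : 'I_n) : continuous (fun t : R => x + t *: 'e_i).
Proof.
move=> t; apply: cvgD; first exact: cvg_cst.
by apply: cvgZl; exact: cvg_id.
Qed.

Lemma mvt_line F x (i : 'I_n) (s t : R) :
  (forall r, ccube (x + r *: 'e_i) -> derivable F (x + r *: 'e_i) 'e_i) ->
  {in ocube (L + beta), continuous F} ->
  ccube (x + s *: 'e_i) -> ccube (x + t *: 'e_i) ->
  exists2 z, ccube z & F (x + t *: 'e_i) - F (x + s *: 'e_i) = pd i F z * (t - s).
Proof.
move=> dF cF.
wlog st : s t / s <= t => [W Qs Qt|].
  have [st|/ltW ts] := leP s t; first exact: W.
  have [z Qz e] := W _ _ ts Qt Qs; exists z => //.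
  by rewrite -opprB e; ring.
move=> Qs Qt.
have Qr r : s <= r <= t -> ccube (x + r *: 'e_i).
  move=> /andP[sr rt] j; have := Qs j; have := Qt j; rewrite !mxE.
  case: (j == i); rewrite /= ?mulr1 ?mulr0// => /andP[h1 h2] /andP[h3 h4].
  by apply/andP; split; lra.
have [||c cst e] := @MVT_segment R (fun t => F (x + t *: 'e_i))
   (fun t => pd i F (x + t *: 'e_i)) s t st.
- move=> r; rewrite in_itv/= => /andP[sr rt].
  by apply: is_derive_line; apply: dF; apply: Qr; rewrite !ltW.
- apply: continuous_in_subspaceT => r; rewrite inE/= in_itv/= => rst.
  apply: (@continuous_comp R 'rV[R]_n R (fun t : R => x + t *: 'e_i) F); first exact: continuous_line.
  by apply: cF; apply: ccube_in; exact: Qr.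
- by exists (x + c *: 'e_i) => //; apply: Qr; move: cst; rewrite in_itv.
Qed.

(** The coordinates are changed one at a time, along a staircase that stays in the cube; each step
    has its own intermediate point, so only partial derivatives occur. *)
Lemma mvt_ccube F u v :
  (forall i : 'I_n, {in ocube (L + beta), forall x, derivable F x 'e_i}) ->
  {in ocube (L + beta), continuous F} -> ccube u -> ccube v ->
  exists z : 'I_n -> 'rV[R]_n, (forall i, ccube (z i)) /\
    F u - F v = \sum_i pd i F (z i) * (u ord0 i - v ord0 i).
Proof.
move=> dF cF Qu Qv.
pose w (m : nat) : 'rV[R]_n := \row_i (if (i < m)%N then u ord0 i else v ord0 i).
have Qw m : ccube (w m) by move=> i; rewrite mxE; case: ifP => _; [exact: Qu|exact: Qv].
have step (i : 'I_n) : exists z, ccube z /\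
    F (w i.+1) - F (w i) = pd i F z * (u ord0 i - v ord0 i).
  pose x : 'rV[R]_n := \row_j (if j == i then 0 else w i ord0 j).
  have e1 : w i.+1 = x + u ord0 i *: 'e_i.
    apply/rowP => j; rewrite !mxE eqxx /= ltnS leq_eqVlt.
    have [->|ji] := eqVneq j i; first by rewrite eqxx /= mulr1 add0r.
    by rewrite mulr0 addr0 -[(j : nat) == i]/(j == i) (negbTE ji).
  have e2 : w i = x + v ord0 i *: 'e_i.
    apply/rowP => j; rewrite !mxE eqxx /=.
    have [->|ji] := eqVneq j i; first by rewrite ltnn mulr1 add0r.
    by rewrite mulr0 addr0.
  have [|||z Qz e] := @mvt_line F x i (v ord0 i) (u ord0 i) _ cF.
  - by move=> r /ccube_in; exact: dF.
  - by rewrite -e2.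
  - by rewrite -e1.
  - by exists z; split => //; rewrite e1 e2.
have [z hz] := choice step; exists z; split => [i|]; first by have [] := hz i.
under eq_bigr do rewrite -(proj2 (hz _)).
rewrite -(big_mkord xpredT (fun m => F (w m.+1) - F (w m))) telescope_sumr//.
congr (F _ - F _); apply/rowP => i; rewrite mxE ?ltn_ord//.
Qed.

End cube_calculus.

Lemma sqr_sum_le (R : realType) n (x : 'I_n -> R) :
  (\sum_i x i) ^+ 2 <= n%:R * \sum_i x i ^+ 2.
Proof.
elim: n x => [|n IH] x; first by rewrite !big_ord0 expr0n mul0r.
rewrite !big_ord_recr /=; have := IH (fun i => x (widen_ord (leqnSn n) i)).
set S := \sum_i _; set Q := \sum_i _ => h; set t := x _.
have Q0 : 0 <= Q by apply: sumr_ge0 => i _; exact: sqr_ge0.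
have [n0|n0] := posnP n.
  have S0 : S = 0 by apply/eqP; rewrite -sqrf_eq0 eq_le sqr_ge0 andbT (le_trans h)// n0 mul0r.
  have N1 : 1 <= n.+1%:R :> R by rewrite ler1n.
  by rewrite S0 add0r; have := sqr_ge0 t; nra.
have n1 : 1 <= n%:R :> R by rewrite ler1n.
rewrite -natr1; move: n1 h; move: (n%:R : R) => m m1 h.
have m0 : 0 < m by lra.
have : 0 <= (Q + m * t ^+ 2 - 2 * S * t) * m by have := sqr_ge0 (S - m * t); nra.
by rewrite pmulr_lge0// => ?; nra.
Qed.

(** * Clipping to an interval *)

Section clip.
Variables (R : realType) (L : R).
Hypothesis L0 : 0 < L.

Definition clip (t : R) : R := Num.max (- L) (Num.min t L).

Let NL : - L <= L. Proof. by rewrite ge0_cp// ltW. Qed.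

Lemma clip_itv (t : R) : - L <= clip t <= L.
Proof.
by rewrite /clip le_max lexx /= ge_max ge_min lexx orbT andbT NL.
Qed.

Lemma clip_id (t : R) : - L <= t <= L -> clip t = t.
Proof. by move=> /andP[h1 h2]; rewrite /clip min_l// max_r. Qed.

Lemma clip_id_lt (t : R) : `|t| < L -> clip t = t.
Proof. by rewrite ltr_norml => /andP[h1 h2]; apply: clip_id; rewrite !ltW. Qed.

Lemma clip_hi (t : R) : L <= t -> clip t = L.
Proof. by move=> h; rewrite /clip min_r// max_r. Qed.

Lemma clip_lo (t : R) : t <= - L -> clip t = - L.
Proof. by move=> h; rewrite /clip min_l ?max_l// (le_trans h). Qed.

(** Expressing clipping as multiplication of increments by some [l] in [[0, 1]] avoids any case
    analysis on the position of the two points in the later mean value formula. *)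
Lemma clip_diff (s t : R) : exists l : R, 0 <= l <= 1 /\ clip t - clip s = l * (t - s).
Proof.
have l0 := L0; wlog st : s t / s <= t => [W|].
  have [st|/ltW ts] := leP s t; first exact: W.
  by have [l [hl e]] := W _ _ ts; exists l; split => //; rewrite -opprB e; ring.
have h : 0 <= clip t - clip s <= t - s.
  have [sl|sl] := leP s (- L); have [tl|tl] := leP t (- L).
  - by rewrite !clip_lo//; apply/andP; split; lra.
  - rewrite (clip_lo sl); have [Lt|tL] := leP L t; first by rewrite clip_hi//; apply/andP; split; lra.
    by rewrite clip_id; apply/andP; split; lra.
  - lra.
  - have [Ls|sL] := leP L s.
      by rewrite !clip_hi//; [apply/andP; split; lra|lra].
    rewrite (@clip_id s); last by apply/andP; split; lra.
    have [Lt|tL] := leP L t; first by rewrite clip_hi//; apply/andP; split; lra.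
    by rewrite clip_id; apply/andP; split; lra.
have [e|ne] := eqVneq s t.
  by exists 0; rewrite lexx ler01 e !subrr mul0r.
have st' : 0 < t - s by rewrite subr_gt0 lt_neqAle ne.
move: h => /andP[h1 h2].
exists ((clip t - clip s) / (t - s)); split; last by rewrite divfK ?gt_eqF.
by rewrite divr_ge0 ?(ltW st')//= ler_pdivrMr// mul1r.
Qed.

End clip.

(** * The linear extension of the map in its first coordinate *)

Section extension.
Variables (R : realType) (n : nat) (L beta : R) (Phi0 : 'rV[R]_n.+1 -> R).
Variables (gam D B : R).
Hypotheses (L0 : 0 < L) (beta0 : 0 < beta) (gam0 : 0 < gam).
Hypothesis hC2 : C2_on (ocube (L + beta)) Phi0.
Hypothesis D0 : 0 < D.
Hypothesis hD : forall x, ccube L x -> D ^+ 2 <= pd ord0 Phi0 x ^+ 2.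
Hypothesis hB : forall x (j : 'I_n.+1), ccube L x -> j != ord0 -> pd j Phi0 x ^+ 2 <= B.

(** The sign is read off at the centre; it is constant on the cube because the derivative never
    vanishes there. *)
Definition sgd : R := Num.sg (pd ord0 Phi0 0).

Definition cl (y : n.+1.-tuple R) : 'rV[R]_n.+1 :=
  \row_i clip L (gam ^- i * tnth y i).

(* [Phi0 \o Gam] on the box, extended linearly with the smallest admissible slope
   in the first coordinate, so that the extension is globally expanding. *)
Definition Ft (y : n.+1.-tuple R) : R :=
  Phi0 (cl y) + sgd * D * (tnth y ord0 - clip L (tnth y ord0)).

Definition slope (y : n.+1.-tuple R) : R := sgd * pd ord0 Phi0 (cl y).

(** The Jacobian of every branch: the factor [gam ^- n] from the shifted coordinates cancels the
    [gam ^+ n] in the last one, which leaves the absolute derivative of [Ft] in the first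
    coordinate. *)
Definition Jac (y : n.+1.-tuple R) : R := if `|tnth y ord0| < L then slope y else D.

Lemma ccube_cl y : ccube L (cl y).
Proof. by move=> i; rewrite mxE; exact: clip_itv. Qed.

Lemma ccube0 : ccube L (0 : 'rV[R]_n.+1).
Proof. by have l0 := L0; move=> i; rewrite mxE; apply/andP; split; lra. Qed.

Lemma pd0_neq0 x : ccube L x -> pd ord0 Phi0 x != 0.
Proof.
move=> /hD; apply: contraTneq => ->; rewrite expr0n -ltNge.
by rewrite exprn_gt0.
Qed.

Lemma sgd_sqr : sgd * sgd = 1.
Proof.
have := pd0_neq0 ccube0; rewrite /sgd => h.
by rewrite -expr2 sqr_sg h.
Qed.

(** The lower bound on the square excludes zeros, so by the intermediate value theorem along the
    segment from the centre the derivative keeps the sign [sgd]. *)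
Lemma slope_ge x : ccube L x -> D <= sgd * pd ord0 Phi0 x.
Proof.
move=> Qx.
have cP : {in ocube (L + beta), continuous (pd ord0 Phi0)} by have [] := hC2.
pose q (t : R) := sgd * pd ord0 Phi0 (t *: x).
have Qt (t : R) : 0 <= t <= 1 -> ccube L (t *: x).
  move=> /andP[t0 t1] i; rewrite mxE; have /andP[h1 h2] := Qx i.
  apply/andP; split; nra.
have q0 : 0 < q 0.
  rewrite /q scale0r /sgd; have := pd0_neq0 ccube0.
  by case: sgrP => // h _; rewrite ?mul1r// mulN1r oppr_gt0.
have q1 : 0 < q 1.
  rewrite ltNge; apply/negP => q1.
  have cq : {within `[0, 1], continuous q}.
    apply: continuous_in_subspaceT => r; rewrite inE/= in_itv/= => rst.
    apply: cvgM; first exact: cvg_cst.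
    apply: (@continuous_comp R 'rV[R]_n.+1 R (fun t : R => t *: x) (pd ord0 Phi0)).
      by apply: cvgZl; exact: cvg_id.
    by apply: cP; apply: (ccube_in beta0); exact: Qt.
  have [|c] := @IVT R q 0 1 0 ler01 cq.
    by rewrite ge_min q1 orbT le_max (ltW q0).
  rewrite in_itv/= => hc /eqP; rewrite /q mulf_eq0 => /orP[/eqP s0|/eqP p0].
    by have := sgd_sqr; rewrite s0 mul0r => /eqP; rewrite eq_sym oner_eq0.
  by move/eqP: p0; apply/negP; apply: pd0_neq0; exact: Qt.
have : D ^+ 2 <= (sgd * pd ord0 Phi0 x) ^+ 2.
  by rewrite exprMn [sgd ^+ 2]expr2 sgd_sqr mul1r; exact: hD.
rewrite ler_sqr ?nnegrE// ?(ltW D0)//.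
by have := q1; rewrite /q scale1r => /ltW.
Qed.

Lemma slope_gt0 y : 0 < slope y.
Proof. by apply: lt_le_trans D0 _; apply: slope_ge; exact: ccube_cl. Qed.

Lemma ex_slope_bound : exists M : R, 0 < M /\ forall x, ccube L x -> sgd * pd ord0 Phi0 x <= M.
Proof.
have cP : {in ocube (L + beta), continuous (pd ord0 Phi0)} by have [] := hC2.
have [M [M0 hM]] := ccube_bounded beta0 cP; exists M; split=> // x Qx.
apply: le_trans (hM _ Qx); apply: (le_trans (ler_norm _)).
have h : `|sgd| = 1 by rewrite /sgd normr_sg pd0_neq0//; exact: ccube0.
by rewrite normrM h mul1r.
Qed.

Lemma Jac_ge y : D <= Jac y.
Proof. by rewrite /Jac; case: ifP => // _; apply: slope_ge; exact: ccube_cl. Qed.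

Lemma Jac_le_slope y : Jac y <= slope y.
Proof. by rewrite /Jac; case: ifP => // _; apply: slope_ge; exact: ccube_cl. Qed.

(** A mean value formula across the clipping. In the first coordinate the fraction [1 - l] of the
    increment lost by clipping is restored with slope [D], so the coefficient is a convex
    combination of a true derivative and [D]; in the others clipping only shrinks the
    coefficient. *)
Lemma Ft_diff M y z : (forall x, ccube L x -> sgd * pd ord0 Phi0 x <= M) ->
  exists a : 'I_n.+1 -> R,
  [/\ Ft y - Ft z = \sum_i a i * (tnth y i - tnth z i),
     D <= sgd * a ord0 <= M &
     forall i, i != ord0 -> a i ^+ 2 <= gam ^- i ^+ 2 * B].
Proof.
move=> hM.
have cP : {in ocube (L + beta), continuous Phi0} by have [] := hC2.
have dP : forall i : 'I_n.+1, {in ocube (L + beta), forall x, derivable Phi0 x 'e_i}.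
  by have [] := hC2.
have [w [Qw e]] := mvt_ccube beta0 dP cP (ccube_cl y) (ccube_cl z).
have hl (i : 'I_n.+1) : exists l : R, 0 <= l <= 1 /\
   cl y ord0 i - cl z ord0 i = l * (gam ^- i * (tnth y i - tnth z i)).
  have [l [hl el]] := clip_diff L0 (gam ^- i * tnth z i) (gam ^- i * tnth y i).
  by exists l; split => //; rewrite !mxE el; ring.
have [l hl'] := choice hl.
pose a i := pd i Phi0 (w i) * l i * gam ^- i + (i == ord0)%:R * (sgd * D * (1 - l ord0)).
exists a; split.
- rewrite /Ft; have -> : forall p q r s : R, p + q - (r + s) = (p - r) + (q - s).
    by move=> *; ring.
  rewrite e; under eq_bigr => i _ do rewrite (proj2 (hl' i)).
  rewrite [in LHS]big_ord_recl [RHS]big_ord_recl /= /a /= invr1 !mulr1 !mul1r.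
  have e0 := proj2 (hl' ord0); rewrite !mxE /= invr1 !mul1r in e0.
  have -> : clip L (tnth y ord0) = clip L (tnth z ord0) + l ord0 * (tnth y ord0 - tnth z ord0).
    by rewrite -e0; ring.
  rewrite -addrA [X in _ + X]addrC addrA; congr (_ + _); last first.
    by apply: eq_bigr => i _; rewrite mul0r addr0; ring.
  by ring.
- have /andP[l0 l1] := proj1 (hl' ord0); rewrite /a /= expr0 invr1 mulr1 mul1r.
  have := slope_ge (Qw ord0); have := hM _ (Qw ord0); have := hM _ ccube0.
  have := slope_ge ccube0.
  have -> : sgd * (pd ord0 Phi0 (w ord0) * l ord0 + sgd * D * (1 - l ord0)) =
     (sgd * pd ord0 Phi0 (w ord0)) * l ord0 + sgd * sgd * D * (1 - l ord0) by ring.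
  rewrite sgd_sqr mul1r; set s := sgd * pd _ _ (w _).
  by move=> *; apply/andP; split; nra.
- move=> i i0; rewrite /a (negbTE i0) mul0r addr0.
  have /andP[li0 li1] := proj1 (hl' i); have hBi := hB (Qw i) i0.
  rewrite exprMn [leLHS]mulrC ler_wpM2l ?sqr_ge0// exprMn.
  have : l i ^+ 2 <= 1 by rewrite expr_le1.
  have := sqr_ge0 (pd i Phi0 (w i)); have := sqr_ge0 (l i); nra.
Qed.

(** Second derivatives are bounded on the compact cube and clipping is 1-Lipschitz, so one constant
    serves the whole space. *)
Lemma slope_lip : exists C : R, 0 <= C /\ forall y z (e : R), 0 < e -> eball y e z ->
  `|slope z - slope y| <= C * e.
Proof.
have cP : {in ocube (L + beta), continuous (pd ord0 Phi0)} by have [] := hC2.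
have dP : forall i : 'I_n.+1, {in ocube (L + beta), forall x, derivable (pd ord0 Phi0) x 'e_i}.
  by have [_ _ _ + _] := hC2; exact.
have hM (i : 'I_n.+1) : exists M : R, 0 < M /\ forall x, ccube L x -> `|pd i (pd ord0 Phi0) x| <= M.
  by apply: (ccube_bounded beta0); have [_ _ _ _] := hC2; apply.
have [M hM'] := choice hM.
exists (\sum_i M i * gam ^- i); split.
  apply: sumr_ge0 => i _; rewrite mulr_ge0 ?(ltW (proj1 (hM' i)))//.
  by rewrite invr_ge0 exprn_ge0// ltW.
move=> y z e e0 yz; rewrite /slope -mulrBr normrM.
have -> : `|sgd| = 1 by rewrite /sgd normr_sg pd0_neq0//; exact: ccube0.
rewrite mul1r.
have [w [Qw ->]] := mvt_ccube beta0 dP cP (ccube_cl z) (ccube_cl y).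
apply: (le_trans (ler_norm_sum _ _ _)); rewrite mulr_suml; apply: ler_sum => i _.
rewrite normrM -mulrA ler_pM//; first exact: (proj2 (hM' i)).
have [l [/andP[l0 l1]]] := clip_diff L0 (gam ^- i * tnth y i) (gam ^- i * tnth z i).
rewrite !mxE => ->; rewrite -mulrBr !normrM (ger0_norm l0).
have g0 : 0 <= gam ^- i by rewrite invr_ge0 exprn_ge0// ltW.
rewrite (ger0_norm g0); have := eball_coord i e0 yz.
set d := `| _ |; have d0 : 0 <= d by exact: normr_ge0.
move=> /ltW de; apply: (@le_trans _ _ (1 * (gam ^- i * d))).
  by rewrite ler_wpM2r// mulr_ge0.
by rewrite mul1r ler_wpM2l.
Qed.

Lemma measurable_slope : measurable_fun setT slope.
Proof. by have [C [_ hC]] := slope_lip; exact: lip_measurable hC. Qed.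

Lemma measurable_Jac : measurable_fun setT Jac.
Proof.
apply: measurable_fun_ifT.
- apply: measurable_fun_ltr => //.
  by apply: measurableT_comp => //; exact: measurable_tnth.
- exact: measurable_slope.
- exact: measurable_cst.
Qed.

(** Unlike the inverse of [Jac], this does not jump where the first coordinate passes [L] or
    [- L]. *)
Definition psi (y : n.+1.-tuple R) : R := (slope y)^-1.

Lemma psi_gt0 y : 0 < psi y.
Proof. by rewrite invr_gt0 slope_gt0. Qed.

Lemma Jac_psi_le : exists A : R, 0 <= A /\ forall y z (e : R), 0 < e -> eball y e z ->
  `|psi z - psi y| * D <= A * e.
Proof.
have [C [C0 hC]] := slope_lip; exists (C / D); split; first by rewrite divr_ge0 ?(ltW D0).
move=> y z e e0 yz; have := hC y z e e0 yz.
have sy := slope_ge (ccube_cl y); have sz := slope_ge (ccube_cl z).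
rewrite -/(slope y) -/(slope z) in sy sz.
have y0 := slope_gt0 y; have z0 := slope_gt0 z.
have -> : psi z - psi y = (slope y - slope z) * (psi z * psi y).
  by rewrite /psi; field; rewrite !gt_eqF.
rewrite normrM distrC (@ger0_norm _ (psi z * psi y)); last first.
  by rewrite mulr_ge0// ltW// psi_gt0.
have pz : psi z <= D^-1 by rewrite lef_pV2 ?posrE.
have py : psi y * D <= 1 by rewrite /psi mulrC ler_pdivrMr// mul1r.
have := psi_gt0 z; have := psi_gt0 y => py0 pz0 h.
rewrite [leRHS]mulrAC -[leLHS]mulrA; apply: ler_pM => //.
  by rewrite !mulr_ge0 ?ltW.
by rewrite -mulrA -[leRHS]mulr1 ler_pM// ?mulr_ge0 ?ltW.
Qed.

Lemma measurable_psi : measurable_fun setT psi.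
Proof.
have [A [A0 hA]] := Jac_psi_le.
apply: (@lip_measurable _ _ _ (A / D)) => y z e e0 yz.
by rewrite mulrAC ler_pdivlMr//; exact: hA.
Qed.

(** * Expansion and invertibility of the branches *)

Variables (sigma C1 C2 : R).
Hypotheses (C1gt : 1 < C1) (C2gt : 1 < C2) (sig : 81 < sigma).
Hypothesis gamE : gam ^- 2 = C1 * sigma.
Hypothesis DE : (gam ^+ n * D) ^+ 2 = C2 * sigma.
Hypothesis BE : n%:R * B = (C1 - 1) * (C2 - 1) * sigma.

Lemma gam_lt1 : gam < 1.
Proof.
have sg := sig; have c1 := C1gt; have g0 := gam0.
rewrite ltNge; apply/negP => g1.
have : gam ^- 2 <= 1 by rewrite invf_le1 ?exprn_gt0// exprn_ege1.
by rewrite gamE; nra.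
Qed.

(** On [U th j] the map [Tmap th] is the branch with [c = 2 j L - th]. *)
Definition branch (c : R) (y : n.+1.-tuple R) : n.+1.-tuple R :=
  [tuple (if ((i : nat).+1 < n.+1)%N then tnth y (insubd i (i : nat).+1) / gam
          else gam ^+ n * (Ft y - c)) | i < n.+1].

Lemma branch_last c y : tnth (branch c y) ord_max = gam ^+ n * (Ft y - c).
Proof. by rewrite tnth_mktuple ltnn. Qed.

Lemma branch_widen c y (i : 'I_n) :
  tnth (branch c y) (widen_ord (leqnSn n) i) = tnth y (lift ord0 i) / gam.
Proof.
rewrite tnth_mktuple /= ltnS ltn_ord; congr (tnth y _ / _).
by apply/val_inj; rewrite val_insubd /= ltnS ltn_ord.
Qed.

(** With [A] the first-coordinate part of the increment of [Ft] and [Bs] the rest,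
    [(A + Bs)^2 >= A^2 / C2 - Bs^2 / (C2 - 1)]. By [DE] the first term yields [sigma] times the
    squared first increment; by [BE] and Cauchy-Schwarz the second costs at most
    [(C1 - 1) * sigma * S], where [S] sums the other squared increments. The shifted coordinates
    contribute [C1 * sigma * S] and pay for it. *)
Lemma branch_expand c y z :
  sigma * sqdist y z <= sqdist (branch c y) (branch c z).
Proof.
have [M [M0 hM]] := ex_slope_bound.
have [a [eF /andP[a0 _] ha]] := Ft_diff z y hM.
have sg := sig; have c1 := C1gt; have c2 := C2gt.
rewrite /sqdist [leRHS]big_ord_recr /= branch_last !branch_last.
rewrite [X in _ <= X + _](eq_bigr (fun i =>
  (tnth z (lift ord0 i) - tnth y (lift ord0 i)) ^+ 2 * (C1 * sigma))); last first.
  by move=> i _; rewrite !branch_widen -mulrBl exprMn exprVn gamE.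
rewrite -mulr_suml -mulrBr exprMn.
have -> : Ft z - c - (Ft y - c) = Ft z - Ft y by ring.
rewrite eF big_ord_recl [X in _ <= _ + _ * (X ^+ 2)]big_ord_recl /=.
pose d i := tnth z (lift ord0 i) - tnth y (lift ord0 i).
set d0 := tnth z ord0 - tnth y ord0.
set S := \sum_(i < n) _ ^+ 2; set A := a ord0 * d0; set Bs := \sum_(i < n) _ * _.
have S0 : 0 <= S by apply: sumr_ge0 => i _; exact: sqr_ge0.
have g1 := gam_lt1; have g0 := gam0.
have hBs : (gam ^+ n) ^+ 2 * Bs ^+ 2 <= (C1 - 1) * (C2 - 1) * sigma * S.
  rewrite -exprMn mulr_sumr; apply: (le_trans (sqr_sum_le _)); rewrite -BE -mulrA.
  rewrite ler_wpM2l// mulr_sumr; apply: ler_sum => i _; rewrite mulrA exprMn.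
  rewrite ler_wpM2r ?sqr_ge0//.
  have hai := ha (lift ord0 i) isT; rewrite exprMn.
  apply: (@le_trans _ _ ((gam ^+ n) ^+ 2 * (gam ^- lift ord0 i ^+ 2 * B))).
    by rewrite ler_wpM2l ?sqr_ge0.
  have B0 : 0 <= B.
    by apply: le_trans (hB (ccube_cl z) (_ : lift ord0 i != ord0)) => //; exact: sqr_ge0.
  (* The factor [gam ^+ n] absorbs [gam ^- i], since [i <= n] and [gam < 1]. *)
  rewrite mulrA -exprMn ler_piMl// expr_le1 ?mulr_ge0 ?invr_ge0 ?exprn_ge0 ?(ltW g0)//.
  rewrite ler_pdivrMr ?exprn_gt0// mul1r lift0 ler_wiXn2l ?(ltW g0) ?(ltW g1)//.
have hA : C2 * sigma * d0 ^+ 2 <= (gam ^+ n) ^+ 2 * A ^+ 2.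
  have : D ^+ 2 <= (sgd * a ord0) ^+ 2 by rewrite ler_sqr ?nnegrE ?(ltW D0)// (le_trans (ltW D0)).
  rewrite exprMn [sgd ^+ 2]expr2 sgd_sqr mul1r => hD2.
  rewrite -DE /A [leLHS](_ : _ = (gam ^+ n) ^+ 2 * (D ^+ 2 * d0 ^+ 2)); last by ring.
  rewrite [leRHS](_ : _ = (gam ^+ n) ^+ 2 * (a ord0 ^+ 2 * d0 ^+ 2)); last by ring.
  by rewrite ler_wpM2l ?sqr_ge0// ler_wpM2r ?sqr_ge0.
set G := (gam ^+ n) ^+ 2 in hBs hA *.
have G0 : 0 <= G by exact: sqr_ge0.
have key : A ^+ 2 / C2 - Bs ^+ 2 / (C2 - 1) <= (A + Bs) ^+ 2.
  rewrite -subr_ge0.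
  have -> : (A + Bs) ^+ 2 - (A ^+ 2 / C2 - Bs ^+ 2 / (C2 - 1)) =
     ((C2 - 1) * A + C2 * Bs) ^+ 2 / (C2 * (C2 - 1)) by field; lra.
  by rewrite divr_ge0 ?sqr_ge0// mulr_ge0; lra.
have h1 : sigma * d0 ^+ 2 <= G * (A ^+ 2 / C2).
  by rewrite mulrA ler_pdivlMr; lra.
have h2 : G * (Bs ^+ 2 / (C2 - 1)) <= (C1 - 1) * sigma * S.
  by rewrite mulrA ler_pdivrMr; lra.
have h3 := ler_wpM2l G0 key.
rewrite mulrBr in h3; lra.
Qed.

Lemma branch_inj c y z : branch c y = branch c z -> y = z.
Proof.
move=> e; have := branch_expand c y z; rewrite -e.
have -> : sqdist (branch c y) (branch c y) = 0.
  by apply: big1 => i _; rewrite subrr expr0n.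
have sg := sig; rewrite pmulr_rle0; last by lra.
move=> h; have /eqP : sqdist y z = 0.
  by apply/eqP; rewrite eq_le h sumr_ge0// => i _; exact: sqr_ge0.
rewrite psumr_eq0; last by move=> i _; exact: sqr_ge0.
move=> /allP h0; apply/eq_from_tnth => i.
have := h0 i (mem_index_enum _); rewrite /= sqrf_eq0 subr_eq0 => /eqP.
by move=> ->.
Qed.

Lemma Ft_tcons M v (s t : R) : (forall x, ccube L x -> sgd * pd ord0 Phi0 x <= M) ->
  s <= t -> D * (t - s) <= sgd * Ft (tcons (t, v)) - sgd * Ft (tcons (s, v)) <= M * (t - s).
Proof.
move=> hM st; have [a [e /andP[a1 a2] _]] := Ft_diff (tcons (t, v)) (tcons (s, v)) hM.
rewrite -mulrBr e big_ord_recl/= !tcons0 big1 ?addr0; last first.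
  by move=> i _; rewrite !tconsS subrr mulr0.
rewrite /= mulrA; apply/andP; split; apply: ler_wpM2r; rewrite // subr_ge0//.
Qed.

Lemma Ft_tcons_continuous v : continuous (fun t : R => sgd * Ft (tcons (t, v))).
Proof.
have [M [M0 hM]] := ex_slope_bound.
move=> t; apply/cvgrPdist_le => e e0.
exists (e / M) => /=; first by rewrite divr_gt0.
move=> s /= /ltW; rewrite ler_pdivlMr// => h; apply: le_trans h; rewrite [leRHS]mulrC.
have d0 := D0.
have [st|ts] := leP s t.
  have /andP[h1 h2] := Ft_tcons v hM st.
  rewrite ger0_norm; last by apply: le_trans h1; rewrite mulr_ge0 ?(ltW D0)// subr_ge0.
  by rewrite ger0_norm// subr_ge0.
have /andP[h1 h2] := Ft_tcons v hM (ltW ts).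
rewrite distrC ger0_norm; last by apply: le_trans h1; rewrite mulr_ge0 ?(ltW D0)// subr_ge0 ltW.
by rewrite distrC ger0_norm// subr_ge0 ltW.
Qed.

Lemma Ft_tcons_surj v (q : R) : exists t, sgd * Ft (tcons (t, v)) = q.
Proof.
have [M [M0 hM]] := ex_slope_bound; have d0 := D0.
pose p (t : R) := sgd * Ft (tcons (t, v)).
(* As [p] has slope at least [D], the value [q] is reached between 0 and [t0]. *)
pose t0 := (q - p 0) / D.
have cp a b : {within `[a, b], continuous p}.
  by apply: continuous_subspaceT; exact: Ft_tcons_continuous.
have [t00|t00] := leP 0 t0.
  have /andP[h _] := Ft_tcons v hM t00; rewrite subr0 in h.
  have := h; rewrite mulrC divfK ?gt_eqF// -/(p _) -/(p _) => h'.
  have q0 : p 0 <= q by move: t00; rewrite pmulr_lge0 ?invr_gt0// subr_ge0.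
  have [|c _ hc] := @IVT R p 0 t0 q t00 (cp _ _); last by exists c.
  by rewrite ge_min q0 /= le_max; apply/orP; right; lra.
have /andP[h _] := Ft_tcons v hM (ltW t00); rewrite sub0r in h.
have := h; rewrite mulrN mulrC divfK ?gt_eqF// -/(p _) -/(p _) => h'.
have q0 : q <= p 0.
  by move: t00; rewrite pmulr_llt0 ?invr_gt0// subr_lt0 => /ltW.
have [|c _ hc] := @IVT R p t0 0 q (ltW t00) (cp _ _); last by exists c.
by rewrite le_max q0 orbT andbT ge_min; apply/orP; left; lra.
Qed.

Lemma branch_surj c x : exists y, branch c y = x.
Proof.
pose v := [tuple gam * tnth x (widen_ord (leqnSn n) i) | i < n].
have [t ht] := Ft_tcons_surj v (sgd * (tnth x ord_max / gam ^+ n + c)).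
have g0 := gt_eqF gam0.
exists (tcons (t, v)); apply/eq_from_tnth => i.
have [j ->|->] := unliftP ord_max i.
  have -> : lift ord_max j = widen_ord (leqnSn n) j.
    by apply/val_inj; rewrite /= /bump leqNgt ltn_ord.
  by rewrite branch_widen tconsS tnth_mktuple mulrC mulKf ?g0.
rewrite branch_last.
have -> : Ft (tcons (t, v)) = tnth x ord_max / gam ^+ n + c.
  by rewrite -[LHS]mul1r -sgd_sqr -mulrA ht mulrA sgd_sqr mul1r.
by rewrite addrK mulrC divfK// expf_neq0// g0.
Qed.

Definition ibranch c x : n.+1.-tuple R := sval (cid (branch_surj c x)).

Lemma ibranchK c x : branch c (ibranch c x) = x.
Proof. exact: (svalP (cid (branch_surj c x))). Qed.

Lemma branchK c y : ibranch c (branch c y) = y.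
Proof. by apply: (@branch_inj c); rewrite ibranchK. Qed.

Lemma eball_ibranch c x z (e : R) : eball x e z ->
  eball (ibranch c x) (e / 9) (ibranch c z).
Proof.
move=> xz; have := branch_expand c (ibranch c x) (ibranch c z).
rewrite !ibranchK => h; have sg := sig.
have {xz} : sigma * sqdist (ibranch c x) (ibranch c z) < e ^+ 2 by apply: le_lt_trans xz.
rewrite /eball /= -/(sqdist _ _).
have : 0 <= sqdist (ibranch c x) (ibranch c z).
  by apply: sumr_ge0 => i _; exact: sqr_ge0.
by rewrite exprMn; move: (sqdist _ _) => S S0 hS; nra.
Qed.

Lemma eball_ibranch1 c x z (e : R) : 0 < e -> eball x e z ->
  eball (ibranch c x) e (ibranch c z).
Proof.
move=> e0 /(eball_ibranch c); apply: eballS; lra.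
Qed.

Definition lastshift (s : R) (x : n.+1.-tuple R) : n.+1.-tuple R :=
  [tuple tnth x i + (i == ord_max)%:R * s | i < n.+1].

Lemma measurable_lastshift :
  measurable_fun setT (fun p : R * n.+1.-tuple R => lastshift (gam ^+ n * p.1) p.2).
Proof.
apply/measurable_fun_tnthP => i.
rewrite (_ : _ \o _ = fun p => (tnth p.2 i + (i == ord_max)%:R * (gam ^+ n * p.1))%R); last first.
  by apply/funext => p /=; rewrite tnth_mktuple.
apply: measurable_funD.
  exact: (measurableT_comp (measurable_tnth i) measurable_snd).
by apply: measurable_funM => //; apply: measurable_funM => //; exact: measurable_fst.
Qed.

(** Changing [c] translates the last coordinate of the branch, so joint measurability in [c] and [x]
    follows from that of the single Lipschitz map [ibranch 0]. *)
Lemma ibranchE c x : ibranch c x = ibranch 0 (lastshift (gam ^+ n * c) x).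
Proof.
apply: (@branch_inj 0); rewrite ibranchK; apply/eq_from_tnth => i.
rewrite [RHS]tnth_mktuple.
have := congr1 (fun w => tnth w i) (ibranchK c x) => /=.
have [j ->|->] := unliftP ord_max i.
  have -> : lift ord_max j = widen_ord (leqnSn n) j.
    by apply/val_inj; rewrite /= /bump leqNgt ltn_ord.
  rewrite !branch_widen => ->; rewrite (_ : (_ == _) = false) ?mul0r ?addr0//.
  by apply/negbTE; rewrite -val_eqE /= neq_ltn ltn_ord.
by rewrite !branch_last eqxx mul1r => <-; ring.
Qed.

Lemma measurable_ibranch0 : measurable_fun setT (ibranch 0).
Proof.
apply/measurable_fun_tnthP => i.
apply: (@lip_measurable _ _ _ 1) => x z e e0 xz; rewrite mul1r /=.
by apply/ltW; apply: eball_coord => //; exact: eball_ibranch1.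
Qed.

Lemma measurable_ibranch :
  measurable_fun setT (fun p : R * n.+1.-tuple R => ibranch p.1 p.2).
Proof.
under eq_fun do rewrite ibranchE.
exact: (measurableT_comp measurable_ibranch0 measurable_lastshift).
Qed.

Lemma measurable_Ft : measurable_fun setT Ft.
Proof.
have [M [M0 hM]] := ex_slope_bound.
have a_le (i : 'I_n.+1) : exists m : R, forall a : R, i != ord0 -> a ^+ 2 <= gam ^- i ^+ 2 * B -> `|a| <= m.
  exists (Num.sqrt (gam ^- i ^+ 2 * B)) => a _ h.
  by rewrite -sqrtr_sqr ler_wsqrtr.
have [m hm] := choice a_le.
apply: (@lip_measurable _ _ _ (M + \sum_(i < n) m (lift ord0 i))) => y z e e0 yz.
have [a [-> /andP[a0 a1] ha]] := Ft_diff z y hM.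
rewrite big_ord_recl /= mulrDl; apply: (le_trans (ler_normD _ _)); apply: lerD.
  rewrite normrM; apply: ler_pM => //; last by apply/ltW; exact: eball_coord.
  have -> : `|a ord0| = sgd * a ord0; last by [].
  have sg1 : `|sgd| = 1 by rewrite /sgd normr_sg pd0_neq0//; exact: ccube0.
  rewrite -[LHS]mul1r -sg1 -normrM ger0_norm//.
  by apply: le_trans a0; exact: ltW.
rewrite mulr_suml; apply: (le_trans (ler_norm_sum _ _ _)); apply: ler_sum => i _.
rewrite normrM; apply: ler_pM => //; last by apply/ltW; exact: eball_coord.
by apply: hm => //; exact: ha.
Qed.

Lemma measurable_branch c : measurable_fun setT (branch c).
Proof.
apply/measurable_fun_tnthP => i.
have [j ->|->] := unliftP ord_max i.
  have -> : lift ord_max j = widen_ord (leqnSn n) j.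
    by apply/val_inj; rewrite /= /bump leqNgt ltn_ord.
  rewrite (_ : _ \o _ = fun y => tnth y (lift ord0 j) / gam); last first.
    by apply/funext => y /=; rewrite branch_widen.
  by apply: measurable_funM => //; exact: measurable_tnth.
rewrite (_ : _ \o _ = fun y => gam ^+ n * (Ft y - c)); last first.
  by apply/funext => y /=; rewrite branch_last.
by apply: measurable_funM => //; apply: measurable_funB => //; exact: measurable_Ft.
Qed.

(** * Change of variables along a branch *)

Lemma cl_tcons_line v : exists x0 : 'rV[R]_n.+1, forall t,
  cl (tcons (t, v)) = x0 + clip L t *: 'e_ord0.
Proof.
exists (\row_i (if i == ord0 then 0 else cl (tcons (0, v)) ord0 i)) => t.
apply/rowP => i; rewrite !mxE eqxx /=.
have [j ->|->] := unliftP ord0 i.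
  by rewrite !tconsS /= mulr0 addr0.
by rewrite eqxx tcons0 /= expr0 invr1 mul1r mulr1 add0r.
Qed.

(** [Jac] is [D] plus the excess [q] of the slope over [D], restricted to []-L, L[]. The constant
    integrates to [D * (b - a)]; the excess lives on the clipped interval, where [Phi0] is evaluated
    along a line and [h] is a primitive of [q]. *)
Lemma integral_Jac_tcons v (a b : R) : a <= b ->
  (\int[lebesgue_measure]_(t in `[a, b]) (Jac (tcons (t, v)))%:E =
   (sgd * Ft (tcons (b, v)) - sgd * Ft (tcons (a, v)))%:E)%E.
Proof.
move=> ab; have [x0 hx0] := cl_tcons_line v.
have cP : {in ocube (L + beta), continuous Phi0} by have [] := hC2.
have cP1 : {in ocube (L + beta), continuous (pd ord0 Phi0)} by have [] := hC2.
have dP : {in ocube (L + beta), forall x, derivable Phi0 x 'e_ord0}.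
  by have [_ + _ _ _] := hC2; apply.
have Q t : - L <= t <= L -> ccube L (x0 + t *: 'e_ord0).
  by move=> tL; have := ccube_cl (tcons (t, v)); rewrite hx0 clip_id.
pose q t := sgd * pd ord0 Phi0 (x0 + t *: 'e_ord0) - D.
pose h t := sgd * Phi0 (x0 + t *: 'e_ord0) - D * t.
pose E := `]- L, L[%classic : set R.
have JE t : Jac (tcons (t, v)) = D + (q t * \1_E t).
  rewrite /Jac /slope tcons0 /= indicE; case: ifPn => tL.
    rewrite mem_set/=; last by rewrite /E /= in_itv/= -ltr_norml.
    by rewrite mulr1 /q hx0 clip_id_lt// addrCA subrr addr0.
  rewrite memNset ?mulr0 ?addr0//.
  by rewrite /E /= in_itv/= -ltr_norml; exact/negP.
have q0 t : E t -> 0 <= q t.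
  rewrite /E /= in_itv/= => /andP[t1 t2]; rewrite subr_ge0; apply: slope_ge; apply: Q.
  by rewrite !ltW.
pose a' := clip L a; pose b' := clip L b.
have a'b' : a' <= b'.
  have [l [/andP[l0 l1] e]] := clip_diff L0 a b.
  by rewrite -subr_ge0 /a' /b' e mulr_ge0// subr_ge0.
have /andP[a'L a'R] : - L <= a' <= L by exact: clip_itv.
have /andP[b'L b'R] : - L <= b' <= L by exact: clip_itv.
have mJ : measurable_fun setT (fun t : R => Jac (tcons (t, v))).
  apply: (measurableT_comp measurable_Jac).
  exact: (measurableT_comp (@measurable_tcons _ _) (pair2_measurable v)).
have mq : measurable_fun setT (fun t => q t * \1_E t).
  have -> : (fun t => q t * \1_E t) = (fun t => Jac (tcons (t, v)) - D).
    by apply/funext => t; rewrite JE addrC addKr.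
  exact: measurable_funB.
under eq_integral do rewrite JE EFinD.
rewrite ge0_integralD//; last 3 first.
- by move=> t _; rewrite lee_fin ltW.
- move=> t _; rewrite lee_fin indicE; case: (boolP (t \in E)); rewrite ?mulr0// mulr1 inE.
  exact: q0.
- by apply/measurable_EFinP/measurable_funTS.
rewrite (@integral_cst _ _ _ lebesgue_measure _ _ D%:E)//= lebesgue_measure_itv /= lte_fin.
have -> : (D%:E * (if (a < b)%R then b%:E - a%:E else 0) = (D * (b - a))%:E)%E.
  have [_|ba] := ltP a b; first by rewrite EFinM.
  have -> : b = a by apply/le_anti; rewrite ba ab.
  by rewrite subrr mulr0 mule0.
have e1 : (\int[lebesgue_measure]_(t in `[a, b]) (q t * \1_E t)%:E =
   \int[lebesgue_measure]_(t in `[a', b']) (q t * \1_E t)%:E)%E.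
  rewrite [LHS]integral_mkcond [RHS]integral_mkcond; apply: eq_integral => t _.
  rewrite !patchE; have [tE|tE] := boolP (t \in E); last first.
    by rewrite indicE (negbTE tE) mulr0; do 2 case: ifP.
  suff -> : (t \in `[a, b]%classic) = (t \in `[a', b']%classic) by [].
  move: tE; rewrite inE /E /= in_itv/= => /andP[t1 t2].
  apply/idP/idP; rewrite !inE /= !in_itv/= => /andP[h1 h2].
    rewrite /a' /b' /clip ge_max le_max ge_min le_min h1 h2 !(ltW t1) !(ltW t2) /=.
    by rewrite orbT.
  move: h1 h2; rewrite /a' /b' /clip ge_max le_max ge_min le_min.
  move=> /andP[_ /orP[->|h1]]; last by rewrite leNgt t2 in h1.
  by move=> /orP[h2|/andP[-> _]//]; rewrite leNgt t1 in h2.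
have e2 : (\int[lebesgue_measure]_(t in `[a', b']) (q t * \1_E t)%:E = (h b' - h a')%:E)%E.
  have [e|ne] := eqVneq a' b'.
    by rewrite e set_itv1 integral_set1 subrr.
  have lt' : a' < b' by rewrite lt_neqAle ne.
  have eqE : {in `]a', b'[, forall t, q t * \1_E t = q t}.
    move=> t; rewrite in_itv/= => /andP[t1 t2]; rewrite indicE mem_set ?mulr1//.
    by rewrite /E /= in_itv/= (le_lt_trans a'L) ?(lt_le_trans _ b'R).
  rewrite (@eq_integral_itv_bounded R _ _ q)//; last 2 first.
  - exact: measurable_funTS.
  - apply: (eq_measurable_fun (fun t => q t * \1_E t)); last exact: measurable_funTS.
    by move=> t /[!inE]; exact: eqE.
  have Qin t : a' <= t <= b' -> x0 + t *: 'e_ord0 \in ocube (L + beta).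
    move=> /andP[t1 t2]; apply: (ccube_in beta0); apply: Q.
    by rewrite (le_trans a'L) ?(le_trans _ b'R).
  have hd t : t \in `]a', b'[ -> is_derive t 1 h (q t).
    rewrite in_itv/= => /andP[t1 t2].
    have d1 : is_derive t 1 (fun t => Phi0 (x0 + t *: 'e_ord0)) (pd ord0 Phi0 (x0 + t *: 'e_ord0)).
      by apply: is_derive_line; apply: dP; apply: Qin; rewrite !ltW.
    have := is_deriveB (is_deriveZ sgd d1) (is_deriveZ D (is_derive_id t (1 : R))).
    by rewrite /q -[D *: 1]/(D * 1) mulr1.
  have ch t : a' <= t <= b' -> h t @[t --> t] --> h t.
    move=> tab; apply: cvgB; last by apply: cvgM; [exact: cvg_cst|exact: cvg_id].
    apply: cvgM; first exact: cvg_cst.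
    apply: (@continuous_comp R 'rV[R]_n.+1 R (fun t : R => x0 + t *: 'e_ord0) Phi0).
      exact: continuous_line.
    by apply: cP; exact: Qin.
  rewrite (@continuous_FTC2 _ q h)//.
  - apply: continuous_in_subspaceT => t; rewrite inE/= in_itv/= => tab.
    apply: cvgB; last exact: cvg_cst.
    apply: cvgM; first exact: cvg_cst.
    apply: (@continuous_comp R 'rV[R]_n.+1 R (fun t : R => x0 + t *: 'e_ord0) (pd ord0 Phi0)).
      exact: continuous_line.
    by apply: cP1; exact: Qin.
  - split.
    + by move=> t /hd[].
    + by apply: cvg_at_right_filter; apply: ch; rewrite lexx.
    + by apply: cvg_at_left_filter; apply: ch; rewrite lexx andbT.
  - by move=> t /hd[_ <-]; rewrite derive1E.
rewrite [X in (_ + X)%E](etrans e1 e2) -EFinD; congr EFin.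
have sE p r : sgd * (p + sgd * D * r) = sgd * p + D * r.
  by rewrite mulrDr !mulrA sgd_sqr mul1r.
by rewrite /h /Ft !sE !hx0 !tcons0 -/a' -/b' /=; ring.
Qed.

Variables (mu : {measure set (n.+1.-tuple R) -> \bar R})
  (nu : {measure set (n.-tuple R) -> \bar R}).
Hypotheses (hmu : is_lebesgue mu) (hnu : is_lebesgue nu).

Lemma Jac_ge0 y : 0 <= Jac y.
Proof. by apply: le_trans (Jac_ge y); exact: ltW. Qed.

(** [sgd * Ft] is an increasing bijection on each line in the first direction, so the preimage of an
    interval is an interval; for negative [sgd] its ends are exchanged. *)
Lemma branch_tcons_itv c v (a b : R) : a <= b -> exists t1 t2 : R,
  [/\ t1 <= t2, forall t, (a <= gam ^+ n * (Ft (tcons (t, v)) - c) <= b) = (t1 <= t <= t2) &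
   sgd * Ft (tcons (t2, v)) - sgd * Ft (tcons (t1, v)) = (b - a) / gam ^+ n].
Proof.
move=> ab; have [M [M0 hM]] := ex_slope_bound.
have g0 : 0 < gam ^+ n by rewrite exprn_gt0.
have incr s t : (sgd * Ft (tcons (s, v)) <= sgd * Ft (tcons (t, v))) = (s <= t).
  apply/idP/idP; last first.
    move=> st; rewrite -subr_ge0; have /andP[h _] := Ft_tcons v hM st.
    by apply: le_trans h; rewrite mulr_ge0 ?(ltW D0)// subr_ge0.
  apply: contraTT; rewrite -!ltNge => ts; rewrite -subr_gt0.
  have /andP[h _] := Ft_tcons v hM (ltW ts).
  by apply: lt_le_trans h; rewrite mulr_gt0// subr_gt0.
have [t1 h1] := Ft_tcons_surj v (if 0 < sgd then a / gam ^+ n + c else - (b / gam ^+ n + c)).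
have [t2 h2] := Ft_tcons_surj v (if 0 < sgd then b / gam ^+ n + c else - (a / gam ^+ n + c)).
have ab' : a / gam ^+ n <= b / gam ^+ n by rewrite ler_pM2r ?invr_gt0.
have s1 : sgd = if 0 < sgd then 1 else -1.
  rewrite /sgd; have := pd0_neq0 ccube0; case: sgrP => //= _ _.
  - by rewrite ltr01.
  - by rewrite ltr0N1.
exists t1, t2; split.
- by rewrite -incr h1 h2; case: ifP => _; lra.
- move=> t; rewrite -(incr t1 t) -(incr t t2) h1 h2.
  have -> : (a <= gam ^+ n * (Ft (tcons (t, v)) - c)) = (a / gam ^+ n + c <= Ft (tcons (t, v))).
    by rewrite -lerBrDr ler_pdivrMr// [gam ^+ n * _]mulrC.
  have -> : (gam ^+ n * (Ft (tcons (t, v)) - c) <= b) = (Ft (tcons (t, v)) <= b / gam ^+ n + c).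
    by rewrite -lerBlDr ler_pdivlMr// [gam ^+ n * _]mulrC.
  move: s1; case: ifP => _ ->; first by rewrite mul1r.
  by rewrite mulN1r !lerN2 andbC.
- by rewrite h1 h2 mulrBl; case: ifP => _; ring.
Qed.

(** For a fixed tail [v], lying over the box separates into a condition on [v] (a box with sides
    scaled by [gam]) and an interval for the first coordinate, on which [Jac] integrates to the last
    side divided by [gam ^+ n]. The powers of [gam] cancel. *)
Lemma is_lebesgue_branch c : is_lebesgue (dpush mu (branch c) Jac).
Proof.
move=> a b ab; rewrite /dpush.
have g0 : 0 < gam ^+ n by rewrite exprn_gt0.
have gn0 := gt_eqF gam0.
have mA : measurable (branch c @^-1` box a b).
  rewrite -[X in measurable X]setTI; apply: measurable_branch => //; exact: measurable_box.
rewrite integral_mkcond.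
have mF : measurable_fun setT ((fun y => (Jac y)%:E) \_ (branch c @^-1` box a b)).
  apply/(measurable_restrictT _ _).1 => //; apply/measurable_funTS/measurable_EFinP.
  exact: measurable_Jac.
have F0 y : (0 <= ((fun y => (Jac y)%:E) \_ (branch c @^-1` box a b)) y)%E.
  by rewrite patchE; case: ifP => // _; rewrite lee_fin Jac_ge0.
rewrite (ge0_integral_tcons hmu hnu)//.
rewrite (@fubini_tonelli2 _ _ _ _ _ lebesgue_measure (sf_lebesgue hnu)
  (fun p => ((fun y => (Jac y)%:E) \_ (branch c @^-1` box a b)) (tcons p)))//; last first.
  exact: (measurableT_comp mF (@measurable_tcons _ _)).
pose a' := [tuple gam * tnth a (widen_ord (leqnSn n) i) | i < n].
pose b' := [tuple gam * tnth b (widen_ord (leqnSn n) i) | i < n].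
have inner v : fubini_G lebesgue_measure
    (fun p => ((fun y => (Jac y)%:E) \_ (branch c @^-1` box a b)) (tcons p)) v =
   (((tnth b ord_max - tnth a ord_max) / gam ^+ n)%:E * (\1_(box a' b') v)%:E)%E.
  have [t1 [t2 [t12 ht <-]]] := branch_tcons_itv c v (ab ord_max).
  have inE' t : (branch c (tcons (t, v)) \in box a b) = (v \in box a' b') && (t1 <= t <= t2).
    rewrite -ht; apply/idP/idP.
      rewrite inE => h; apply/andP; split; last by have := h ord_max; rewrite branch_last.
      rewrite inE => i; have := h (widen_ord (leqnSn n) i).
      rewrite branch_widen tconsS !tnth_mktuple ler_pdivlMr// ler_pdivrMr//.
      by rewrite ![_ * gam]mulrC.
    move=> /andP[]; rewrite !inE => h1 h2 i; have [j ->|->] := unliftP ord_max i; last first.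
      by rewrite branch_last.
    have -> : lift ord_max j = widen_ord (leqnSn n) j.
      by apply/val_inj; rewrite /= /bump leqNgt ltn_ord.
    have := h1 j; rewrite branch_widen tconsS !tnth_mktuple ler_pdivlMr// ler_pdivrMr//.
    by rewrite ![_ * gam]mulrC.
  have inE2 t : (tcons (t, v) \in branch c @^-1` box a b) = (branch c (tcons (t, v)) \in box a b).
    by apply/idP/idP; rewrite !inE.
  rewrite /fubini_G indicE; case: (boolP (v \in box a' b')) => hv; last first.
    rewrite mule0 integral0_eq// => t _; rewrite patchE ifF//.
    by rewrite inE2 inE' (negbTE hv).
  rewrite mule1 -integral_Jac_tcons// [RHS]integral_mkcond; apply: eq_integral => t _.
  rewrite !patchE inE2 inE' hv /=; congr (if _ then _ else _).
  by apply/idP/idP; rewrite inE /= in_itv.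
under eq_integral do rewrite inner.
have mb : measurable (box a' b') by exact: measurable_box.
have d0 : 0 <= (tnth b ord_max - tnth a ord_max) / gam ^+ n.
  by rewrite divr_ge0 ?subr_ge0// ltW.
rewrite ge0_integralZl//; last exact/measurable_EFinP.
rewrite integral_indic// setIT /sf_lebesgue hnu; last first.
  by move=> i; rewrite !tnth_mktuple ler_pM2l.
rewrite big_ord_recr /= -EFinM; congr EFin.
rewrite [RHS]mulrC mulrAC -mulrA; congr (_ * _).
under eq_bigr do rewrite !tnth_mktuple -mulrBr.
rewrite big_split /= prodr_const card_ord mulrAC mulfV ?mul1r//.
by rewrite gt_eqF.
Qed.

Lemma ge0_integral_ibranch c (Q : n.+1.-tuple R -> \bar R) :
  measurable_fun setT Q -> (forall y, 0 <= Q y)%E ->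
  (\int[mu]_x Q (ibranch c x) = \int[mu]_y (Q y * (Jac y)%:E))%E.
Proof.
move=> mQ Q0.
have mi : measurable_fun setT (ibranch c).
  exact: (measurableT_comp measurable_ibranch (pair1_measurable c)).
rewrite (@lebesgue_change_of_variables _ _ mu _ _ mu (branch c) Jac hmu)//.
- by apply: eq_integral => y _; rewrite branchK.
- exact: measurable_branch.
- exact: measurable_Jac.
- exact: Jac_ge0.
- exact: is_lebesgue_branch.
- exact: (measurableT_comp mQ mi).
Qed.

Lemma branch_e1shift (y : n.+1.-tuple R) (s t : R) : s <= t ->
  9 * (t - s) <= `|gam ^+ n * Ft (e1shift t y) - gam ^+ n * Ft (e1shift s y)|.
Proof.
move=> st; have [M [M0 hM]] := ex_slope_bound.
have sh r : e1shift r y = tcons (tnth y ord0 + r, ttail y).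
  apply/eq_from_tnth => i; rewrite tnth_mktuple.
  have [j ->|->] := unliftP ord0 i; first by rewrite tconsS tnth_mktuple mul0r addr0.
  by rewrite tcons0 eqxx mul1r.
have st' : tnth y ord0 + s <= tnth y ord0 + t by rewrite lerD2l.
have /andP[h _] := Ft_tcons (ttail y) hM st'.
rewrite -!sh in h.
have e : tnth y ord0 + t - (tnth y ord0 + s) = t - s by ring.
rewrite e in h.
have g0 : 0 < gam ^+ n by rewrite exprn_gt0.
have sg1 : `|sgd| = 1 by rewrite /sgd normr_sg pd0_neq0//; exact: ccube0.
have gD : 9 <= gam ^+ n * D.
  have gD0 : 0 < gam ^+ n * D by rewrite mulr_gt0.
  have s8 := sig; have c2 := C2gt; rewrite leNgt; apply/negP => h9.
  have : (gam ^+ n * D) ^+ 2 < 81 by nra.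
  by rewrite DE; nra.
have nE (z : R) : `|z| = `|sgd * z| by rewrite normrM sg1 mul1r.
rewrite -mulrBr normrM gtr0_norm// [`|_ - _|]nE [sgd * _]mulrBr.
apply: (@le_trans _ _ (gam ^+ n * (D * (t - s)))).
  by rewrite mulrA ler_wpM2r// subr_ge0.
rewrite ler_pM2l//; apply: (le_trans h); exact: ler_norm.
Qed.

(** This upper speed prevents a short segment from meeting the preimages of two different faces of
    the same kind. *)
Lemma branch_e1shift_le : exists K, 0 < K /\ forall (y : n.+1.-tuple R) (s t : R),
  `|gam ^+ n * Ft (e1shift t y) - gam ^+ n * Ft (e1shift s y)| <= K * `|t - s|.
Proof.
have [M [M0 hM]] := ex_slope_bound.
have g0 : 0 < gam ^+ n by rewrite exprn_gt0.
have d0 := D0.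
exists (gam ^+ n * M); split; first by rewrite mulr_gt0.
move=> y s t; wlog st : s t / s <= t => [W|].
  by have [/W//|/ltW/W] := leP s t; rewrite distrC [`|s - t|]distrC.
have sh r : e1shift r y = tcons (tnth y ord0 + r, ttail y).
  apply/eq_from_tnth => i; rewrite tnth_mktuple.
  have [j ->|->] := unliftP ord0 i; first by rewrite tconsS tnth_mktuple mul0r addr0.
  by rewrite tcons0 eqxx mul1r.
have st' : tnth y ord0 + s <= tnth y ord0 + t by rewrite lerD2l.
have /andP[h1 h] := Ft_tcons (ttail y) hM st'.
rewrite -!sh in h h1.
have e : tnth y ord0 + t - (tnth y ord0 + s) = t - s by ring.
rewrite e in h h1.
have sg1 : `|sgd| = 1 by rewrite /sgd normr_sg pd0_neq0//; exact: ccube0.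
rewrite -mulrBr normrM gtr0_norm// -[X in _ * X <= _]mul1r -sg1 -normrM mulrBr -mulrA.
rewrite ler_pM2l// (ger0_norm (_ : 0 <= t - s)) ?subr_ge0// ger0_norm//.
by apply: le_trans h1; rewrite mulr_ge0 ?(ltW D0)// subr_ge0.
Qed.

End extension.

(** * Averaging a family of functions against the density *)

Section averaging.
Variables (R : realType) (n : nat).
Local Notation tup := (n.-tuple R).
Variable mu : {sigma_finite_measure set tup -> \bar R}.
Variables (H : R -> R) (P : R -> tup -> R) (c : \bar R).
Hypotheses (hH : prob_density H)
  (mP : measurable_fun setT (fun q : R * tup => P q.1 q.2))
  (c_lty : (c < +oo)%E)
  (P_L1 : forall th, (\int[mu]_x (`|P th x|)%:E <= c)%E).
Local Notation leb := (@lebesgue_measure R).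
Local Open Scope ereal_scope.

Let HP (q : R * tup) : \bar R := (H q.1 * P q.1 q.2)%:E.

(** By Fubini the integrand is integrable in [th] for almost every [x]; elsewhere the value given by
    [fine] is irrelevant. *)
Definition avg (x : tup) : R := fine (\int[leb]_th (H th * P th x)%:E).

Let H0 t : (0 <= H t)%R. Proof. by case: hH. Qed.
Let mH : measurable_fun setT H. Proof. by case: hH. Qed.
Let H1 : \int[leb]_t (H t)%:E = 1. Proof. by case: hH. Qed.

Let mHP : measurable_fun setT HP.
Proof.
apply/measurable_EFinP; apply: measurable_funM => //.
exact: (measurableT_comp mH measurable_fst).
Qed.

Lemma integral_density_le (b : R -> \bar R) (C : \bar R) :
  measurable_fun setT b -> (forall th, 0 <= b th) -> (forall th, b th <= C) ->
  \int[leb]_th ((H th)%:E * b th) <= C.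
Proof.
move=> mb b0 bC; have C0 : 0 <= C by exact: le_trans (b0 0%R) (bC 0%R).
have mHE : measurable_fun setT (EFin \o H) by exact/measurable_EFinP.
apply: (@le_trans _ _ (\int[leb]_th (C * (H th)%:E))).
  apply: ge0_le_integral => //.
  - by move=> t _; rewrite mule_ge0// lee_fin.
  - exact: emeasurable_funM.
  - exact: measurable_funeM.
  - by move=> t _; rewrite muleC lee_wpmul2r// lee_fin.
rewrite ge0_integralZl//; last by move=> t _; rewrite lee_fin.
by rewrite H1 mule1.
Qed.

Let mabsP : measurable_fun setT (fun q : R * tup => (`|P q.1 q.2|%R)%:E).
Proof. by apply/measurable_EFinP; exact: measurableT_comp. Qed.

Let absHP th x : `|HP (th, x)| = (H th)%:E * (`|P th x|%R)%:E.
Proof. by rewrite /HP /= normrM ger0_norm. Qed.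

Let mabsPth th : measurable_fun setT (fun x => (`|P th x|%R)%:E).
Proof. exact: (measurableT_comp mabsP (pair1_measurable th)). Qed.

Let int_absHP : \int[leb]_th \int[mu]_x `|HP (th, x)| <= c.
Proof.
rewrite [leLHS](_ : _ = \int[leb]_th ((H th)%:E * \int[mu]_x (`|P th x|%R)%:E)); last first.
  apply: eq_integral => th _; rewrite -ge0_integralZl// ?lee_fin//.
  by apply: eq_integral => x _; exact: absHP.
apply: integral_density_le => //.
- exact: (measurable_fun_fubini_tonelli_F (m2 := mu) _ mabsP).
- by move=> th; apply: integral_ge0 => x _; rewrite lee_fin.
Qed.

Let iHP : (leb \x mu).-integrable setT HP.
Proof. by apply/integrable12ltyP => //; exact: le_lt_trans int_absHP _. Qed.

Let avg_ae : ae_eq mu setT (EFin \o avg) (fubini_G leb HP).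
Proof.
have := ae_integrable2 iHP; apply: filterS => x ix _.
by rewrite /avg /= fineK//; exact: integrable_fin_num.
Qed.

Lemma measurable_avg : measurable_fun setT avg.
Proof.
have mF : measurable_fun setT (fubini_G leb HP) by exact: measurable_fubini_G iHP.
exact: (measurableT_comp (fine_measurable measurableT) mF).
Qed.

Lemma avg_L1 : \int[mu]_x (`|avg x|%R)%:E <= c.
Proof.
have mabs : measurable_fun setT (fun q => `|HP q|) by exact: measurableT_comp.
have h := int_absHP.
rewrite (fubini_tonelli (m1 := leb) (m2 := mu) _ mabs) in h; last by [].
apply: le_trans h; apply: ae_ge0_le_integral => //.
- by apply/measurable_EFinP; apply: measurableT_comp => //; exact: measurable_avg.
- by move=> x _; exact: integral_ge0.
- exact: (measurable_fun_fubini_tonelli_G (m1 := leb) _ mabs).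
move: avg_ae; apply: filterS => x hx _; have := hx Logic.I => /= {}hx.
rewrite [leLHS](_ : _ = `|(avg x)%:E|)// hx; apply: le_abse_integral => //.
exact: (measurableT_comp mHP (pair2_measurable x)).
Qed.

Lemma integrable_avg : mu.-integrable setT (EFin \o avg).
Proof.
apply/integrableP; split; first by apply/measurable_EFinP; exact: measurable_avg.
by apply: le_lt_trans c_lty; exact: avg_L1.
Qed.

Lemma integral_avg B : measurable B ->
  \int[mu]_(x in B) (avg x)%:E =
  \int[leb]_th ((H th)%:E * \int[mu]_(x in B) (P th x)%:E).
Proof.
move=> mB.
pose F (q : R * tup) := HP q * (\1_B q.2)%:E.
have m1 : measurable_fun setT (fun q : R * tup => (\1_B q.2)%:E : \bar R).
  apply/measurable_EFinP; apply: (measurableT_comp (measurable_indic mB)).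
  exact: measurable_snd.
have mF : measurable_fun setT F by exact: emeasurable_funM.
have iF : (leb \x mu).-integrable setT F.
  apply: le_integrable iHP => //= q _.
  rewrite lee_fin indicE; case: (_ \in B); first by rewrite mulr1.
  by rewrite mulr0 normr0.
rewrite [LHS](_ : _ = \int[mu]_x \int[leb]_th F (th, x)); last first.
  rewrite (ae_eq_integral (fubini_G leb HP))//; last 3 first.
  - by apply/measurable_EFinP; apply: measurable_funTS; exact: measurable_avg.
  - by apply: measurable_funTS; exact: measurable_fubini_G iHP.
  - by apply: ae_eq_subset avg_ae.
  rewrite integral_mkcond; apply: eq_integral => x _.
  rewrite patchE /F /fubini_G /= indicE; case: ifP => _.
    by apply: eq_integral => th _; rewrite mule1.
  by under [RHS]eq_integral do rewrite mule0; rewrite integral0.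
rewrite -(Fubini iF); apply: eq_integral => th _.
have iP : mu.-integrable B (EFin \o P th).
  apply: (@integrableS _ _ _ _ setT) => //; apply/integrableP; split.
    by apply/measurable_EFinP; exact: (measurableT_comp mP (pair1_measurable th)).
  exact: le_lt_trans (P_L1 th) c_lty.
rewrite -integralZl// [RHS]integral_mkcond; apply: eq_integral => x _.
by rewrite patchE /F /HP /= indicE; case: ifP => _; rewrite ?mule1 ?mule0 ?EFinM.
Qed.

Section oscillation.
Variables (e : R) (Z : set (R * tup)) (b : R -> tup -> \bar R) (C : \bar R).
Hypotheses (e0 : (0 < e)%R) (hmu : is_lebesgue mu) (mZ : measurable Z)
  (Z0 : forall th, mu [set x | Z (th, x)] = 0)
  (mb : measurable_fun setT (fun q : R * tup => b q.1 q.2))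
  (b0 : forall th x, 0 <= b th x)
  (Pb : forall th x z w, ~ Z (th, z) -> ~ Z (th, w) -> eball x e z -> eball x e w ->
     (`|P th z - P th w|%R)%:E <= b th x)
  (bC : forall th, \int[mu]_x b th x <= C).

(** For each [th] the bound [Pb] excludes a null set of [x]; by Tonelli, almost every [x] is
    excluded for a null set of [th] only. Such [x] with integrable fibre form the full-measure set
    [G1], on which [Pb] may be integrated over [th]. *)
Lemma integral_osc_avg : \int[mu]_x osc mu avg (eball x e) <= C.
Proof.
have mabs : measurable_fun setT (fun q => `|HP q|) by exact: measurableT_comp.
pose u x := \int[leb]_th `|HP (th, x)|.
have mu_ : measurable_fun setT u by exact: (measurable_fun_fubini_tonelli_G (m1 := leb) _ mabs).
have u0 x : 0 <= u x by exact: integral_ge0.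
pose v x := leb (ysection Z x).
have mv : measurable_fun setT v by exact: measurable_fun_ysection.
have v0 x : 0 <= v x by exact: measure_ge0.
have iv : \int[mu]_x v x = 0.
  have := @indic_fubini_tonelli _ _ _ _ _ leb mu Z mZ.
  rewrite indic_fubini_tonelli_FE// indic_fubini_tonelli_GE// => <-.
  apply: integral0_eq => th _ /=; rewrite -[RHS](Z0 th); congr (mu _).
  by apply/seteqP; split => x; rewrite /xsection /= inE.
pose G1 := [set x | u x < +oo /\ v x = 0].
have mG1 : measurable G1.
  have -> : G1 = (u @^-1` [set t | t < +oo]) `&` (v @^-1` [set 0]) by [].
  apply: measurableI; rewrite -[X in measurable X]setTI.
    exact: emeasurable_fun_infty_o.
  by apply: mv => //.
have G10 : mu (~` G1) = 0.
  apply/negligibleP; first exact: measurableC.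
  have /= := ae_integrable2 iHP => h1.
  have h2 : ae_eq mu setT v (cst 0).
    apply/ae_eq_integral_abs => //; rewrite -[RHS]iv; apply: eq_integral => x _.
    by rewrite gee0_abs.
  suff : {ae mu, forall x, G1 x} by [].
  move: h1 h2; apply: filterS2 => x ix /(_ Logic.I) vx; split => //.
  by have /integrableP[] := ix.
pose M x := \int[leb]_th ((H th)%:E * b th x).
have mHb : measurable_fun setT (fun q : R * tup => (H q.1)%:E * b q.1 q.2).
  apply: emeasurable_funM => //; apply/measurable_EFinP.
  exact: (measurableT_comp mH measurable_fst).
have Hb0 q : 0 <= (H q.1)%:E * b q.1 q.2 by rewrite mule_ge0// lee_fin.
have oM x : osc mu avg (eball x e) <= M x.
  apply: (osc_le mG1 G10) => z w [uz vz] [uw vw] xz xw.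
  have ix y : u y < +oo -> leb.-integrable setT (fun th => HP (th, y)).
    move=> uy; apply/integrableP; split => //.
    exact: (measurableT_comp mHP (pair2_measurable y)).
  have iz := ix _ uz; have iw := ix _ uw.
  have mHPy y : measurable_fun setT (fun th => HP (th, y)).
    exact: (measurableT_comp mHP (pair2_measurable y)).
  have -> : (`|avg z - avg w|%R)%:E = `| \int[leb]_th (HP (th, z) - HP (th, w))|.
    rewrite integralB// /avg.
    have /fineK {2}<- := integrable_fin_num measurableT iz.
    by have /fineK {2}<- := integrable_fin_num measurableT iw.
  have mD : measurable_fun setT (fun th => HP (th, z) - HP (th, w)).
    exact: emeasurable_funB.
  apply: (le_trans (le_abse_integral leb measurableT mD)).
  apply: ae_ge0_le_integral => //.
  - by apply: measurableT_comp => //; exact: emeasurable_funB.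
  - by move=> th _; exact: (Hb0 (th, x)).
  - exact: (measurableT_comp mHb (pair2_measurable x)).
  have mys y : measurable (ysection Z y) by exact: measurable_ysection.
  exists (ysection Z z `|` ysection Z w); split.
  - by apply: measurableU; exact: mys.
  - by apply: null_set_setU => //; exact: mys.
  - move=> th /= h; apply: contrapT => hn; apply: h => _.
    have nz : ~ ysection Z z th by move=> ?; apply: hn; left.
    have nw : ~ ysection Z w th by move=> ?; apply: hn; right.
    rewrite /HP /= -mulrBr normrM ger0_norm// EFinM lee_wpmul2l ?lee_fin//.
    apply: Pb => // hZ; [apply: nz|apply: nw]; by rewrite /ysection /= inE.
apply: (@le_trans _ _ (\int[mu]_x M x)).
  apply: ge0_le_integral => //.
  - by move=> x _; exact: (osc_ge0 hmu x measurable_avg e0).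
  - exact: (measurable_osc mu measurable_avg e0).
  - exact: (measurable_fun_fubini_tonelli_G (m1 := leb) _ mHb).
rewrite -(fubini_tonelli (m1 := leb) (m2 := mu) _ mHb)//.
rewrite [leLHS](_ : _ = \int[leb]_th ((H th)%:E * \int[mu]_x b th x)); last first.
  apply: eq_integral => th _ /=; rewrite ge0_integralZl// ?lee_fin//.
  exact: (measurableT_comp mb (pair1_measurable th)).
apply: integral_density_le => //.
- exact: (measurable_fun_fubini_tonelli_F (m2 := mu) _ mb).
- by move=> th; exact: integral_ge0.
Qed.

End oscillation.
End averaging.

(** * Null sets and invariance of the oscillation under them *)

Section null_hyperplane.
Variables (R : realType) (n : nat) (mu : {measure set (n.-tuple R) -> \bar R}).
Hypothesis hmu : is_lebesgue mu.

Lemma measurable_hyperplane (i : 'I_n) (a : R) : measurable [set x : n.-tuple R | tnth x i = a].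
Proof.
have -> : [set x : n.-tuple R | tnth x i = a] = setT `&` (@tnth n R ^~ i) @^-1` [set a].
  by rewrite setTI.
exact: measurable_tnth.
Qed.

Lemma hyperplane_null (i : 'I_n) (a : R) : mu [set x : n.-tuple R | tnth x i = a] = 0%E.
Proof.
pose side (s : R) := [tuple if j == i then a else s | j < n].
have sideE (s : R) j : tnth (side s) j = if j == i then a else s by rewrite tnth_mktuple.
pose bx (m : nat) := box (side (- m%:R)) (side m%:R).
have bx0 m : mu (bx m) = 0%E.
  rewrite hmu; last first.
    by move=> j; rewrite !sideE; case: ifP => _ //; rewrite (@le_trans _ _ 0)// oppr_le0.
  by rewrite (bigD1 i)//= !sideE eqxx subrr mul0r.
apply/negligibleP; first exact: measurable_hyperplane.
apply: (@negligibleS _ _ _ _ (\bigcup_m bx m)); last first.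
  by apply: negligible_bigcup => m; apply/negligibleP; [exact: measurable_box|exact: bx0].
move=> x xi; have : (\bigcup_m @cbox R n m) x by rewrite bigcup_cbox.
move=> [m _ xm]; exists m => // j; have := xm j; rewrite !tnth_mktuple.
by case: eqP => [->|_ //]; rewrite xi lexx.
Qed.

End null_hyperplane.

Lemma osc_ae_eq (R : realType) n (mu : {sigma_finite_measure set (n.-tuple R) -> \bar R})
    (f g : n.-tuple R -> R) (G A : set (n.-tuple R)) :
  measurable G -> mu (~` G) = 0%E -> {in G, f =1 g} ->
  osc mu f A = osc mu g A.
Proof.
wlog suff h : f g / measurable G -> mu (~` G) = 0%E -> {in G, f =1 g} ->
    (osc mu f A <= osc mu g A)%E.
  move=> mG G0 fg; apply/eqP; rewrite eq_le !h// => x Gx; exact/esym/fg.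
move=> mG G0 fg; have mGC := measurableC mG.
apply: le_ereal_inf_tmp => M /= hM.
have hG : \forall z \ae (mu \x mu)%E, G z.1 /\ G z.2.
  apply: (@negligibleS _ _ _ _ ((~` G `*` setT) `|` (setT `*` ~` G))).
    move=> [z w] /= hzw; have [Gz|] := pselect (G z); last by left.
    have [Gw|] := pselect (G w); last by right.
    by exfalso; apply: hzw.
  apply: negligibleU; apply/negligibleP; try exact: measurableX.
    by rewrite [LHS]product_measure1E//= G0 mul0e.
  by rewrite [LHS]product_measure1E//= G0 mule0.
apply: ereal_inf_lbound => /=; move: hM hG; apply: filterS2 => -[z w] /= h [Gz Gw]; rewrite !fg ?inE//.
Qed.

Lemma integral_osc_le (R : realType) n (mu : {sigma_finite_measure set (n.-tuple R) -> \bar R})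
    (f : n.-tuple R -> R) (e0 e : R) : 0 < e < e0 ->
  (\int[mu]_x osc mu f (eball x e) <= e%:E * seminorm1 mu e0 f)%E.
Proof.
move=> he; have /andP[e_gt0 _] := he.
rewrite -lee_pdivrMl//; apply: ereal_sup_ubound; exists e; split => //.
Qed.

(** With [t] the square root of [s], the equation becomes [t^2 - (2 + c) * t + 1 = 0]. Here
    [c >= 4 * 4 / 2 = 8], since [Y >= 4] and the ratio of ball volumes is at least 1/2. A root above
    1 satisfies [t + 1 / t >= 10], hence [t > 9]. *)
Lemma S_k_gt81 (R : realType) (leb : forall n : nat, {measure set (n.-tuple R) -> \bar R})
  (Hleb : forall n : nat, is_lebesgue (leb n)) n : (0 < n)%N ->
  81 < S_k (unit_ball_vol leb) n.+1 (n.+1 + 2)%:R.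
Proof.
move=> n0; set Y : R := _%:R; set gm := unit_ball_vol leb.
have gm0 m : 0 < gm m.
  apply: fine_gt0; rewrite unit_ball_vol_gt0 ?unit_ball_vol_lty//.
have Y4 : 4 <= Y by rewrite /Y ler_nat addn2 !ltnS.
pose c := 4 * Y * (gm n / gm n.+1).
have c8 : 8 <= c.
  have : 1 / 2 <= gm n / gm n.+1.
    by rewrite ler_pdivlMr//; have := unit_ball_vol_leS Hleb n; rewrite -/gm; lra.
  rewrite /c; set r := gm n / _ => r2; nra.
have etaE s : eta0 gm n.+1 s Y = (Num.sqrt s)^-1 + c / (Num.sqrt s - 1).
  by rewrite /eta0 /= /c -/Y; congr (_ + _); ring.
have key (t : R) : 1 < t -> t^-1 + c / (t - 1) = 1 <-> t ^+ 2 - (2 + c) * t + 1 = 0.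
  move=> t1; have t0 : t != 0 by lra.
  have t10 : t - 1 != 0 by lra.
  have E : t^-1 + c / (t - 1) - 1 = - (t ^+ 2 - (2 + c) * t + 1) / (t * (t - 1)).
    by field; rewrite t0 t10.
  split => h.
    have : - (t ^+ 2 - (2 + c) * t + 1) / (t * (t - 1)) = 0 by rewrite -E h subrr.
    move/eqP; rewrite mulf_eq0 invr_eq0 mulf_eq0 (negbTE t0) (negbTE t10) !orbF oppr_eq0.
    by move/eqP.
  by apply/eqP; rewrite -subr_eq0 E h oppr0 mul0r.
have [S1 SE] : 1 < S_k gm n.+1 Y /\ eta0 gm n.+1 (S_k gm n.+1 Y) Y = 1.
  (* [S_k] would default to 0 if the equation had no solution, so the larger root of the quadratic
     has to be exhibited. *)
  rewrite /S_k; case: xgetP => [//|/(_ _)].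
  pose d := Num.sqrt ((2 + c) ^+ 2 - 4).
  have d0 : 0 <= d by exact: sqrtr_ge0.
  have dE : d ^+ 2 = (2 + c) ^+ 2 - 4 by rewrite sqr_sqrtr//; nra.
  pose t := (2 + c + d) / 2.
  have t1 : 1 < t by rewrite /t; lra.
  move=> /(_ (t ^+ 2)) []; split; first by nra.
  rewrite etaE sqrtr_sqr gtr0_norm; last by lra.
  apply/key => //; have -> : t ^+ 2 - (2 + c) * t + 1 = (d ^+ 2 - ((2 + c) ^+ 2 - 4)) / 4.
    by rewrite /t; field.
  by rewrite dE subrr mul0r.
rewrite etaE in SE; set S := S_k _ _ _ in S1 SE *.
have S0 : 0 <= S by lra.
have t1 : 1 < Num.sqrt S.
  by rewrite -[ltLHS]sqrtr1 ltr_sqrt; lra.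
have /key := SE => /(_ t1) h; have := sqr_sqrtr S0.
set t := Num.sqrt S in t1 h *; move=> <-; have : 9 < t by nra.
by move=> ?; nra.
Qed.

(** Tailored to sums over branches: different branches use disjoint strips, so a sum over all of
    them costs no more than a single term. *)
Lemma sume_at_most_one (R : realType) N (a : 'I_N -> \bar R) (c : \bar R) :
  (0 <= c)%E -> (forall i, 0 <= a i <= c)%E ->
  (forall i j, i != j -> a i = 0%E \/ a j = 0%E) ->
  (\sum_i a i <= c)%E.
Proof.
move=> c0 ac one.
have [h|/existsNP[i ai]] := pselect (forall i, a i = 0%E).
  by rewrite big1// => i _; exact: h.
rewrite (bigD1 i)//= big1 ?adde0; first by have /andP[] := ac i.
by move=> j ji; have [//|] := one _ _ ji.
Qed.

Lemma lebesgue_measure_diam (R : realType) (A : set R) (d : R) : measurable A ->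
  0 <= d -> (forall s t, A s -> A t -> s - t <= d) ->
  (lebesgue_measure A <= d%:E)%E.
Proof.
move=> mA d0 hA.
have [->|/set0P[t0 At0]] := eqVneq A set0; first by rewrite measure0 lee_fin.
have lbA : has_lbound A by exists (t0 - d) => t At; have := hA _ _ At0 At; lra.
have sub : A `<=` `[inf A, inf A + d]%classic.
  move=> t At; rewrite /= in_itv/=; apply/andP; split; first exact: ge_inf.
  rewrite -lerBlDr; apply: lb_le_inf; first by exists t0.
  by move=> s As; have := hA _ _ At As; lra.
apply: (@le_trans _ _ (lebesgue_measure (`[inf A, inf A + d]%classic : set R))).
  by apply: le_measure; rewrite ?inE.
rewrite lebesgue_measure_itv/= lte_fin; case: ifP => _; rewrite ?lee_fin//; lra.
Qed.

Lemma measurable_e1shiftN (R : realType) n :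
  measurable_fun setT (fun q : R * n.+1.-tuple R => e1shift (- q.1) q.2).
Proof.
apply/measurable_fun_tnthP => i.
rewrite (_ : _ \o _ = fun q => tnth q.2 i + (i == ord0)%:R * (- q.1)); last first.
  by apply/funext => q /=; rewrite tnth_mktuple.
apply: measurable_funD.
  exact: (measurableT_comp (measurable_tnth i) measurable_snd).
apply: measurable_funM => //; apply: measurableT_comp => //; exact: measurable_fst.
Qed.

Lemma measurable_e1shiftNl (R : realType) n (z : n.+1.-tuple R) :
  measurable_fun setT (fun t : R => e1shift (- t) z).
Proof. exact: (measurableT_comp (@measurable_e1shiftN R n) (pair2_measurable z)). Qed.

(** * The oscillation estimate, for abstract expanding inverse branches *)

Section lasota_yorke.
Variables (R : realType) (n : nat).
Local Notation tup := (n.+1.-tuple R).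
Variable mu : {sigma_finite_measure set tup -> \bar R}.
Hypothesis hmu : is_lebesgue mu.
Variables (ell : R) (W J psi : tup -> R) (I : R -> tup -> tup) (A K : R).
Hypotheses (ell0 : 0 < ell) (mW : measurable_fun setT W)
  (mI : measurable_fun setT (fun q : R * tup => I q.1 q.2))
  (WI : forall p x, W (I p x) = tnth x ord_max + p)
  (eball_I : forall p x z (e : R), eball x e z -> eball (I p x) (e / 9) (I p z))
  (I_cov : forall p (Q : tup -> \bar R), measurable_fun setT Q -> (forall y, 0 <= Q y)%E ->
     (\int[mu]_x Q (I p x) = \int[mu]_y (Q y * (J y)%:E))%E)
  (mJ : measurable_fun setT J) (mJV : measurable_fun setT (fun y => (J y)^-1)) (J0 : forall y, 0 < J y)
  (mpsi : measurable_fun setT psi) (psi0 : forall y, 0 < psi y)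
  (Jpsi : forall y, J y * psi y <= 1) (A0 : 0 <= A)
  (psi_lip : forall y z (e : R), 0 < e -> eball y e z -> J y * `|psi z - psi y| <= A * e)
  (W9 : forall y (s t : R), s <= t -> 9 * (t - s) <= `|W (e1shift t y) - W (e1shift s y)|)
  (K0 : 0 < K)
  (WK : forall y (s t : R), `|W (e1shift t y) - W (e1shift s y)| <= K * `|t - s|).

Variables (f : tup -> R) (G : set tup).
Hypotheses (mf : measurable_fun setT f) (gG : goodset mu f G).

(** In the application [W] is [gam ^+ n * Ft], [I p] is the inverse branch with offset
    [c = p / gam ^+ n], and [ell] is [gam ^+ n * L]. *)
Definition fpsi p (x : tup) : R := f (I p x) * psi (I p x).

(** The contribution of one branch to the transfer operator. Only the last coordinate is cut off: in
    the application [f] vanishes off [Omega0], which already confines the other coordinates of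
    [x]. *)
Definition piece p (x : tup) : R := if `|tnth x ord_max| < ell then fpsi p x else 0.

Section fixed_radius.
Variables (e : R).
Hypotheses (e0 : 0 < e) (e_ell : e < ell).
Local Notation Osc := (fun y => osc mu f (eball y (e / 9))).
Local Notation Sup := (supball G f (e / 9)).
Local Open Scope ereal_scope.

Let e9 : (0 < e / 9)%R. Proof. by rewrite divr_gt0. Qed.

(* The two cases are the interior and the collar of the cut-off [|x_last| < ell],
   since [W (I p x) - p] is the last coordinate of [x]. *)
Definition bnd p (y : tup) : \bar R :=
  if (`|W y - p| <= ell - e)%R then (1 + A * e)%:E * Osc y + (A * e)%:E * Sup y
  else if (`|W y - p| < ell + e)%R then (2 * (1 + A * e))%:E * Sup y else 0.

Lemma bnd_ge0 p y : 0 <= bnd p y.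
Proof.
have o0 := osc_ge0 hmu y mf e9.
have s0 := supball_ge0 G f (e / 9) y.
have ae0 : (0 <= A * e)%R by rewrite mulr_ge0 ?(ltW e0).
rewrite /bnd; case: ifP => _; [|case: ifP => _//].
- by apply: adde_ge0; apply: mule_ge0; rewrite // lee_fin; lra.
- by apply: mule_ge0; rewrite // lee_fin; lra.
Qed.

Lemma psi_bound y z : eball y (e / 9) z -> (J y * psi z <= 1 + A * e)%R.
Proof.
move=> yz; have h := psi_lip e9 yz; have h1 := Jpsi y; have a0 := A0; have ee := e0.
have : (J y * psi z <= J y * psi y + J y * `|psi z - psi y|)%R.
  rewrite -mulrDr ler_pM2l//; have := ler_norm (psi z - psi y)%R; lra.
have : (A * (e / 9) <= A * e)%R by rewrite ler_wpM2l//; lra.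
lra.
Qed.

Lemma psi_diff_bound y z w : eball y (e / 9) z -> eball y (e / 9) w ->
  (J y * `|psi z - psi w| <= A * e)%R.
Proof.
move=> yz yw; have h := psi_lip e9 yz; have h' := psi_lip e9 yw.
have a0 := A0; have ee := e0.
have : (J y * `|psi z - psi w| <= J y * `|psi z - psi y| + J y * `|psi w - psi y|)%R.
  rewrite -mulrDr ler_pM2l//; have -> : (psi z - psi w = (psi z - psi y) - (psi w - psi y))%R by ring.
  exact: ler_normB.
have : (A * (e / 9) + A * (e / 9) <= A * e)%R by rewrite -mulrDr ler_wpM2l//; lra.
lra.
Qed.

Lemma fin_mul_le (a b : R) (M : \bar R) (c : R) : (0 < c)%R -> (c * a <= b)%R ->
  b%:E <= M -> a%:E <= M * (c^-1)%:E.
Proof.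
move=> c0 cab bM; apply: (@le_trans _ _ (b%:E * (c^-1)%:E)).
  by rewrite -EFinM lee_fin ler_pdivlMr// mulrC.
by rewrite lee_wpmul2r// lee_fin invr_ge0 ltW.
Qed.

(** In the interior both points survive the cut-off and the product rule applies; in the collar one
    of them may be cut off, so both values are estimated separately, whence the factor 2; further
    out both vanish. The factor [J^-1] is kept explicit because the change of variables will remove
    it. *)
Lemma piece_osc p x z w : G (I p z) -> G (I p w) -> eball x e z -> eball x e w ->
  (`|piece p z - piece p w|%R)%:E <= bnd p (I p x) * ((J (I p x))^-1)%:E.
Proof.
move=> Gz Gw xz xw; have ae0 : (0 <= A * e)%R by rewrite mulr_ge0 ?(ltW e0).
have yz := eball_I p xz; have yw := eball_I p xw.
have lz := eball_coord ord_max e0 xz; have lw := eball_coord ord_max e0 xw.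
have o0 := osc_ge0 hmu (I p x) mf e9.
have s0 := supball_ge0 G f (e / 9) (I p x).
rewrite /bnd WI addrK; set xl := tnth x ord_max in lz lw *.
have pz_le u : G (I p u) -> eball (I p x) (e / 9) (I p u) ->
    ((J (I p x) * `|piece p u|)%R)%:E <= (1 + A * e)%:E * Sup (I p x).
  move=> Gu yu; apply: (@le_trans _ _ (((1 + A * e) * `|f (I p u)|)%R%:E)); last first.
    by rewrite EFinM lee_wpmul2l ?supball_ge// lee_fin; lra.
  rewrite lee_fin /piece; case: ifP => _; last by rewrite normr0 mulr0 mulr_ge0//; lra.
  rewrite /fpsi normrM (gtr0_norm (psi0 _)) mulrCA mulrC ler_wpM2r//.
  exact: psi_bound.
case: ifP => [xin|/negbT xin].
- have zin : (`|tnth z ord_max| < ell)%R.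
    have -> : tnth z ord_max = (xl + (tnth z ord_max - xl))%R by ring.
    by apply: (le_lt_trans (ler_normD _ _)); lra.
  have win : (`|tnth w ord_max| < ell)%R.
    have -> : tnth w ord_max = (xl + (tnth w ord_max - xl))%R by ring.
    by apply: (le_lt_trans (ler_normD _ _)); lra.
  rewrite /piece zin win /fpsi.
  set z' := I p z; set w' := I p w; set y := I p x.
  apply: (@fin_mul_le _ ((1 + A * e) * `|f z' - f w'| + (A * e) * `|f w'|)%R _ (J y)) => //.
    have -> : (f z' * psi z' - f w' * psi w' = (f z' - f w') * psi z' + f w' * (psi z' - psi w'))%R by ring.
    apply: (@le_trans _ _ (J y * (`|f z' - f w'| * psi z' + `|f w'| * `|psi z' - psi w'|))%R).
      rewrite ler_pM2l//; apply: (le_trans (ler_normD _ _)).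
      by rewrite !normrM (gtr0_norm (psi0 z')).
    rewrite mulrDr; apply: lerD.
      by rewrite mulrCA mulrC ler_wpM2r//; exact: psi_bound.
    by rewrite mulrCA mulrC ler_wpM2r//; exact: psi_diff_bound.
  rewrite EFinD !EFinM; apply: leeD; apply: lee_wpmul2l.
  - by rewrite lee_fin; lra.
  - exact: (osc_ge mf gG e9).
  - by rewrite lee_fin.
  - exact: supball_ge.
- case: ifP => [xbd|/negbT xout].
    apply: (@fin_mul_le _ (J (I p x) * `|piece p z| + J (I p x) * `|piece p w|)%R _ (J (I p x))) => //.
      by rewrite -mulrDr ler_pM2l// ler_normB.
    have -> : (2 * (1 + A * e))%:E * Sup (I p x) =
        (1 + A * e)%:E * Sup (I p x) + (1 + A * e)%:E * Sup (I p x).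
      have ae1 : (0 <= 1 + A * e)%R by lra.
      by rewrite -ge0_muleDl ?lee_fin// -EFinD mulrDl mul1r.
    by rewrite EFinD; apply: leeD; exact: pz_le.
  have out u : (`|tnth u ord_max - xl| < e)%R -> (`|tnth u ord_max| < ell)%R = false.
    move=> lu; apply/negbTE; rewrite -leNgt; rewrite -leNgt in xout.
    have : (`|xl| <= `|tnth u ord_max| + `|tnth u ord_max - xl|)%R.
      by rewrite -[X in (`|X| <= _)%R](subKr (tnth u ord_max)) ler_normB.
    by lra.
  by rewrite /piece !out// subrr normr0 mul0e.
Qed.

Lemma measurable_bnd : measurable_fun setT (fun q : R * tup => bnd q.1 q.2).
Proof.
have mw : measurable_fun setT (fun q : R * tup => `|W q.2 - q.1|%R).
  apply: measurableT_comp => //; apply: measurable_funB => //.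
  exact: (measurableT_comp mW measurable_snd).
have mO : measurable_fun setT (fun q : R * tup => Osc q.2).
  have := @measurableT_comp _ _ _ _ _ _ (fun y : tup => Osc y) setT
    (snd : R * tup -> tup) (measurable_osc mu mf e9).
  by apply; exact: measurable_snd.
have mS : measurable_fun setT (fun q : R * tup => Sup q.2).
  exact: (measurableT_comp (measurable_supball G f e9) measurable_snd).
apply: measurable_fun_ifT.
- by apply: measurable_fun_ler.
- by apply: emeasurable_funD; exact: measurable_funeM.
- apply: measurable_fun_ifT => //.
  + by apply: measurable_fun_ltr.
  + exact: measurable_funeM.
Qed.

(** * The boundary term, by averaging along segments *)

Section fixed_shift.
Variables (N : nat) (p0 rho : R).
Hypotheses (rho0 : (0 < rho)%R) (rho_small : (e + K * rho <= ell)%R).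
(** Consecutive values of [j] change the offset [c] by [2 * L], hence [p] by [2 * ell]. *)
Definition sh (i : nat) : R := (p0 + 2 * ell * i%:R)%R.
Local Notation near q y := (`|W y - q| < e)%R.

(** The choices [d = ell] and [d = - ell] count the preimages of the upper and of the lower face
    that pass near [y]. *)
Definition hits (d : R) (y : tup) : R := (\sum_(i < N) (near (sh i + d) y)%:R)%R.

Lemma hits_ge0 d y : (0 <= hits d y)%R.
Proof. by apply: sumr_ge0. Qed.

Lemma measurable_near q : measurable_fun setT (fun y => (near q y)%:R : R).
Proof.
have -> : (fun y => (near q y)%:R : R) = \1_(W @^-1` `](q - e)%R, (q + e)%R[%classic).
  apply/funext => y; rewrite indicE (_ : (y \in _) = near q y)//.
  by apply/idP/idP; rewrite inE /= in_itv/= ltr_distl.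
apply: measurable_indic; rewrite -[X in measurable X]setTI; exact: mW.
Qed.

Lemma measurable_hits d : measurable_fun setT (hits d).
Proof. by apply: measurable_sum => i; exact: measurable_near. Qed.

Lemma sh_dist i j : i != j -> (2 * ell <= `|sh i - sh j|)%R.
Proof.
move=> ij; have l0 := ell0.
have -> : (sh i - sh j = 2 * ell * (i%:R - j%:R))%R by rewrite /sh; ring.
rewrite normrM ger0_norm; last by lra.
rewrite -[leLHS]mulr1 ler_pM2l; last by lra.
have [h|h|/eqP] := ltngtP i j; last by rewrite (negbTE ij).
  have : (i.+1%:R <= j%:R :> R)%R by rewrite ler_nat.
  by rewrite -natr1 distrC => h1; rewrite ger0_norm; lra.
have : (j.+1%:R <= i%:R :> R)%R by rewrite ler_nat.
by rewrite -natr1 => h1; rewrite ger0_norm; lra.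
Qed.

(** The interior strips of different branches are disjoint, so the interior term is paid once,
    independently of [N]; a collar is always near one of the two faces of its branch. *)
Lemma sum_bnd_le y : \sum_(i < N) bnd (sh i) y <=
  (1 + A * e)%:E * Osc y + (A * e)%:E * Sup y +
  (2 * (1 + A * e))%:E * (Sup y * (hits ell y + hits (- ell) y)%:E).
Proof.
have o0 := osc_ge0 hmu y mf e9.
have s0 := supball_ge0 G f (e / 9) y.
have ae0 : (0 <= A * e)%R by rewrite mulr_ge0 ?(ltW e0).
have ee := e0; have l0 := ell0.
set X := _ + _ * Sup y.
have X0 : 0 <= X.
  by apply: adde_ge0; apply: mule_ge0; rewrite // lee_fin; lra.
set c2 := (2 * (1 + A * e))%:E.
have c20 : 0 <= c2 by rewrite lee_fin; lra.
pose inn i := (`|W y - sh i| <= ell - e)%R.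
apply: (@le_trans _ _ (\sum_(i < N) ((if inn i then X else 0) +
   c2 * (Sup y * (((near (sh i + ell) y)%:R + (near (sh i - ell) y)%:R)%R)%:E)))).
  apply: lee_sum => i _; rewrite /bnd -/(inn i); case: ifP => hi.
    by rewrite leeDl// !mule_ge0// lee_fin addr_ge0.
  rewrite add0e; case: ifP => hb; last by rewrite !mule_ge0// lee_fin addr_ge0.
  rewrite lee_wpmul2l// -[leLHS]mule1 lee_wpmul2l// lee_fin.
  have [W0|W0] := leP 0%R (W y - sh i)%R.
    rewrite ger0_norm// in hb; have hi' : (ell - e < W y - sh i)%R.
      by move/negbT: hi; rewrite /inn ger0_norm// -ltNge.
    have -> : near (sh i + ell) y by rewrite ltr_norml; apply/andP; split; lra.
    by rewrite lerDl.
  rewrite ltr0_norm// in hb; have hi' : (ell - e < - (W y - sh i))%R.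
    by move/negbT: hi; rewrite /inn ltr0_norm// -ltNge.
  have -> : near (sh i - ell) y by rewrite ltr_norml; apply/andP; split; lra.
  by rewrite lerDr.
rewrite big_split /=; apply: leeD.
  apply: sume_at_most_one => // [i|i j ij]; first by case: ifP => _; rewrite ?lexx ?X0.
  case: (boolP (inn i)) => hi; last by left.
  case: (boolP (inn j)) => hj; last by right.
  exfalso; have := sh_dist ij.
  have -> : (sh i - sh j = (W y - sh j) - (W y - sh i))%R by ring.
  have := ler_normB (W y - sh j)%R (W y - sh i)%R; move: hi hj; rewrite /inn; lra.
rewrite -ge0_sume_distrr; last by move=> i _; rewrite mule_ge0// lee_fin addr_ge0.
rewrite lee_wpmul2l// -ge0_sume_distrr; last by move=> i _; rewrite lee_fin addr_ge0.
by rewrite lee_wpmul2l// sumEFin lee_fin /hits -big_split.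
Qed.

Lemma e1shiftK t (y : tup) : e1shift (- t) (e1shift t y) = y.
Proof. by apply/eq_from_tnth => i; rewrite !tnth_mktuple; ring. Qed.

(** [W] is expanded by at least 9 along the segment, so the parameters at which it is within [e] of
    a given level have diameter at most [2 e / 9]. Meeting two levels would force a change of more
    than [2 * ell - 2 * e] over a length below [2 * rho], excluded by [rho_small]; hence the bound
    does not grow with [N]. *)
Lemma integral_hits d z :
  \int[lebesgue_measure]_(t in `](- rho)%R, rho[%classic) (hits d (e1shift (- t) z))%:E <=
  (2 * e / 9)%:E.
Proof.
have ee := e0; have l0 := ell0; have r0 := rho0; have k0 := K0; have rs := rho_small.
have msh : measurable_fun setT (fun t : R => e1shift (- t) z).
  exact: measurable_e1shiftNl.
have mt i : measurable_fun setT (fun t : R => (near (sh i + d) (e1shift (- t) z))%:R : R).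
  exact: (measurableT_comp (measurable_near (sh i + d)) msh).
under eq_integral => t _ do rewrite /hits -sumEFin.
rewrite ge0_integral_sum//; last first.
  by move=> i; apply/measurable_EFinP; apply: measurable_funTS; exact: mt.
pose B i : set R := `](- rho)%R, rho[%classic `&` [set t | near (sh i + d) (e1shift (- t) z)].
have mB i : measurable (B i).
  apply: measurableI => //.
  have -> : [set t : R | near (sh i + d) (e1shift (- t) z)] =
     (fun t : R => W (e1shift (- t) z)) @^-1` `](sh i + d - e)%R, (sh i + d + e)%R[%classic.
    by apply/seteqP; split => t; rewrite /= in_itv/= ltr_distl.
  rewrite -[X in measurable X]setTI; exact: (measurableT_comp mW msh).
have IB i : \int[lebesgue_measure]_(t in `](- rho)%R, rho[%classic)
     ((near (sh i + d) (e1shift (- t) z))%:R)%:E = lebesgue_measure (B i).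
  rewrite -[B i]setIT -(@integral_indic _ _ _ lebesgue_measure setT measurableT (B i) (mB i)) [LHS]integral_mkcond; apply: eq_integral => t _.
  rewrite patchE indicE /B in_setI; case: ifP => //= _.
  rewrite (_ : (t \in _) = near (sh i + d) (e1shift (- t) z))//.
  by apply/idP/idP; rewrite inE.
under eq_bigr do rewrite IB.
have WW s t : (s <= t)%R -> (9 * (t - s) <= `|W (e1shift (- s) z) - W (e1shift (- t) z)|)%R.
  by move=> st; have := @W9 z (- t)%R (- s)%R; rewrite lerN2 => /(_ st); rewrite opprK addrC.
apply: sume_at_most_one => [|i|i j ij].
- by rewrite lee_fin; lra.
- rewrite measure_ge0 /=; apply: lebesgue_measure_diam => //; first by lra.
  move=> s t [_ hs] [_ ht].
  have [st|ts] := leP s t; first by lra.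
  have := WW _ _ (ltW ts); move: hs ht => /=.
  set a := W _; set b := W _; set q := (_ + d)%R => hs ht.
  have -> : (b - a = (b - q) - (a - q))%R by ring.
  by have := ler_normB (b - q)%R (a - q)%R; lra.
- have [Bi|/set0P[s [+ hs]]] := eqVneq (B i) set0; first by left; rewrite Bi measure0.
  have [Bj|/set0P[t [+ ht]]] := eqVneq (B j) set0; first by right; rewrite Bj measure0.
  rewrite /= !in_itv/= => /andP[t1 t2] /andP[s1 s2]; exfalso.
  have := sh_dist ij; have := @WK z (- s)%R (- t)%R.
  move: hs ht => /=; set a := W _; set b := W _ => hs ht.
  have : (`|- t - - s| < 2 * rho)%R by rewrite ltr_norml; apply/andP; split; lra.
  have -> : (sh i - sh j = (b - (sh j + d)) - (a - (sh i + d)) - (b - a))%R by ring.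
  have := ler_normB ((b - (sh j + d)) - (a - (sh i + d)))%R (b - a)%R.
  have := ler_normB (b - (sh j + d))%R (a - (sh i + d))%R.
  by nra.
Qed.

Local Notation r' := (rho + e / 9)%R.
(* Bounds [Sup] at every point within [rho] of [z] along the first axis; the value
   [+oo] off [G] only affects a null set. *)
Definition needle (z : tup) : \bar R :=
  if `[< G z >] then (`|f z|%R)%:E + osc mu f (eball z r') else +oo.

Let r'0 : (0 < r')%R. Proof. by rewrite addr_gt0. Qed.

Lemma needle_ge0 z : 0 <= needle z.
Proof.
rewrite /needle; case: ifP => _ //; apply: adde_ge0; first by rewrite lee_fin.
exact: (osc_ge0 hmu z mf r'0).
Qed.

Lemma measurable_needle : measurable_fun setT needle.
Proof.
have [mG _ _] := gG.
apply: measurable_fun_ifT => //.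
- apply: (measurable_fun_bool true).
  rewrite setTI (_ : _ @^-1` _ = G)//.
  by apply/seteqP; split => z /= => [/asboolP//|Gz]; exact/asboolP.
- apply: emeasurable_funD.
    by apply/measurable_EFinP; exact: measurableT_comp.
  exact: (measurable_osc mu mf r'0).
Qed.

Lemma integral_needle : \int[mu]_z needle z =
  \int[mu]_z (`|f z|%R)%:E + \int[mu]_z osc mu f (eball z r').
Proof.
have [mG G0 _] := gG.
have mo := measurable_osc mu mf r'0.
have mabs : measurable_fun setT (fun z => (`|f z|%R)%:E).
  by apply/measurable_EFinP; exact: measurableT_comp.
rewrite -ge0_integralD//; last first.
  by move=> z _; exact: (osc_ge0 hmu z mf r'0).
apply: ge0_ae_eq_integral => //.
- exact: measurable_needle.
- exact: emeasurable_funD.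
- by move=> z _; exact: needle_ge0.
- by move=> z _; apply: adde_ge0; [rewrite lee_fin|exact: (osc_ge0 hmu z mf r'0)].
- exists (~` G); split => //; first exact: measurableC.
  by move=> z /= h Gz; apply: h => _; rewrite /needle; case: asboolP.
Qed.

Lemma Sup_le_needle y t : (- rho < t < rho)%R -> Sup y <= needle (e1shift t y).
Proof.
move=> tr; rewrite /needle; case: asboolP => Gw; last exact: leey.
set w := e1shift t y in Gw *.
have wy : eball w rho y by apply: eball_sym; apply: eball_e1shift; rewrite ltr_norml.
have o0 := osc_ge0 hmu w mf r'0.
apply: supball_le; first by apply: adde_ge0 => //; rewrite lee_fin.
move=> z Gz yz; have wz := eball_triangle rho0 e9 wy yz.
have ww := eball_center w r'0.
have h := osc_ge mf gG r'0 Gz Gw wz ww.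
apply: (@le_trans _ _ ((`|f w|%R)%:E + (`|f z - f w|%R)%:E)); last by rewrite leeD2l.
rewrite -EFinD lee_fin; have -> : f z = (f w + (f z - f w))%R by ring.
apply: (le_trans (ler_normD _ _)); by rewrite addrAC subrr add0r.
Qed.

Local Notation hits2 y := (hits ell y + hits (- ell) y)%R.

(** [Sup y] is bounded by [needle] at every translate of [y] along the segment. After averaging over
    the translates, translation invariance of [mu] moves the shift from [needle] to the counting
    function, whose integral over the segment is small whatever the base point. *)
Lemma integral_Sup_hits :
  (2 * rho)%:E * \int[mu]_y (Sup y * (hits2 y)%:E) <=
  (4 * e / 9)%:E * \int[mu]_z needle z.
Proof.
have r0 := rho0; have ee := e0.
have mS := measurable_supball G f e9.
have mh : measurable_fun setT (fun y => hits2 y).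
  by apply: measurable_funD; exact: measurable_hits.
have h0 y : (0 <= hits2 y)%R by rewrite addr_ge0// hits_ge0.
have S0 y : 0 <= Sup y by exact: supball_ge0.
have mSh : measurable_fun setT (fun y => Sup y * (hits2 y)%:E).
  by apply: emeasurable_funM => //; exact/measurable_EFinP.
pose E : set R := `](- rho)%R, rho[%classic.
have mE : measurable E by exact: measurable_itv.
pose F1 (q : R * tup) := (\1_E q.1)%:E * (needle (e1shift q.1 q.2) * (hits2 q.2)%:E).
pose F2 (q : R * tup) := (\1_E q.1)%:E * (needle q.2 * (hits2 (e1shift (- q.1) q.2))%:E).
have mE1 : measurable_fun setT (fun q : R * tup => (\1_E q.1)%:E : \bar R).
  apply/measurable_EFinP; apply: (measurableT_comp (measurable_indic mE)).
  exact: measurable_fst.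
have mF1 : measurable_fun setT F1.
  apply: emeasurable_funM => //; apply: emeasurable_funM.
    exact: (measurableT_comp measurable_needle (@measurable_e1shift R n)).
  by apply/measurable_EFinP; exact: (measurableT_comp mh measurable_snd).
have mF2 : measurable_fun setT F2.
  apply: emeasurable_funM => //; apply: emeasurable_funM.
    exact: (measurableT_comp measurable_needle measurable_snd).
  apply/measurable_EFinP; apply: (measurableT_comp mh).
  exact: measurable_e1shiftN.
have F10 q : 0 <= F1 q by rewrite !mule_ge0 ?lee_fin// needle_ge0.
have F20 q : 0 <= F2 q by rewrite !mule_ge0 ?lee_fin// needle_ge0.
rewrite -ge0_integralZl//; last 2 first.
- by move=> y _; rewrite mule_ge0// lee_fin.
- by rewrite lee_fin; lra.
apply: (@le_trans _ _ (\int[mu]_y \int[lebesgue_measure]_t F1 (t, y))).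
  apply: ge0_le_integral => //.
  - by move=> y _; rewrite !mule_ge0// lee_fin//; lra.
  - exact: measurable_funeM.
  - exact: (measurable_fun_fubini_tonelli_G (m1 := lebesgue_measure) _ mF1 F10).
  move=> y _.
  have -> : (2 * rho)%:E * (Sup y * (hits2 y)%:E) =
     \int[lebesgue_measure]_(t in E) (cst (Sup y * (hits2 y)%:E) t).
    rewrite integral_cst//= /E lebesgue_measure_itv/= lte_fin ifT; last by lra.
    by rewrite muleC -EFinD opprK mulr_natl mulr2n.
  rewrite integral_mkcond; apply: ge0_le_integral => //.
  - by move=> t _; rewrite patchE; case: ifP => // _; rewrite mule_ge0// lee_fin.
  - by apply/(measurable_restrictT _ _).1 => //; exact: measurable_cst.
  - exact: (measurableT_comp mF1 (pair2_measurable y)).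
  move=> t _; rewrite patchE /F1 /= indicE; case: ifPn => tE; last by rewrite mul0e.
  rewrite mul1e lee_wpmul2r ?lee_fin//; apply: Sup_le_needle.
  by move: tE; rewrite inE /E /= in_itv.
rewrite -(fubini_tonelli (m1 := lebesgue_measure) (m2 := mu) _ mF1 F10).
have -> : \int[lebesgue_measure]_t \int[mu]_y F1 (t, y) =
          \int[lebesgue_measure]_t \int[mu]_y F2 (t, y).
  apply: eq_integral => t _.
  have mq : measurable_fun setT (fun z => F2 (t, z)).
    exact: (measurableT_comp mF2 (pair1_measurable t)).
  rewrite -(ge0_integral_e1shift hmu t mq)//.
  by apply: eq_integral => y _; rewrite /F1 /F2 /= e1shiftK.
rewrite (fubini_tonelli (m1 := lebesgue_measure) (m2 := mu) _ mF2 F20).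
rewrite -ge0_integralZl//; last 3 first.
- exact: measurable_needle.
- by move=> y _; exact: needle_ge0.
- by rewrite lee_fin; lra.
apply: ge0_le_integral => //.
- by move=> z _; exact: integral_ge0.
- exact: (measurable_fun_fubini_tonelli_G (m1 := lebesgue_measure) _ mF2 F20).
- by apply: measurable_funeM; exact: measurable_needle.
move=> z _.
have msh : measurable_fun setT (fun t : R => e1shift (- t) z).
  exact: measurable_e1shiftNl.
have mht d : measurable_fun setT (fun t : R => (hits d (e1shift (- t) z))%:E).
  by apply/measurable_EFinP; exact: (measurableT_comp (measurable_hits d) msh).
have -> : \int[lebesgue_measure]_t F2 (t, z) =
   needle z * \int[lebesgue_measure]_(t in E) (hits2 (e1shift (- t) z))%:E.
  rewrite -ge0_integralZl//; last 3 first.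
  - by apply/measurable_funTS/measurable_EFinP; exact: (measurableT_comp mh msh).
  - by move=> t _; rewrite lee_fin.
  - exact: needle_ge0.
  rewrite [RHS]integral_mkcond; apply: eq_integral => t _.
  by rewrite patchE /F2 /= indicE; case: ifP => _; rewrite ?mul1e ?mul0e.
rewrite muleC lee_wpmul2r ?needle_ge0//.
under eq_integral do rewrite EFinD.
rewrite ge0_integralD//; last 4 first.
- by move=> t _; rewrite lee_fin hits_ge0.
- by apply: measurable_funTS; exact: mht.
- by move=> t _; rewrite lee_fin hits_ge0.
- by apply: measurable_funTS; exact: mht.
have -> : (4 * e / 9)%:E = (2 * e / 9)%:E + (2 * e / 9)%:E by rewrite -EFinD; congr EFin; field.
by apply: leeD; exact: integral_hits.
Qed.

(** The first line is the interior term, after bounding [Sup] by [|f|] plus [Osc], which doubles the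
    coefficient [A * e]. The second is the collar term, [2 * (1 + A * e)] times the ratio of
    [4 * e / 9] to [2 * rho]. *)
Definition lybound : \bar R :=
  (1 + 2 * (A * e))%:E * \int[mu]_y Osc y + (A * e)%:E * \int[mu]_y (`|f y|%R)%:E +
  (4 * (1 + A * e) * (e / 9) / rho)%:E *
    (\int[mu]_y (`|f y|%R)%:E + \int[mu]_y osc mu f (eball y r')).

Lemma integral_bnd_le :
  \int[mu]_x (\sum_(i < N) (bnd (sh i) (I (sh i) x) * ((J (I (sh i) x))^-1)%:E)) <= lybound.
Proof.
have r0 := rho0; have ee := e0.
have [mG G0 _] := gG.
have ae0 : (0 <= A * e)%R by rewrite mulr_ge0 ?(ltW e0).
have mO : measurable_fun setT (fun y : tup => Osc y) by exact: (measurable_osc mu mf e9).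
have mS := measurable_supball G f e9.
have mabs : measurable_fun setT (fun z => (`|f z|%R)%:E).
  by apply/measurable_EFinP; exact: measurableT_comp.
have O0 y : 0 <= Osc y by exact: (osc_ge0 hmu y mf e9).
have S0 y : 0 <= Sup y by exact: supball_ge0.
have mb p : measurable_fun setT (bnd p).
  exact: (measurableT_comp measurable_bnd (pair1_measurable p)).
have mIp p : measurable_fun setT (I p) by exact: (measurableT_comp mI (pair1_measurable p)).
have mJi : measurable_fun setT (fun y => ((J y)^-1)%:E).
  exact/measurable_EFinP.
have mq p : measurable_fun setT (fun y => bnd p y * ((J y)^-1)%:E).
  exact: emeasurable_funM.
have q0 p y : 0 <= bnd p y * ((J y)^-1)%:E.
  by rewrite mule_ge0 ?bnd_ge0// lee_fin invr_ge0 ltW.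
rewrite ge0_integral_sum//; last first.
  by move=> i; exact: (measurableT_comp (mq (sh i)) (mIp (sh i))).
(* The factor [J^-1] cancels the Jacobian, so that all branches can be summed under one integral in
   [y]. *)
rewrite (eq_bigr (fun i : 'I_N => \int[mu]_y bnd (sh i) y)); last first.
  move=> i _; rewrite (I_cov (sh i) (mq (sh i)) (q0 (sh i))).
  apply: eq_integral => y _; rewrite -muleA -EFinM mulVf ?mule1// gt_eqF//.
rewrite -ge0_integral_sum//; last first.
  by move=> i y _; exact: bnd_ge0.
have h0 y : (0 <= hits2 y)%R by rewrite addr_ge0// hits_ge0.
have mh : measurable_fun setT (fun y => hits2 y).
  by apply: measurable_funD; exact: measurable_hits.
have mSh : measurable_fun setT (fun y => Sup y * (hits2 y)%:E).
  by apply: emeasurable_funM => //; exact/measurable_EFinP.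
have Sh0 y : 0 <= Sup y * (hits2 y)%:E by rewrite mule_ge0// lee_fin.
have a1 : 0 <= (1 + A * e)%:E by rewrite lee_fin; lra.
have a2 : 0 <= (A * e)%:E by rewrite lee_fin.
have a3 : 0 <= (2 * (1 + A * e))%:E by rewrite lee_fin; lra.
apply: (@le_trans _ _ (\int[mu]_y ((1 + A * e)%:E * Osc y + (A * e)%:E * Sup y +
  (2 * (1 + A * e))%:E * (Sup y * (hits2 y)%:E)))).
  apply: ge0_le_integral => //.
  - by move=> y _; apply: sume_ge0 => i _; exact: bnd_ge0.
  - exact: emeasurable_sum.
  - apply: emeasurable_funD; last exact: measurable_funeM.
    by apply: emeasurable_funD; exact: measurable_funeM.
  - by move=> y _; exact: sum_bnd_le.
rewrite ge0_integralD//; last 4 first.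
- by move=> y _; apply: adde_ge0; exact: mule_ge0.
- by apply: emeasurable_funD; exact: measurable_funeM.
- by move=> y _; exact: mule_ge0.
- exact: measurable_funeM.
rewrite ge0_integralD//; last 4 first.
- by move=> y _; exact: mule_ge0.
- exact: measurable_funeM.
- by move=> y _; exact: mule_ge0.
- exact: measurable_funeM.
rewrite !ge0_integralZl//.
rewrite /lybound; apply: leeD; last first.
  have := integral_Sup_hits; rewrite integral_needle.
  set X := \int[mu]_y _; set Y := _ + _ => XY.
  have -> : (2 * (1 + A * e))%:E * X = ((1 + A * e) / rho)%:E * ((2 * rho)%:E * X).
    rewrite muleA -EFinM; congr (_%:E * _).
    by field; rewrite gt_eqF.
  have -> : (4 * (1 + A * e) * (e / 9) / rho)%:E * Y = ((1 + A * e) / rho)%:E * ((4 * e / 9)%:E * Y).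
    rewrite muleA -EFinM; congr (_%:E * _).
    by field; rewrite gt_eqF.
  by rewrite lee_wpmul2l// lee_fin divr_ge0//; lra.
have SI : \int[mu]_y Sup y <= \int[mu]_y (`|f y|%R)%:E + \int[mu]_y Osc y.
  rewrite -ge0_integralD//; apply: ae_ge0_le_integral => //.
  - by move=> y _; apply: adde_ge0 => //; rewrite lee_fin.
  - exact: emeasurable_funD.
  exists (~` G); split => //; first exact: measurableC.
  move=> y /= h Gy; apply: h => _.
  have yy := eball_center y e9.
  apply: supball_le; first by apply: adde_ge0 => //; rewrite lee_fin.
  move=> z Gz yz; have h := osc_ge mf gG e9 Gz Gy yz yy.
  apply: (@le_trans _ _ ((`|f y|%R)%:E + (`|f z - f y|%R)%:E)); last by rewrite leeD2l.
  rewrite -EFinD lee_fin; have -> : f z = (f y + (f z - f y))%R by ring.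
  by apply: (le_trans (ler_normD _ _)); rewrite addrAC subrr add0r.
apply: (@le_trans _ _ ((1 + A * e)%:E * \int[mu]_y Osc y +
   (A * e)%:E * (\int[mu]_y (`|f y|%R)%:E + \int[mu]_y Osc y))).
  by rewrite leeD2l// lee_wpmul2l.
have IO : 0 <= \int[mu]_y Osc y by exact: integral_ge0.
have If : 0 <= \int[mu]_y (`|f y|%R)%:E by apply: integral_ge0 => y _; rewrite lee_fin.
move: IO If; move: (\int[mu]_y Osc y) => P; move: (\int[mu]_y (`|f y|%R)%:E) => Q P0 Q0.
have -> : (A * e)%:E * (Q + P) = (A * e)%:E * Q + (A * e)%:E * P by rewrite ge0_muleDr.
have -> : (1 + 2 * (A * e))%:E * P = (1 + A * e)%:E * P + (A * e)%:E * P.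
  by rewrite -ge0_muleDl// -EFinD; congr (_%:E * _); ring.
by rewrite -addeA [X in _ <= _ + X]addeC.
Qed.

End fixed_shift.

End fixed_radius.
Lemma integral_I p (Q : tup -> R) : measurable_fun setT Q ->
  (\int[mu]_x (Q (I p x))%:E = \int[mu]_y (Q y * J y)%:E)%E.
Proof.
move=> mQ; have mQE : measurable_fun setT (EFin \o Q) by exact/measurable_EFinP.
rewrite [LHS]integralE [RHS]integralE.
rewrite [X in (X - _ = _)%E](_ : _ = \int[mu]_x (EFin \o Q)^\+ (I p x))%E; last first.
  by apply: eq_integral => x _; rewrite !funeposE.
rewrite [X in (_ - X = _)%E](_ : _ = \int[mu]_x (EFin \o Q)^\- (I p x))%E; last first.
  by apply: eq_integral => x _; rewrite !funenegE.
rewrite (I_cov p (measurable_funepos mQE))// (I_cov p (measurable_funeneg mQE))//.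
congr (_ - _)%E; apply: eq_integral => y _; rewrite ?funeposE ?funenegE /=.
  by rewrite muleC maxe_pMr ?lee_fin ?(ltW (J0 y))// mule0 -EFinM mulrC.
by rewrite muleC maxe_pMr ?lee_fin ?(ltW (J0 y))// mule0 -EFinM mulrN mulrC.
Qed.

Lemma measurable_piece : measurable_fun setT (fun q : R * tup => piece q.1 q.2).
Proof.
apply: measurable_fun_ifT => //.
- apply: measurable_fun_ltr => //; apply: measurableT_comp => //.
  exact: (measurableT_comp (measurable_tnth ord_max) measurable_snd).
- by apply: measurable_funM; apply: measurableT_comp.
Qed.

(** The inverse branch [I 0] carries a hyperplane onto the level set, and the change of variables
    with weight [J^-1] preserves null sets. *)
Lemma level_set_null p : mu [set y | W y = p] = 0%E.
Proof.
have mS : measurable [set y | W y = p].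
  have -> : [set y | W y = p] = setT `&` W @^-1` [set p] by rewrite setTI.
  exact: mW.
pose Q y : \bar R := (\1_[set y | W y = p] y * (J y)^-1)%:E.
have mQ : measurable_fun setT Q.
  by apply/measurable_EFinP; apply: measurable_funM.
have Q0 y : (0 <= Q y)%E by rewrite lee_fin mulr_ge0// invr_ge0 ltW.
have := @integral_indic _ _ _ mu setT measurableT _ mS; rewrite setIT => <-.
transitivity (\int[mu]_y (Q y * (J y)%:E))%E.
  by apply: eq_integral => y _; rewrite /Q -EFinM mulfVK// gt_eqF.
rewrite -(I_cov 0 mQ Q0); rewrite -[RHS](@null_set_integral _ _ _ mu [set x | tnth x ord_max = p]
  (fun x => Q (I 0 x))).
- rewrite [RHS]integral_mkcond; apply: eq_integral => x _.
  rewrite patchE; case: ifPn => //; rewrite notin_setE /= => xp.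
  rewrite /Q indicE memNset ?mul0r//= WI addr0; exact: xp.
- exact: measurable_hyperplane.
- apply: measurable_funTS; apply: (measurableT_comp mQ).
  exact: (measurableT_comp mI (pair1_measurable (0 : R))).
- exact: hyperplane_null.
Qed.

(** * The sum over branches and its average over the shift *)

Section random_shift.
Variables (N : nat) (q0 H : R -> R).
Hypotheses (mq0 : measurable_fun setT q0) (hH : prob_density H)
  (f_int : mu.-integrable setT (EFin \o f)).
Local Open Scope ereal_scope.

Definition transfer th x : R := (\sum_(i < N) piece (sh (q0 th) i) x)%R.

Let msh i : measurable_fun setT (fun q : R * tup => (sh (q0 q.1) i, q.2)).
Proof.
apply/measurable_fun_pairP; split => /=; last exact: measurable_snd.
apply: measurable_funD => //; exact: (measurableT_comp mq0 measurable_fst).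
Qed.

Lemma measurable_transfer : measurable_fun setT (fun q : R * tup => transfer q.1 q.2).
Proof.
by apply: measurable_sum => i; exact: (measurableT_comp measurable_piece (msh i)).
Qed.

Local Notation dom p y := (`|W y - p| < ell)%R.

Lemma measurable_dom p : measurable_fun setT (fun y => (dom p y)%:R : R).
Proof.
have -> : (fun y => (dom p y)%:R : R) = \1_(W @^-1` `](p - ell)%R, (p + ell)%R[%classic).
  apply/funext => y; rewrite indicE (_ : (y \in _) = dom p y)//.
  by apply/idP/idP; rewrite inE /= in_itv/= ltr_distl.
apply: measurable_indic; rewrite -[X in measurable X]setTI; exact: mW.
Qed.

Lemma sum_dom_le1 p0 y : (\sum_(i < N) (dom (sh p0 i) y)%:R <= 1 :> R)%R.
Proof.
rewrite -lee_fin -sumEFin; apply: sume_at_most_one => // [i|i j ij].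
  by rewrite !lee_fin ler0n/= lern1 leq_b1.
have l0 := ell0.
case: (boolP (dom (sh p0 i) y)) => hi; last by left.
case: (boolP (dom (sh p0 j) y)) => hj; last by right.
exfalso; have := @sh_dist p0 i j ij.
have -> : (sh p0 i - sh p0 j = (W y - sh p0 j) - (W y - sh p0 i))%R by ring.
by have := ler_normB (W y - sh p0 j)%R (W y - sh p0 i)%R; lra.
Qed.

Lemma integral_abs_piece p :
  \int[mu]_x (`|piece p x|%R)%:E <= \int[mu]_y (`|f y| * (dom p y)%:R)%:E.
Proof.
pose Q y : \bar R := (`|f y| * (dom p y)%:R * psi y)%:E.
have mQ : measurable_fun setT Q.
  apply/measurable_EFinP; apply: measurable_funM => //.
  apply: measurable_funM; [exact: measurableT_comp|exact: measurable_dom].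
have Q0 y : 0 <= Q y by rewrite lee_fin !mulr_ge0// ltW.
rewrite [leLHS](_ : _ = \int[mu]_x Q (I p x)); last first.
  apply: eq_integral => x _; rewrite /Q WI addrK /piece /fpsi.
  case: ifP => _; last by rewrite normr0 mulr0 mul0r.
  by rewrite normrM (gtr0_norm (psi0 _)) mulr1.
rewrite I_cov//; apply: ge0_le_integral => //.
- by move=> y _; rewrite mule_ge0// lee_fin ltW.
- by apply: emeasurable_funM => //; exact/measurable_EFinP.
- apply/measurable_EFinP; apply: measurable_funM; [exact: measurableT_comp|exact: measurable_dom].
- move=> y _; rewrite /Q -EFinM lee_fin -[X in (X <= _)%R]mulrA -[X in (_ <= X)%R]mulr1.
  by rewrite ler_wpM2l ?mulr_ge0// mulrC.
Qed.

Lemma transfer_L1 th : \int[mu]_x (`|transfer th x|%R)%:E <= \int[mu]_x (`|f x|%R)%:E.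
Proof.
have mpc p : measurable_fun setT (fun x => (`|piece p x|%R)%:E).
  apply/measurable_EFinP; apply: measurableT_comp => //.
  exact: (measurableT_comp measurable_piece (pair1_measurable p)).
have mfd p : measurable_fun setT (fun y => (`|f y| * (dom p y)%:R)%:E).
  apply/measurable_EFinP; apply: measurable_funM; [exact: measurableT_comp|exact: measurable_dom].
apply: (@le_trans _ _ (\int[mu]_x (\sum_(i < N) (`|piece (sh (q0 th) i) x|%R)%:E))).
  apply: ge0_le_integral => //.
  - apply/measurable_EFinP; apply: measurableT_comp => //.
    exact: (measurableT_comp measurable_transfer (pair1_measurable th)).
  - exact: emeasurable_sum.
  - by move=> x _; rewrite sumEFin lee_fin; exact: ler_norm_sum.
rewrite ge0_integral_sum//.
apply: (@le_trans _ _ (\sum_(i < N) \int[mu]_y (`|f y| * (dom (sh (q0 th) i) y)%:R)%:E)).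
  by apply: lee_sum => i _; exact: integral_abs_piece.
rewrite -ge0_integral_sum//.
apply: ge0_le_integral => //.
- by move=> y _; apply: sume_ge0 => i _; rewrite lee_fin mulr_ge0.
- exact: emeasurable_sum.
- by apply/measurable_EFinP; exact: measurableT_comp.
- move=> y _; rewrite sumEFin lee_fin -mulr_sumr -[X in (_ <= X)%R]mulr1 ler_wpM2l//.
  exact: sum_dom_le1.
Qed.

Let f_lty : \int[mu]_x (`|f x|%R)%:E < +oo.
Proof. by have /integrableP[_] := f_int. Qed.

(** Duality: substituting [y = I p x] in each piece produces the weight [J y * psi y], which is 1
    wherever [f] can be nonzero. *)
Lemma integral_transfer (br : R -> tup -> tup) (O B : set tup) th :
  (forall p, measurable_fun setT (br p)) -> (forall p x, br p (I p x) = x) ->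
  (forall y, O y -> (J y * psi y = 1)%R) -> (forall y, ~ O y -> f y = 0%R) ->
  measurable B ->
  \int[mu]_(x in B) (transfer th x)%:E =
  \int[mu]_y (f y * \sum_(i < N) (dom (sh (q0 th) i) y)%:R * \1_B (br (sh (q0 th) i) y))%:E.
Proof.
move=> mbr brI JO fO mB; pose p i := sh (q0 th) i.
have ipc i : mu.-integrable setT (fun x => (piece (p i) x)%:E).
  apply/integrableP; split.
    apply/measurable_EFinP.
    exact: (measurableT_comp measurable_piece (pair1_measurable (p i))).
  apply: le_lt_trans f_lty; apply: (le_trans (integral_abs_piece (p i))).
  apply: ge0_le_integral => //.
  - apply/measurable_EFinP; apply: measurable_funM; [exact: measurableT_comp|exact: measurable_dom].
  - by apply/measurable_EFinP; exact: measurableT_comp.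
  - by move=> y _; rewrite lee_fin -[X in (_ <= X)%R]mulr1 ler_wpM2l// lern1 leq_b1.
have m1 i : measurable_fun setT (fun y => (dom (p i) y)%:R * \1_B (br (p i) y) : R)%R.
  apply: measurable_funM; first exact: measurable_dom.
  exact: (measurableT_comp (measurable_indic mB)).
have ifi i : mu.-integrable setT (fun y => (f y * ((dom (p i) y)%:R * \1_B (br (p i) y)))%:E).
  apply: le_integrable f_int => //.
    by apply/measurable_EFinP; exact: measurable_funM.
  move=> y _; rewrite /= lee_fin normrM -[X in (_ <= X)%R]mulr1 ler_wpM2l// indicE.
  by case: (dom _ _); case: (_ \in _); rewrite ?mulr1 ?mulr0 ?normr1 ?normr0.
have -> : \int[mu]_(x in B) (transfer th x)%:E = \sum_(i < N) \int[mu]_(x in B) (piece (p i) x)%:E.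
  under eq_integral do rewrite /transfer -sumEFin.
  rewrite integral_sum// => i; exact: integrableS (ipc i).
have -> : \int[mu]_y (f y * \sum_(i < N) (dom (p i) y)%:R * \1_B (br (p i) y))%:E =
    \sum_(i < N) \int[mu]_y (f y * ((dom (p i) y)%:R * \1_B (br (p i) y)))%:E.
  rewrite -integral_sum//; apply: eq_integral => y _.
  by rewrite sumEFin -mulr_sumr.
apply: eq_bigr => i _.
pose Q y := (f y * ((dom (p i) y)%:R * \1_B (br (p i) y)) * psi y)%R.
have mQ : measurable_fun setT Q.
  by apply: measurable_funM => //; exact: measurable_funM.
have := integral_I (p i) mQ; rewrite [RHS](_ : _ =
  \int[mu]_y (f y * ((dom (p i) y)%:R * \1_B (br (p i) y)))%:E); last first.
  apply: eq_integral => y _; congr EFin; rewrite /Q.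
  have [Oy|nOy] := pselect (O y); last by rewrite fO// !mul0r.
  by rewrite -mulrA [(psi y * _)%R]mulrC JO// mulr1.
move=> <-; rewrite integral_mkcond; apply: eq_integral => x _.
rewrite /Q WI addrK brI patchE /= indicE /piece /fpsi.
by case: (x \in B); case: (_ < _)%R; rewrite ?mulr1 ?mulr0 ?mul1r ?mul0r.
Qed.

Lemma mu_preimage_I p B : measurable B -> mu B = 0 -> mu [set x | B (I p x)] = 0.
Proof.
move=> mB B0.
have mIp : measurable_fun setT (I p) by exact: (measurableT_comp mI (pair1_measurable p)).
have mIB : measurable [set x | B (I p x)].
  by rewrite -[X in measurable X]setTI; exact: mIp.
have := @integral_indic _ _ _ mu setT measurableT _ mIB; rewrite setIT => <-.
have -> : \int[mu]_x (\1_[set x | B (I p x)] x)%:E = \int[mu]_x (\1_B (I p x))%:E :> \bar R.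
  by apply: eq_integral => x _; rewrite !indicE; congr (_%:R)%:E; apply/idP/idP; rewrite !inE.
rewrite (I_cov p (Q := fun y => (\1_B y)%:E))//; last exact/measurable_EFinP.
rewrite -[RHS](@null_set_integral _ _ _ mu B (fun y => (J y)%:E))//; last first.
  by apply: measurable_funTS; exact/measurable_EFinP.
rewrite [RHS]integral_mkcond; apply: eq_integral => y _.
by rewrite patchE indicE; case: ifP => _; rewrite ?mul1e ?mul0e.
Qed.

Lemma integral_osc_transfer (e rho : R) : (0 < e < ell)%R -> (0 < rho)%R ->
  (e + K * rho <= ell)%R ->
  \int[mu]_x osc mu (avg H transfer) (eball x e) <= lybound e rho.
Proof.
move=> /andP[e0 el] rho0 rhoK.
(* Pairs for which some preimage of the point leaves the good set of [f]; the union runs over all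
   natural [i], and countability keeps each section null. *)
pose Z : set (R * tup) := \bigcup_i [set q | ~ G (I (sh (q0 q.1) i) q.2)].
pose b th x := \sum_(i < N) (bnd e (sh (q0 th) i) (I (sh (q0 th) i) x) *
   ((J (I (sh (q0 th) i) x))^-1)%:E).
have [mG G0 _] := gG.
have mIs i : measurable_fun setT (fun q : R * tup => I (sh (q0 q.1) i) q.2).
  exact: (measurableT_comp mI (msh i)).
have mZ : measurable Z.
  apply: bigcup_measurable => i _.
  rewrite -[X in measurable X]setTI.
  by apply: (mIs i measurableT (~` G)); exact: measurableC.
apply: (@integral_osc_avg _ _ mu H transfer _ hH measurable_transfer f_lty transfer_L1 e Z b) => //.
- move=> th; have -> : [set x | Z (th, x)] =
      \bigcup_i [set x | (~` G) (I (sh (q0 th) i) x)] by [].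
  have mi i : measurable [set x | (~` G) (I (sh (q0 th) i) x)].
    rewrite -[X in measurable X]setTI.
    apply: (measurableT_comp mI (pair1_measurable (sh (q0 th) i))) => //; exact: measurableC.
  apply/negligibleP; first exact: bigcup_measurable.
  apply: negligible_bigcup => i; apply/negligibleP => //.
  by apply: mu_preimage_I => //; exact: measurableC.
- apply: emeasurable_sum => i; apply: emeasurable_funM.
    have mIs2 : measurable_fun setT (fun q : R * tup =>
        (sh (q0 q.1) i, I (sh (q0 q.1) i) q.2)).
      apply/measurable_fun_pairP; split; last exact: mIs.
      exact: (measurableT_comp measurable_fst (msh i)).
    exact: (measurableT_comp (measurable_bnd e0) mIs2).
  by apply/measurable_EFinP; exact: (measurableT_comp mJV (mIs i)).
- move=> th x; apply: sume_ge0 => i _; rewrite mule_ge0 ?bnd_ge0// lee_fin invr_ge0 ltW//.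
- move=> th x z w nz nw xz xw; rewrite /transfer -sumrB.
  apply: (@le_trans _ _ (\sum_(i < N) (`|piece (sh (q0 th) i) z - piece (sh (q0 th) i) w|%R)%:E)).
    by rewrite sumEFin lee_fin; exact: ler_norm_sum.
  apply: lee_sum => i _; apply: piece_osc => //.
    by apply: contrapT => h; apply: nz; exists (i : nat).
  by apply: contrapT => h; apply: nw; exists (i : nat).
- by move=> th; exact: integral_bnd_le.
Qed.

Lemma ex_transfer (br : R -> tup -> tup) (O : set tup) :
  (forall p, measurable_fun setT (br p)) -> (forall p x, br p (I p x) = x) ->
  (forall y, O y -> (J y * psi y = 1)%R) -> (forall y, ~ O y -> f y = 0%R) ->
  exists g : tup -> R, [/\ measurable_fun setT g, mu.-integrable setT (EFin \o g),
    forall B, measurable B -> \int[mu]_(x in B) (g x)%:E =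
      \int[lebesgue_measure]_th ((H th)%:E * \int[mu]_y (f y *
        \sum_(i < N) (dom (sh (q0 th) i) y)%:R * \1_B (br (sh (q0 th) i) y))%:E),
    \int[mu]_x (`|g x|%R)%:E <= \int[mu]_x (`|f x|%R)%:E &
    forall e rho : R, (0 < e < ell)%R -> (0 < rho)%R -> (e + K * rho <= ell)%R ->
      \int[mu]_x osc mu g (eball x e) <= lybound e rho].
Proof.
move=> mbr brI JO fO; have mT := measurable_transfer.
exists (avg H transfer); split.
- exact: (measurable_avg hH mT f_lty transfer_L1).
- exact: (integrable_avg hH mT f_lty transfer_L1).
- move=> B mB; rewrite (integral_avg hH mT f_lty transfer_L1)//.
  by apply: eq_integral => th _; rewrite (integral_transfer th mbr brI JO fO mB).
- exact: (avg_L1 hH mT f_lty transfer_L1).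
- exact: integral_osc_transfer.
Qed.

End random_shift.

End lasota_yorke.

(** * The map [Tmap] and its branches *)

Section dynamics.
Variables (R : realType) (n : nat) (L : R) (Phi0 : 'rV[R]_n.+1 -> R) (gam D Fm : R).
Variables (mu : {measure set (n.+1.-tuple R) -> \bar R}).
Local Notation tup := (n.+1.-tuple R).
Local Notation Ft := (@Ft R n L Phi0 gam D).
Local Notation branch := (@branch R n L Phi0 gam D).
Local Notation Omega := (@Omega R n.+1 gam L).
Local Notation Omega0 := (@Omega0 R n.+1 gam L).
Local Notation U := (@U R n.+1 Phi0 gam L).
Local Notation Tmap := (@Tmap R n.+1 Phi0 gam L).
Hypotheses (L0 : 0 < L) (gam0 : 0 < gam) (hmu : is_lebesgue mu)
  (mFt : measurable_fun setT Ft) (mbr : forall c, measurable_fun setT (branch c))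
  (Ft_null : forall c, mu [set y | Ft y = c] = 0%E)
  (Ft_le : forall y, Omega0 y -> `|Ft y| <= Fm).

Definition jump (th : R) (j : int) : R := 2 * j%:~R * L - th.

Lemma Omega0_coord y : Omega0 y <-> forall i : 'I_n.+1, `|tnth y i| < gam ^+ i * L.
Proof.
have h (i : 'I_n.+1) : (- L < gam ^- i * tnth y i < L) = (`|tnth y i| < gam ^+ i * L).
  have g : 0 < gam ^+ i by rewrite exprn_gt0.
  by rewrite -ltr_norml normrM normfV (gtr0_norm g) mulrC ltr_pdivrMr// mulrC.
by split=> H i; have := H i; rewrite mxE h.
Qed.

Lemma Omega_coord y : Omega y <-> forall i : 'I_n.+1, `|tnth y i| <= gam ^+ i * L.
Proof. by split=> H i; have := H i; rewrite ler_norml. Qed.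

Lemma Ft_Omega0 y : Omega0 y -> Ft y = Phi0 (Gam gam y).
Proof.
move=> Oy.
rewrite -[Ft y]/(Phi0 (cl L gam y) + sgd Phi0 * D * (tnth y ord0 - clip L (tnth y ord0))).
have -> : cl L gam y = Gam gam y.
  by apply/rowP => i; rewrite !mxE clip_id_lt// ltr_norml; have := Oy i; rewrite mxE.
have /Omega0_coord/(_ ord0) := Oy; rewrite expr0 mul1r => y0.
by rewrite clip_id_lt// subrr mulr0 addr0.
Qed.

Lemma U_Ft th j y : Omega0 y -> U th j y <-> `|Ft y - jump th j| < L.
Proof.
move=> Oy; rewrite Ft_Omega0// ltr_distl /jump; split.
  by move=> [_ /andP[h1 h2]]; apply/andP; split; lra.
by move=> /andP[h1 h2]; split => //; apply/andP; split; lra.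
Qed.

Lemma U_floor th j y : U th j y -> Num.floor ((th + Phi0 (Gam gam y) + L) / (2 * L)) = j.
Proof.
move=> [_ /andP[h1 h2]]; apply: floor_def; have l0 := L0.
rewrite ler_pdivlMr ?mulr_gt0// ltr_pdivrMr ?mulr_gt0// intrD.
by apply/andP; split; lra.
Qed.

Lemma Tmap_U th j y : U th j y -> Tmap th y = branch (jump th j) y.
Proof.
move=> Uy; rewrite /Defs.Tmap (U_floor Uy); case: asboolP => // _.
apply/eq_from_tnth => i; rewrite !tnth_mktuple; case: ifP => // _.
by rewrite Ft_Omega0 /jump; [congr (_ * _); ring|case: Uy].
Qed.

Lemma Tmap_out th y : (forall j, ~ U th j y) -> Tmap th y = y.
Proof. by move=> h; rewrite /Defs.Tmap; case: asboolP => // /h. Qed.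

Lemma Tmap_Omega th y : Omega y -> Omega (Tmap th y).
Proof.
move=> Oy; have [[j Uy]|/forallNP h] := pselect (exists j, U th j y); last by rewrite Tmap_out.
rewrite (Tmap_U Uy); apply/Omega_coord => i; have [yO _] := Uy.
have l0 := L0; have [ii|] := unliftP ord_max i.
  move=> ->; have -> : lift ord_max ii = widen_ord (leqnSn n) ii.
    by apply/val_inj => /=; rewrite /bump leqNgt ltn_ord add0n.
  have /Omega0_coord/(_ (lift ord0 ii)) := yO.
  rewrite branch_widen normrM normfV (gtr0_norm gam0) ler_pdivrMr//= => /ltW.
  by rewrite /bump /= add1n exprS -mulrA mulrC.
move=> ->; rewrite branch_last normrM gtr0_norm ?exprn_gt0// ler_pM2l ?exprn_gt0//.
by apply/ltW/U_Ft.
Qed.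

Lemma measurable_Omega0 : measurable Omega0.
Proof.
have -> : Omega0 = \bigcap_(i in [set: 'I_n.+1])
    ((@tnth n.+1 R ^~ i) @^-1` `](- (gam ^+ i * L)), (gam ^+ i * L)[%classic).
  apply/seteqP; split => y.
    by move/Omega0_coord => h i _ /=; rewrite in_itv /= -ltr_norml.
  by move=> h; apply/Omega0_coord => i; have := h i Logic.I; rewrite /= in_itv /= -ltr_norml.
apply: fin_bigcap_measurable => // i _; rewrite -[X in measurable X]setTI.
exact: measurable_tnth.
Qed.

Lemma measurable_Omega : measurable Omega.
Proof.
have -> : Omega = box [tuple - (gam ^+ i * L) | i < n.+1] [tuple gam ^+ i * L | i < n.+1].
  by apply/seteqP; split => y h i; have := h i; rewrite !tnth_mktuple.
exact: measurable_box.
Qed.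

Lemma OmegaD_null : mu (Omega `\` Omega0) = 0%E.
Proof.
have mO := measurableD measurable_Omega measurable_Omega0.
apply/negligibleP => //.
pose hp (s : R) (i : 'I_n.+1) := [set x : tup | tnth x i = s * (gam ^+ i * L)].
apply: (@negligibleS _ _ _ _ (\big[setU/set0]_(i < n.+1) (hp 1 i `|` hp (-1) i))); last first.
  elim/big_ind: _ => [|A B nA nB|i _]; first exact: negligible_set0.
    exact: negligibleU.
  by apply: negligibleU; apply/negligibleP; [exact: measurable_hyperplane|exact: hyperplane_null|
    exact: measurable_hyperplane|exact: hyperplane_null].
move=> y [/Omega_coord Oy] /Omega0_coord/existsNP[i /negP yi].
rewrite -bigcup_mkord_ord; exists i => //=; rewrite inord_val.
have yE : `|tnth y i| = gam ^+ i * L by apply/eqP; rewrite eq_le Oy /= leNgt.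
have [y0|y0] := leP 0 (tnth y i); rewrite /hp /= -yE; [left|right].
  by rewrite ger0_norm// mul1r.
by rewrite ltr0_norm// mulN1r opprK.
Qed.

Lemma UE th j : U th j = Omega0 `&` Ft @^-1` `](jump th j - L), (jump th j + L)[%classic.
Proof.
apply/seteqP; split => y.
  by move=> Uy; have [Oy _] := Uy; split => //=; rewrite in_itv/= -ltr_distl; exact/U_Ft.
by move=> [Oy] /=; rewrite in_itv/= -ltr_distl => h; exact/U_Ft.
Qed.

Lemma measurable_U th j : measurable (U th j).
Proof.
rewrite UE; apply: measurableI; first exact: measurable_Omega0.
by rewrite -[X in measurable X]setTI; exact: mFt.
Qed.

Lemma measurable_Tmap th (B : set tup) : measurable B -> measurable (Tmap th @^-1` B).
Proof.
move=> mB; have -> : Tmap th @^-1` B = (B `&` ~` \bigcup_j U th j) `|`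
    \bigcup_j (U th j `&` branch (jump th j) @^-1` B).
  apply/seteqP; split => y.
    move=> By; have [[j Uy]|/forallNP h] := pselect (exists j, U th j y).
      by right; exists j => //; split => //=; rewrite -(Tmap_U Uy).
    by left; split; [rewrite -(Tmap_out h)|move=> [j _ /h]].
  move=> [[By h]|[j _ [Uy By]]]; rewrite /preimage /= ?(Tmap_U Uy)//.
  by rewrite Tmap_out// => j Uy; apply: h; exists j.
apply: measurableU.
  apply: measurableI => //; apply: measurableC.
  by apply: countable_bigcupT_measurable => // j; exact: measurable_U.
apply: countable_bigcupT_measurable => // j; apply: measurableI; first exact: measurable_U.
by rewrite -[X in measurable X]setTI; exact: mbr.
Qed.

(* The points of [Omega0] lying in no [U th j]; there [Tmap] is the identity by convention,
   whereas the sum over the branches vanishes. *)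
Definition resonant th : set tup := \bigcup_j [set y | Ft y = jump th j - L].

Lemma resonant_null th : mu.-negligible (resonant th).
Proof.
have mF c : measurable [set y | Ft y = c].
  have -> : [set y | Ft y = c] = setT `&` Ft @^-1` [set c] by rewrite setTI.
  exact: mFt.
pose F (i : nat) := [set y | Ft y = jump th (Posz i) - L] `|` [set y | Ft y = jump th (Negz i) - L].
apply: (@negligibleS _ _ _ _ (\bigcup_i F i)).
  by move=> y [[i|i] _ h]; exists i => //; [left|right].
by apply: negligible_bigcup => i; apply: negligibleU; apply/negligibleP => //; exact: Ft_null.
Qed.

(** The margin 3 covers the rounding in [Num.trunc], the rounding in the floor of [th / (2 L)], and
    the half-width [L] of the strips. *)
Definition nmax : nat := (Num.trunc (Fm / (2 * L))).+3.

(* The indices [j] of the [U th j] that meet [Omega0] are at most [nmax] away from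
   [floor (th / (2 L))], so that the number of branches does not depend on [th]. *)
Definition base_shift (th : R) : R :=
  gam ^+ n * jump th (Num.floor (th / (2 * L)) - Posz nmax).

Lemma measurable_base_shift : measurable_fun setT base_shift.
Proof.
apply: measurable_funM => //; apply: measurable_funB => //.
apply: measurable_funM => //; apply: measurable_funM => //.
apply: nondecreasing_measurable => // s t st; rewrite ler_int lerB//.
by apply: le_floor; rewrite ler_pM2r// invr_gt0 mulr_gt0.
Qed.

Lemma sh_jump th i : sh (gam ^+ n * L) (base_shift th) i =
  gam ^+ n * jump th (Num.floor (th / (2 * L)) - Posz nmax + Posz i).
Proof. by rewrite /sh /base_shift /jump !intrD /=; ring. Qed.

(** Exactly one [j] puts [y] in [U th j], so a single term survives. Resonance is the case of
    equality in the lower bound given by the floor, where the strict inequality defining [U]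
    fails. *)
Lemma sum_branches th (B : set tup) y : Omega0 y -> ~ resonant th y ->
  \sum_(i < nmax.*2.+1)
     (`|gam ^+ n * Ft y - sh (gam ^+ n * L) (base_shift th) i| < gam ^+ n * L)%R%:R *
     \1_B (branch (sh (gam ^+ n * L) (base_shift th) i / gam ^+ n) y) = \1_B (Tmap th y) :> R.
Proof.
move=> Oy nres; have g0 : 0 < gam ^+ n by rewrite exprn_gt0.
set fl := Num.floor (th / (2 * L)).
have domE i : (`|gam ^+ n * Ft y - sh (gam ^+ n * L) (base_shift th) i| < gam ^+ n * L)%R =
    (`|Ft y - jump th (fl - Posz nmax + Posz i)| < L).
  by rewrite sh_jump -mulrBr normrM (gtr0_norm g0) ltr_pM2l.
have brE i : branch (sh (gam ^+ n * L) (base_shift th) i / gam ^+ n) y =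
    branch (jump th (fl - Posz nmax + Posz i)) y.
  by rewrite sh_jump mulrC mulKf// gt_eqF.
pose j := Num.floor ((th + Ft y + L) / (2 * L)).
have l0 := L0; have l2 : 0 < 2 * L by lra.
have Uj : U th j y.
  apply/U_Ft => //; have := floor_itv ((th + Ft y + L) / (2 * L)); rewrite -/j.
  rewrite ler_pdivlMr// ltr_pdivrMr// intrD => /andP[h1 h2].
  have h3 : Ft y != jump th j - L by apply/eqP => h; apply: nres; exists j.
  have h4 : jump th j - L < Ft y by rewrite lt_neqAle eq_sym h3 /jump; lra.
  by rewrite ltr_distl; apply/andP; split => //; rewrite /jump; lra.
have jE j' : (`|Ft y - jump th j'| < L) = (j' == j).
  apply/idP/eqP => [h|->]; last exact/U_Ft.
  have /U_floor <- : U th j' y by exact/U_Ft.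
  by rewrite /j Ft_Omega0.
have [i0 i0E] : exists i : 'I_(nmax.*2.+1), fl - Posz nmax + Posz i = j.
  have /(U_Ft _ _ Oy) := Uj; rewrite ltr_distl => /andP[j1 j2].
  have := floor_itv (th / (2 * L)); rewrite -/fl ler_pdivlMr// ltr_pdivrMr// intrD => /andP[f1 f2].
  have := Ft_le Oy; rewrite ler_norml => /andP[u1 u2].
  have : Fm / (2 * L) < nmax%:R - 2.
    rewrite /nmax -addn3 natrD; have := truncnS_gt (Fm / (2 * L)); rewrite -natr1; lra.
  rewrite ltr_pdivrMr// => u3; rewrite /jump in j1 j2.
  have k1 : j - fl < Posz nmax.
    by rewrite -(ltr_int R) intrB -(ltr_pM2r l2); lra.
  have k2 : - Posz nmax < j - fl.
    by rewrite -(ltr_int R) intrB rmorphN /= -(ltr_pM2r l2); lra.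
  have il : (`|(j - fl + Posz nmax)%R|%N < nmax.*2.+1)%N by lia.
  by exists (Ordinal il) => /=; lia.
rewrite (bigD1 i0)//= domE jE i0E eqxx brE i0E mul1r big1 ?addr0; last first.
  move=> i ii0; rewrite domE jE; case: eqP => [h|_]; last by rewrite mul0r.
  exfalso; move/eqP: ii0; apply; apply/val_inj => /=.
  by move: h; rewrite -i0E => /addrI [].
by rewrite (Tmap_U Uj).
Qed.

End dynamics.

(** * The Perron-Frobenius operator and the final inequality *)

Section perron_frobenius.
Variables (R : realType) (n : nat).
Variables (mu : {sigma_finite_measure set (n.+1.-tuple R) -> \bar R})
  (nu : {measure set (n.-tuple R) -> \bar R}).
Hypotheses (hmu : is_lebesgue mu) (hnu : is_lebesgue nu).
Variables (L beta : R) (Phi0 : 'rV[R]_n.+1 -> R) (sigma C1 C2 gam : R) (H : R -> R).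
Hypotheses (n0 : (0 < n)%N) (L0 : 0 < L) (beta0 : 0 < beta)
  (hC2 : C2_on (ocube (L + beta)) Phi0) (sig : 81 < sigma) (C1gt : 1 < C1) (C2gt : 1 < C2)
  (gam0 : 0 < gam) (gamE : gam ^- 2 = C1 * sigma)
  (hd : forall x, ocube (L + beta) x -> C1 ^+ n * C2 * sigma ^+ n.+1 <= pd ord0 Phi0 x ^+ 2)
  (hb : forall x (j : 'I_n.+1), ocube (L + beta) x -> j != ord0 ->
     pd j Phi0 x ^+ 2 <= (C1 - 1) * (C2 - 1) / n%:R * sigma)
  (hH : prob_density H).
Local Notation tup := (n.+1.-tuple R).
Local Notation ell := (gam ^+ n * L).

Lemma ex_operator : exists A K : R, [/\ 0 <= A, 0 < K,
  forall th B, measurable B -> measurable (Tmap Phi0 gam L th @^-1` B) &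
  forall f : tup -> R, measurable_fun setT f -> mu.-integrable setT (EFin \o f) ->
    (forall y, ~ Omega0 gam L y -> f y = 0) ->
    exists g : tup -> R, [/\ isPf mu H (Tmap Phi0 gam L) f g,
      (L1norm mu g <= L1norm mu f)%E &
      forall e rho : R, 0 < e < ell -> 0 < rho -> e + K * rho <= ell ->
        (\int[mu]_x osc mu g (eball x e) <= lybound mu A f e rho)%E]].
Proof.
have c10 : 0 < C1 by exact: lt_trans C1gt.
have c20 : 0 < C2 by exact: lt_trans C2gt.
have s0 : 0 < sigma by exact: lt_trans sig.
have g0 : 0 < gam ^+ n by rewrite exprn_gt0.
pose D := Num.sqrt (C1 ^+ n * C2 * sigma ^+ n.+1).
have DD0 : 0 < C1 ^+ n * C2 * sigma ^+ n.+1 by rewrite !mulr_gt0// exprn_gt0.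
have D0 : 0 < D by rewrite sqrtr_gt0.
have D2 : D ^+ 2 = C1 ^+ n * C2 * sigma ^+ n.+1 by rewrite sqr_sqrtr// ltW.
pose B := (C1 - 1) * (C2 - 1) / n%:R * sigma.
have hD x : ccube L x -> D ^+ 2 <= pd ord0 Phi0 x ^+ 2.
  by move=> /(sub_ccube beta0) /hd; rewrite D2.
have hB x (j : 'I_n.+1) : ccube L x -> j != ord0 -> pd j Phi0 x ^+ 2 <= B.
  by move=> /(sub_ccube beta0) /hb; exact.
have nn0 : n%:R != 0 :> R by rewrite pnatr_eq0 -lt0n.
have BE : n%:R * B = (C1 - 1) * (C2 - 1) * sigma by rewrite /B; field.
have gs : gam ^+ 2 * (C1 * sigma) = 1.
  by rewrite -gamE mulfV// expf_neq0// gt_eqF.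
(* The powers of [C1] and [sigma] in the lower bound on the first derivative are exactly those that
   the [n] factors [gam ^+ 2] cancel. *)
have DE : (gam ^+ n * D) ^+ 2 = C2 * sigma.
  rewrite exprMn D2 -exprM mulnC exprM [sigma ^+ n.+1]exprS.
  have -> : (gam ^+ 2) ^+ n * (C1 ^+ n * C2 * (sigma * sigma ^+ n)) =
     (gam ^+ 2 * (C1 * sigma)) ^+ n * (C2 * sigma) by rewrite !exprMn; ring.
  by rewrite gs expr1n mul1r.
pose Ftt := @Ft R n L Phi0 gam D.
pose W y := gam ^+ n * Ftt y.
pose J := @Jac R n L Phi0 gam D.
pose ps := @psi R n L Phi0 gam.
pose I p x := ibranch L0 beta0 gam0 hC2 D0 hD hB (p / gam ^+ n) x.
pose br p y := @branch R n L Phi0 gam D (p / gam ^+ n) y.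
have [M [M0 hM]] := ex_slope_bound L0 beta0 hC2 D0 hD.
have [A' [A'0 hA']] := Jac_psi_le L0 beta0 gam0 hC2 D0 hD.
have [K [K0 hK]] := branch_e1shift_le L0 beta0 gam0 hC2 D0 hD hB.
have [cPhi _ _ _ _] := hC2.
have [Fm [Fm0 hFm]] := ccube_bounded beta0 cPhi.
have mFt : measurable_fun setT Ftt by exact: (measurable_Ft gam L0 beta0 hC2 D0 hD hB).
have mbrc c : measurable_fun setT (@branch R n L Phi0 gam D c).
  exact: (measurable_branch gam L0 beta0 hC2 D0 hD hB).
have mW : measurable_fun setT W by exact: measurable_funM.
have ell0 : 0 < ell by rewrite mulr_gt0.
have mI : measurable_fun setT (fun q : R * tup => I q.1 q.2).
  have mp : measurable_fun setT (fun q : R * tup => (q.1 / gam ^+ n, q.2)).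
    apply/measurable_fun_pairP; split; last exact: measurable_snd.
    by apply: measurable_funM => //; exact: measurable_fst.
  exact: (measurableT_comp (measurable_ibranch L0 beta0 gam0 hC2 D0 hD hB C1gt C2gt sig gamE DE BE) mp).
have brI p x : br p (I p x) = x by exact: ibranchK.
have WI p x : W (I p x) = tnth x ord_max + p.
  rewrite -[in RHS](brI p x) branch_last /W -/Ftt mulrBr [X in _ - X]mulrC divfK ?subrK//.
  by rewrite gt_eqF.
have eball_I p x z (e : R) : eball x e z -> eball (I p x) (e / 9) (I p z).
  exact: (eball_ibranch L0 beta0 gam0 hC2 D0 hD hB C1gt C2gt sig gamE DE BE).
have I_cov p (Q : tup -> \bar R) : measurable_fun setT Q -> (forall y, 0 <= Q y)%E ->
     (\int[mu]_x Q (I p x) = \int[mu]_y (Q y * (J y)%:E))%E.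
  exact: (ge0_integral_ibranch L0 beta0 gam0 hC2 D0 hD hB C1gt C2gt sig gamE DE BE hmu hnu).
have mJ : measurable_fun setT J by exact: (measurable_Jac L0 beta0 gam0 hC2 D0 hD).
have mps : measurable_fun setT ps by exact: (measurable_psi L0 beta0 gam0 hC2 D0 hD).
have mJV : measurable_fun setT (fun y => (J y)^-1).
  rewrite (_ : (fun _ => _) = (fun y => if `|tnth y ord0| < L then ps y else D^-1)); last first.
    by apply/funext => y; rewrite /J /Jac; case: ifP.
  apply: measurable_fun_ifT => //; apply: measurable_fun_ltr => //.
  by apply: measurableT_comp => //; exact: measurable_tnth.
have JD y : D <= J y by exact: (Jac_ge gam L0 beta0 hC2 D0 hD).
have J0 y : 0 < J y by exact: lt_le_trans D0 (JD y).
have ps0 y : 0 < ps y by exact: (psi_gt0 gam L0 beta0 hC2 D0 hD).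
have JS y : J y <= slope L Phi0 gam y by exact: (Jac_le_slope gam L0 beta0 hC2 D0 hD).
have S0 y : 0 < slope L Phi0 gam y by exact: (slope_gt0 gam L0 beta0 hC2 D0 hD).
have Jps y : J y * ps y <= 1 by rewrite /ps /psi ler_pdivrMr// mul1r.
have JM y : J y <= M by apply: (le_trans (JS y)); apply: hM; exact: ccube_cl.
(* [A'] controls the variation of [psi] multiplied by [D]; the bound needed has [J] in place of [D],
   and [J] is at most [M]. *)
pose A := A' * M / D.
have A0 : 0 <= A by rewrite /A divr_ge0 ?mulr_ge0// ltW.
have psi_lip y z (e : R) : 0 < e -> eball y e z -> J y * `|ps z - ps y| <= A * e.
  move=> e0 yz; apply: (@le_trans _ _ (M * `|ps z - ps y|)); first by rewrite ler_wpM2r.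
  have := hA' _ _ _ e0 yz; rewrite -ler_pdivlMr// => h.
  apply: (@le_trans _ _ (M * (A' * e / D))); first by rewrite ler_wpM2l// ltW.
  by rewrite /A le_eqVlt; apply/orP; left; apply/eqP; ring.
have W9 y (s t : R) : s <= t -> 9 * (t - s) <= `|W (e1shift t y) - W (e1shift s y)|.
  exact: (branch_e1shift L0 beta0 gam0 hC2 D0 hD hB C2gt sig DE).
have Ft_null c : mu [set y | Ftt y = c] = 0%E.
  rewrite -[RHS](level_set_null hmu mW mI WI I_cov mJV J0 (gam ^+ n * c)); congr (mu _).
  apply/seteqP; split => y; rewrite /W /=; first by move=> ->.
  by move/mulfI; apply; rewrite gt_eqF.
have Ft_le y : Omega0 gam L y -> `|Ftt y| <= Fm.
  move=> Oy; rewrite /Ftt Ft_Omega0//; apply: hFm => i; have /andP[h1 h2] := Oy i.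
  by rewrite !ltW.
exists A, K; split => // [th E mE|f mf f_int fO].
  exact: (measurable_Tmap L0 gam0 mFt mbrc).
have [G gG] := ex_goodset mu mf.
have mq0 := @measurable_base_shift R n L gam Fm L0.
have JO y : Omega0 gam L y -> J y * ps y = 1.
  move=> /(Omega0_coord L gam0)/(_ ord0); rewrite expr0 mul1r => y0.
  by rewrite /J /Jac y0 mulfV// gt_eqF.
have mbr p : measurable_fun setT (br p) by exact: mbrc.
have [g [mg ig gE gL gO]] := ex_transfer hmu ell0 mW mI WI eball_I I_cov mJ mJV J0 mps ps0 Jps
  A0 psi_lip W9 K0 hK mf gG (nmax L Fm).*2.+1 mq0 hH f_int mbr brI JO fO.
exists g; split; [split; [exact: mg|exact: ig|]|exact: gL|exact: gO].
move=> E mE; rewrite (gE E mE).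
apply: eq_integral => th _; congr (_ * _)%E.
have mT := measurable_Tmap L0 gam0 mFt mbrc th mE.
rewrite [RHS](_ : _ = \int[mu]_y (f y * \1_E (Tmap Phi0 gam L th y))%:E)%E; last first.
  rewrite integral_mkcond; apply: eq_integral => y _; rewrite patchE indicE.
  have -> : (y \in Tmap Phi0 gam L th @^-1` E) = (Tmap Phi0 gam L th y \in E).
    by apply/idP/idP; rewrite !inE.
  by case: ifP => _; rewrite ?mulr1 ?mulr0.
apply: ae_eq_integral => //.
- apply/measurable_EFinP; apply: measurable_funM => //; apply: measurable_sum => i.
  apply: measurable_funM; first exact: measurable_dom.
  exact: (measurableT_comp (measurable_indic mE)).
- apply/measurable_EFinP; apply: measurable_funM => //.
  have -> : (fun y => \1_E (Tmap Phi0 gam L th y) : R) = \1_(Tmap Phi0 gam L th @^-1` E).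
    by apply/funext => y; rewrite !indicE; congr (_%:R); apply/idP/idP; rewrite !inE.
  exact: measurable_indic.
apply: (@negligibleS _ _ _ _ (resonant L Phi0 gam D th)); last exact: resonant_null.
move=> y /= h; apply: contrapT => nres; apply: h => _; congr EFin.
have [Oy|/fO ->] := pselect (Omega0 gam L y); last by rewrite !mul0r.
by congr (_ * _); exact: sum_branches.
Qed.

Lemma ae_eq_EFin (f g : tup -> R) : ae_eq mu setT (EFin \o f) (EFin \o g) ->
  exists G, [/\ measurable G, mu (~` G) = 0%E & {in G, f =1 g}].
Proof.
move=> [N [mN N0 hN]]; exists (~` N); split; [exact: measurableC|by rewrite setCK|].
move=> x; rewrite inE => nNx; apply: contrapT => fg; apply: nNx; apply: hN => /= h.
by apply: fg; have [] := h Logic.I.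
Qed.

Lemma L1norm_ae_eq (f g : tup -> R) : measurable_fun setT f -> measurable_fun setT g ->
  ae_eq mu setT (EFin \o f) (EFin \o g) -> L1norm mu f = L1norm mu g.
Proof.
move=> mf mg fg; apply: ge0_ae_eq_integral => //.
- by apply/measurable_EFinP; exact: measurableT_comp.
- by apply/measurable_EFinP; exact: measurableT_comp.
- by move: fg; apply: filterS => x h xT; have [->] := h xT.
Qed.

(** Both radii [e / 9] and [8/9 e0 + e / 9] are below [e0], so the seminorm controls both
    oscillations. With [A * e <= 1/10] the coefficient of [s] is at most [(6/5) / 9 + (11/10) / 2],
    which is below [9/10]; the division by [rho] leaves the term in [e0^-1]. *)
Lemma lybound_le (A e0 e : R) (f : tup -> R) (s l : R) : 0 <= A -> A * e0 <= 1 / 10 ->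
  0 < e < e0 -> 0 <= s -> 0 <= l ->
  (seminorm1 mu e0 f = s%:E)%E -> (L1norm mu f = l%:E)%E ->
  (lybound mu A f e (8 / 9 * e0) <= (e * (9 / 10 * s + (A + e0^-1) * l))%:E)%E.
Proof.
move=> A0 Ae0 he s0 l0 sE lE; have /andP[e_gt0 ee0] := he.
have e0_gt0 : 0 < e0 by exact: lt_trans ee0.
have Ae : 0 <= A * e <= 1 / 10.
  by rewrite mulr_ge0 ?(ltW e_gt0)//=; apply: le_trans Ae0; rewrite ler_wpM2l// ltW.
have o1 : (\int[mu]_x osc mu f (eball x (e / 9)) <= (e / 9 * s)%:E)%E.
  by rewrite EFinM -sE; apply: integral_osc_le; apply/andP; split; lra.
have o2 : (\int[mu]_x osc mu f (eball x (8 / 9 * e0 + e / 9)) <= (e0 * s)%:E)%E.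
  apply: (@le_trans _ _ ((8 / 9 * e0 + e / 9) * s)%:E).
    by rewrite EFinM -sE; apply: integral_osc_le; apply/andP; split; lra.
  by rewrite lee_fin ler_wpM2r//; lra.
rewrite /lybound; move: lE; rewrite /L1norm => ->.
set a := 1 + 2 * (A * e); set c := 4 * (1 + A * e) * (e / 9) / (8 / 9 * e0).
have cE : c = e * ((1 + A * e) / 2) * e0^-1.
  by rewrite /c; field; rewrite gt_eqF.
have c0 : 0 <= c by rewrite cE !mulr_ge0 ?invr_ge0//; lra.
apply: (@le_trans _ _ (a * (e / 9 * s) + A * e * l + c * (l + e0 * s))%:E).
  rewrite [leRHS](_ : _ = a%:E * (e / 9 * s)%:E + (A * e)%:E * l%:E +
    c%:E * (l%:E + (e0 * s)%:E))%E//.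
  apply: leeD; first apply: leeD => //.
  - by apply: lee_wpmul2l; rewrite // lee_fin /a; lra.
  - by apply: lee_wpmul2l; rewrite ?lee_fin//; exact: leeD2l.
have -> : c * (l + e0 * s) = e * ((1 + A * e) / 2 * (e0^-1 * l) + (1 + A * e) / 2 * s).
  by rewrite cE; field; rewrite gt_eqF.
have i0 : 0 <= e0^-1 * l by rewrite mulr_ge0// invr_ge0 ltW.
have -> : a * (e / 9 * s) + A * e * l + e * ((1 + A * e) / 2 * (e0^-1 * l) + (1 + A * e) / 2 * s) =
  e * ((a / 9 + (1 + A * e) / 2) * s + A * l + (1 + A * e) / 2 * (e0^-1 * l)).
  by field; rewrite gt_eqF.
rewrite lee_fin ler_pM2l// [(A + _) * l]mulrDl; move: i0; set q := e0^-1 * l => q0.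
have h1 : (a / 9 + (1 + A * e) / 2) * s <= 9 / 10 * s by rewrite ler_wpM2r// /a; lra.
have h2 : (1 + A * e) / 2 * q <= 1 * q by rewrite ler_wpM2r//; lra.
lra.
Qed.

Lemma seminorm1_ge0 (e0 : R) (f : tup -> R) : 0 < e0 -> measurable_fun setT f ->
  (0 <= seminorm1 mu e0 f)%E.
Proof.
move=> e0_gt0 mf; have h : 0 < e0 / 2 by lra.
apply: (@le_trans _ _ (((e0 / 2)^-1)%:E * \int[mu]_x osc mu f (eball x (e0 / 2))))%E.
  rewrite mule_ge0 ?lee_fin ?invr_ge0 ?(ltW h)//; apply: integral_ge0 => x _.
  exact: (osc_ge0 hmu x mf h).
by apply: ereal_sup_ubound; exists (e0 / 2); split => //; lra.
Qed.

Lemma seminorm1_osc_eq (e0 : R) (f g : tup -> R) :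
  (forall e x, osc mu f (eball x e) = osc mu g (eball x e)) ->
  seminorm1 mu e0 f = seminorm1 mu e0 g.
Proof.
move=> fg.
have fgE e : (\int[mu]_x osc mu f (eball x e) = \int[mu]_x osc mu g (eball x e))%E.
  by apply: eq_integral => x _; exact: fg.
have sup_eq (F F' : R -> \bar R) : F = F' ->
  ereal_sup [set y : \bar R | exists e : R, 0 < e < e0 /\ y = ((e^-1)%:E * F e)%E] =
  ereal_sup [set y : \bar R | exists e : R, 0 < e < e0 /\ y = ((e^-1)%:E * F' e)%E] by move=> ->.
exact: (sup_eq _ _ (funext fgE)).
Qed.

Lemma L1norm_fin (f : tup -> R) : mu.-integrable setT (EFin \o f) ->
  exists2 l : R, (L1norm mu f = l%:E)%E & 0 <= l.
Proof.
move=> /integrableP[_ h]; have h0 : (0 <= L1norm mu f)%E by exact: integral_ge0.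
exists (fine (L1norm mu f)); last exact: fine_ge0.
by rewrite fineK// ge0_fin_numE.
Qed.

Lemma seminorm1_fin (e0 : R) (f : tup -> R) : 0 < e0 -> measurable_fun setT f ->
  (seminorm1 mu e0 f < +oo)%E -> exists2 s : R, (seminorm1 mu e0 f = s%:E)%E & 0 <= s.
Proof.
move=> e0_gt0 mf h; have h0 := seminorm1_ge0 e0_gt0 mf.
exists (fine (seminorm1 mu e0 f)); last exact: fine_ge0.
by rewrite fineK// ge0_fin_numE.
Qed.

Lemma lasota_yorke_inequality : exists e1 : R, 0 < e1 /\
  forall e0 : R, 0 < e0 < e1 ->
    exists eta C : R, [/\ 0 < eta < 1, 0 < C &
      forall f : tup -> R, inV1 mu (Omega gam L) e0 f ->
        (exists g, isPf mu H (Tmap Phi0 gam L) f g) /\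
        (forall g, isPf mu H (Tmap Phi0 gam L) f g ->
           inV1 mu (Omega gam L) e0 g /\
           (V1norm mu e0 g <= eta%:E * V1norm mu e0 f + C%:E * L1norm mu f)%E)].
Proof.
have [A [K [A0 K0 mT hop]]] := ex_operator.
have ell0 : 0 < ell by rewrite mulr_gt0// exprn_gt0.
(* The first bound yields [e + K * rho <= ell] for [rho = 8/9 e0], the second [A * e0 <= 1/10]. *)
pose e1 := Num.min (ell / (1 + K)) ((10 * (A + 1))^-1).
exists e1; split.
  have k1 : 0 < 1 + K by lra.
  have a1 : 0 < 10 * (A + 1) by lra.
  by rewrite lt_min divr_gt0//= invr_gt0.
move=> e0 /andP[e0_gt0]; rewrite lt_min => /andP[].
rewrite ltr_pdivlMr; last by lra.
rewrite -[(10 * _)^-1]mul1r ltr_pdivlMr; last by lra.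
move=> e0K e0A; have Ae0 : A * e0 <= 1 / 10 by nra.
have small e : 0 < e < e0 ->
    [/\ 0 < e < ell, 0 < 8 / 9 * e0 & e + K * (8 / 9 * e0) <= ell].
  by move=> /andP[h1 h2]; split; [apply/andP; split => //; nra|lra|nra].
have C0 : 0 < 1 + (A + e0^-1).
  have : 0 < e0^-1 by rewrite invr_gt0.
  by lra.
(* The seminorm estimate uses [A + e0^-1]; the extra 1 pays for the L1 norm of [g], which is at most
   that of [f]. *)
exists (9 / 10), (1 + (A + e0^-1)); split; [lra|exact: C0|].
move=> f [mf f_int fO f_semi].
(* [f] vanishes only almost everywhere off the closed box, whereas the operator was built for
   functions vanishing everywhere off the open box. The two versions differ on a null set, which
   changes neither oscillations nor [Pf]. *)
pose f' y := f y * \1_(Omega0 gam L) y.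
have mO0 := @measurable_Omega0 R n L gam gam0.
have mO := @measurable_Omega R n L gam.
have mf' : measurable_fun setT f'.
  by apply: measurable_funM; [exact: mf|exact: measurable_indic].
have f'_int : mu.-integrable setT (EFin \o f').
  apply: le_integrable f_int => //; first exact/measurable_EFinP.
  move=> y _; rewrite /= lee_fin /f' indicE; case: (_ \in _); rewrite ?mulr1// mulr0 normr0//.
have ff' : ae_eq mu setT (EFin \o f) (EFin \o f').
  have hO : {ae mu, forall y, Omega gam L y -> Omega0 gam L y}.
    exists (Omega gam L `\` Omega0 gam L); split; [exact: measurableD| |].
      exact: (OmegaD_null L gam0 hmu).
    by move=> y /= /not_implyP.
  move: fO hO; apply: filterS2 => y h1 h2 _; rewrite /= /f' indicE.
  case: (boolP (y \in _)); first by rewrite mulr1.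
  rewrite notin_setE => nO; rewrite mulr0 h1// => Oy; apply: nO; exact: h2.
have [G [mG G0 fG]] := ae_eq_EFin ff'.
have f'O y : ~ Omega0 gam L y -> f' y = 0 by move=> nO; rewrite /f' indicE memNset// mulr0.
have [g0 [[mg0 ig0 g0E] g0L g0osc]] := hop f' mf' f'_int f'O.
have Pf0 : isPf mu H (Tmap Phi0 gam L) f g0.
  split; [exact: mg0|exact: ig0|move=> B mB]; rewrite (g0E B mB); apply: eq_integral => th _; congr (_ * _)%E.
  apply: ae_eq_integral; [exact: mT| | |].
  - by apply: measurable_funTS; exact/measurable_EFinP.
  - by apply: measurable_funTS; exact/measurable_EFinP.
  - by move: ff'; apply: filterS => y h _; exact/esym/h.
split; first by exists g0.
move=> g [mg ig gE].
(* Any two representatives of [Pf] have the same integral over every measurable set, hence agree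
   almost everywhere; the estimate for [g0] thus passes to every [g]. *)
have g0g : ae_eq mu setT (EFin \o g0) (EFin \o g).
  apply: integral_ae_eq; [exact: measurableT|exact: ig0|exact/measurable_EFinP|].
  by move=> B _ mB; rewrite /= (gE B mB); case: Pf0 => _ _ /(_ B mB).
have [G' [mG' G'0 gG']] := ae_eq_EFin g0g.
have f'f_osc e x : osc mu f' (eball x e) = osc mu f (eball x e).
  by rewrite -(osc_ae_eq _ mG G0 fG).
have g0g_osc e x : osc mu g0 (eball x e) = osc mu g (eball x e).
  exact: (osc_ae_eq _ mG' G'0 gG').
have f'semi : seminorm1 mu e0 f' = seminorm1 mu e0 f.
  exact: (seminorm1_osc_eq e0 f'f_osc).
have [l lE l0] := L1norm_fin f_int.
have [s sE s0] := seminorm1_fin e0_gt0 mf f_semi.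
have gL : (L1norm mu g <= l%:E)%E.
  rewrite -(L1norm_ae_eq mg0 mg g0g) -lE (L1norm_ae_eq mf mf' ff'); exact: g0L.
have gS : (seminorm1 mu e0 g <= (9 / 10 * s + (A + e0^-1) * l)%:E)%E.
  apply: ge_ereal_sup => _ [e [he ->]]; have /andP[e_gt0 ee0] := he.
  have -> : (\int[mu]_x osc mu g (eball x e) = \int[mu]_x osc mu g0 (eball x e))%E.
    by apply: eq_integral => x _; exact/esym/g0g_osc.
  rewrite lee_pdivrMl; last exact: e_gt0.
  rewrite -EFinM.
  apply: (le_trans (g0osc e (8 / 9 * e0) _ _ _)).
  - by have [] := small e he.
  - by have [] := small e he.
  - by have [] := small e he.
  - apply: (lybound_le A0 Ae0 he s0 l0); first by rewrite f'semi.
    by rewrite -(L1norm_ae_eq mf mf' ff').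
split; last first.
  rewrite /V1norm lE sE; apply: (le_trans (leeD gL gS)).
  rewrite [leRHS](_ : _ = (9 / 10 * (l + s) + (1 + (A + e0^-1)) * l)%:E); last by [].
  by rewrite -EFinD lee_fin; lra.
split; [exact: mg|exact: ig| |by apply: (le_lt_trans gS); rewrite ltry].
have mOC := measurableC mO.
(* [Tmap] preserves the box, so the preimage of a set outside it is outside as well, where [f]
   vanishes almost everywhere; hence [g] has zero integral over every such set. *)
have : ae_eq mu (~` Omega gam L) (cst 0%E) (EFin \o g).
  apply: integral_ae_eq; [exact: mOC| | |].
  - exact: integrable0.
  - by apply: measurable_funTS; exact/measurable_EFinP.
  move=> B BO mB; rewrite integral0 /= (gE B mB); apply/esym.
  apply: integral0_eq => th _.
  rewrite (ae_eq_integral (cst 0%E)) ?integral0 ?mule0; [by []|exact: mT| |exact: measurable_cst|].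
  - by apply: measurable_funTS; exact/measurable_EFinP.
  - move: fO; apply: filterS => y h By; congr EFin; apply: h => Oy.
    (* The slope [1] is a placeholder: [Tmap] does not involve the extension. *)
    by apply: (BO _ By); exact: (@Tmap_Omega R n L Phi0 gam 1 L0 gam0 th y Oy).
by apply: filterS => y h /h [].
Qed.

End perron_frobenius.

Theorem theorem4p5 (R : realType)
  (leb : forall n : nat, {measure set (n.-tuple R) -> \bar R})
  (Hleb : forall n : nat, is_lebesgue (leb n))
  (k : nat) (L beta : R) (Phi0 : 'rV[R]_k -> R)
  (sigma C1 C2 gam : R) (H : R -> R) :
  (2 <= k)%N -> 0 < L -> 0 < beta ->
  C2_on (ocube (L + beta)) Phi0 ->
  S_k (unit_ball_vol leb) k (k + 2)%:R < sigma ->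
  1 < C1 -> 1 < C2 ->
  0 < gam -> gam ^- 2 = C1 * sigma ->
  (forall x (j : 'I_k), ocube (L + beta) x -> (j : nat) = 0%N ->
     C1 ^+ k.-1 * C2 * sigma ^+ k <= (pd j Phi0 x) ^+ 2) ->
  (forall x (j : 'I_k), ocube (L + beta) x -> (1 <= j)%N ->
     (pd j Phi0 x) ^+ 2 <= (C1 - 1) * (C2 - 1) / (k.-1)%:R * sigma) ->
  prob_density H ->
  exists e1 : R, 0 < e1 /\
    forall e0 : R, 0 < e0 < e1 ->
      exists eta C : R, [/\ 0 < eta < 1, 0 < C &
        forall f : k.-tuple R -> R, inV1 (leb k) (Omega gam L) e0 f ->
          (exists g, isPf (leb k) H (Tmap Phi0 gam L) f g) /\
          (forall g, isPf (leb k) H (Tmap Phi0 gam L) f g ->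
             inV1 (leb k) (Omega gam L) e0 g /\
             (V1norm (leb k) e0 g <=
                eta%:E * V1norm (leb k) e0 f + C%:E * L1norm (leb k) f)%E)].
Proof.
case: k Phi0 => [//|n] Phi0 n0 L0 beta0 hC2 hS C1gt C2gt gam0 gamE hd hb hH.
have sig : 81 < sigma by apply: lt_trans hS; exact: S_k_gt81.
apply: (@lasota_yorke_inequality R n (sf_lebesgue (Hleb n.+1)) (leb n) (Hleb n.+1) (Hleb n)
  L beta Phi0 sigma C1 C2 gam H) => //.
- by move=> x Ox; exact: hd.
- by move=> x j Ox j0; apply: hb => //; rewrite lt0n.
Qed.
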